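(* Let $e(CP_n)$ denote the number of edges of the random Catalan-pair graph $CP_n$. Then $$\mathbb{E}[e(CP_n)] \sim \frac{1}{\pi}\, n\log n \qquad (n\to\infty).$$ Moreover, for every $\epsilon>0$, $$\Pr\Big[\,\big|e(CP_n)-\tfrac{1}{\pi}n\log n\big|<\epsilon\, n\log n\,\Big]\to 1 \qquad (n\to\infty).$$
   Context: A Catalan-arc matching of size $m$ on $2m$ points $p_1<\dots<p_{2m}$ of a line is a perfect matching of these points (drawn as semicircular arcs on one side of the line) with no two arcs crossing, i.e. there are no $a<b<c<d$ with $\{p_a,p_c\}$ and $\{p_b,p_d\}$ both arcs. There are $C_m=\frac{1}{m+1}\binom{2m}{m}$ such matchings. The random Catalan-pair graph $CP_n$ is generated as follows: take the points $1,2,\dots,2n$ on a line; color each of the points $1,\dots,2n-1$ red or blue independently and uniformly at random, and color point $2n$ so that the total number of red points (hence also of blue points) is even. If there are $2k$ red points, choose independently and uniformly at random a Catalan-arc matching of size $k$ on the red points (arcs drawn above the line) and one of size $n-k$ on the blue points (arcs drawn below). $CP_n$ has one vertex for each of the $n$ arcs, and two vertices are adjacent iff the endpoints of the two arcs alternate (i.e. the arcs are $\{a,c\}$ and $\{b,d\}$ with $a<b<c<d$); this can only happen for arcs of different colors, so $CP_n$ is bipartite. $\log$ is the natural logarithm. *)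

(* Defs.v *)
From Stdlib Require Import Reals.
From mathcomp Require Import all_boot.
Set Implicit Arguments.
Unset Strict Implicit.
Unset Printing Implicit Defensive.

Section CP.
Variable n : nat.
Local Notation pt := 'I_(2 * n).

(* Points 1..2n are represented by the ordinals 0..2n-1 of 'I_(2n).
   The random input: colors (true = red) of the first 2n-1 points. *)
Definition coloring := {ffun 'I_(2 * n).-1 -> bool}.

(* Full coloring: the last point is colored so that the number of red points is even. *)
Definition full_col (c : coloring) (i : pt) : bool :=
  match (insub (nat_of_ord i) : option 'I_(2 * n).-1) with
  | Some j => c j
  | None => odd #|[set j | c j]|
  end.

Definition red_pts (c : coloring) : {set pt} := [set i | full_col c i].
Definition blue_pts (c : coloring) : {set pt} := [set i | ~~ full_col c i].

Definition alt (A B : {set pt}) : bool :=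
  [exists a : pt, exists b : pt, exists c : pt, exists d : pt,
    [&& (a < b)%N, (b < c)%N, (c < d)%N, A == [set a; c] & B == [set b; d]]].

Definition catalan_matching (S : {set pt}) (P : {set {set pt}}) : bool :=
  [&& partition P S, [forall A in P, #|A| == 2%N] &
      ~~ [exists A in P, exists B in P, alt A B]].

Definition catalan_matchings (S : {set pt}) : {set {set {set pt}}} :=
  [set P | catalan_matching S P].

(* Number of edges of CP_n: unordered pairs of arcs whose endpoints alternate
   (each such pair is counted once, as the ordered pair (A,B) with A starting first). *)
Definition edges (PR PB : {set {set pt}}) : nat :=
  #|[set AB : {set pt} * {set pt} |
      [&& AB.1 \in PR :|: PB, AB.2 \in PR :|: PB & alt AB.1 AB.2]]|.

Definition expect (X : {set {set pt}} -> {set {set pt}} -> R) : R :=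
  \big[Rplus/R0]_(c : coloring)
    Rmult (Rmult (Rmult (Rinv (INR (2 ^ (2 * n - 1))%N))
                        (Rinv (INR #|catalan_matchings (red_pts c)|)))
                 (Rinv (INR #|catalan_matchings (blue_pts c)|)))
      (\big[Rplus/R0]_(PR in catalan_matchings (red_pts c))
         \big[Rplus/R0]_(PB in catalan_matchings (blue_pts c)) X PR PB).

Definition expected_edges : R := expect (fun PR PB => INR (edges PR PB)).

Definition prob_concentrated (eps : R) : R :=
  expect (fun PR PB =>
    if Rlt_dec (Rabs (Rminus (INR (edges PR PB))
                             (Rmult (Rmult (Rinv PI) (INR n)) (ln (INR n)))))
               (Rmult (Rmult eps (INR n)) (ln (INR n)))
    then R1 else R0).

End CP.

(* Main.v *)
Require Import Defs.
From Stdlib Require Import Reals Lra Lia.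
From Coquelicot Require Import Coquelicot.
From mathcomp Require Import all_boot zify_ssreflect.
From HB Require Import structures.
Set Implicit Arguments.
Unset Strict Implicit.
Unset Printing Implicit Defensive.
Local Open Scope R_scope.

(* Let a_j = binom(2j,j) / 4^j and psi_j = a_j / (j+1), so that the Catalan numbers are
   4^j psi_j.  Deleting an arc of a uniform noncrossing matching of 2k points, together with the
   points below it, leaves two independent uniform matchings; hence an arc with 2l points below it
   is present with probability psi_l psi_(k-1-l) / (4 psi_k) >= psi_l / 4, and joint laws of two
   arcs are given by similar products.

   Upper bound, for every colouring: the expected number of blue arcs leaving a window of t blue
   points is at most 1 + 2 sqrt(2t/pi), because each point of the window is matched inside it with
   at least the probability of the infinite model.  Summing over red arcs with the arc
   probabilities, and using sqrt t <= (t / sqrt(g+1) + sqrt(g+1)) / 2 where g is the number of red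
   points below the arc, gives E[e] <= n ln n / pi + O(n).

   Lower bound: let X count the crossings whose four endpoints lie within distance L = O(n/K).
   Averaging over colourings, Jensen's inequality for (xy)^(-3/2) and Wallis' asymptotics
   a_j ~ (pi j)^(-1/2) give E[X] >= (1 - O(1/K)) n ln n / pi - O_K(n).

   Concentration: in E[X^2] pairs of crossings whose arcs lie side by side contribute
   (1 + O(1/K)) E[X]^2, while those with nested arcs contribute only O(n L ln n), since the number
   of short arcs leaving a window of t points has second moment O(t).  Chebyshev's inequality for
   X and Markov's inequality for e - X >= 0 conclude. *)

(** * Central binomial coefficients and the Wallis product *)

(** The logarithm arises because every scale of spans contributes about equally to the number of
    crossings. Discarding spans above a small multiple of [n / K] therefore costs a term of order
    [n ln K], besides boundary effects, and in return the arcs become short compared with the number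
    of points. That makes side-by-side arcs nearly independent: removing them changes the
    normalisation only by a ratio [psi_(k-d) / psi_k] close to 1. The uniformity of the upper bound
    over colourings does double duty. Fluctuations of the conditional mean given the colouring need
    no separate estimate: E[X^2] is compared with the square of the uniform bound, and the lower
    bound for E[X] shows that both agree to leading order. This uniformity comes from the
    arithmetic-geometric mean step, whose two halves are weighted by the numbers of red and of blue
    points, which add up to [2 n]. Colourings with too few points of one colour would destroy
    near-independence, so X is set to 0 on them. Only the constants entering the leading coefficient
    have to be sharp; all others are crude. *)

Fixpoint cbin (j : nat) : R :=
  if j is j'.+1 then cbin j' * ((2 * INR j' + 1) / (2 * INR j' + 2)) else 1.

Lemma cbin_gt0 j : 0 < cbin j.
Proof.
elim: j => [|j IH] /=; first lra.
have := pos_INR j => h; apply: Rmult_lt_0_compat => //.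
apply: Rdiv_lt_0_compat; lra.
Qed.

Definition wallis (k : nat) : R := RInt (fun x => sin x ^ k) 0 (PI / 2).

Lemma ex_RInt_sin_pow k a b : ex_RInt (fun x => sin x ^ k) a b.
Proof.
apply: ex_RInt_continuous => x _; apply: ex_derive_continuous; auto_derive; done.
Qed.

(** Integration by parts: the primitive [- cos x * sin x ^ k.+1] vanishes at both ends of the
    interval. *)
Lemma wallis_rec k : (INR k + 2) * wallis k.+2 = (INR k + 1) * wallis k.
Proof.
have P0 := PI_RGT_0.
have H : is_RInt (fun x => (INR k + 2) * sin x ^ k.+2 - (INR k + 1) * sin x ^ k)
           0 (PI / 2) (minus (- cos (PI/2) * sin (PI/2) ^ k.+1) (- cos 0 * sin 0 ^ k.+1)).
  apply: (is_RInt_derive (fun x => - cos x * sin x ^ k.+1)) => x _.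
    auto_derive=> //.
    have := sin2_cos2 x; rewrite /Rsqr => h.
    have -> : match k with 0%N => 1 | _.+1 => INR k + 1 end = INR k + 1.
      by case: (k) => [|k'] //; rewrite Rplus_0_l.
    have -> : sin x ^ k.+2 = sin x ^ k * (1 - cos x * cos x) by rewrite -h /=; ring.
    have -> : - (1 * - sin x) * (sin x * sin x ^ k) = (sin x * sin x) * sin x ^ k by ring.
    rewrite (_ : sin x * sin x = 1 - cos x * cos x); [ring | lra].
  apply: ex_derive_continuous; auto_derive; done.
have H2 : is_RInt (fun x => (INR k + 2) * sin x ^ k.+2 - (INR k + 1) * sin x ^ k)
           0 (PI / 2) (minus (scal (INR k + 2) (wallis k.+2)) (scal (INR k + 1) (wallis k))).
  apply: is_RInt_minus; apply: is_RInt_scal; exact/RInt_correct/ex_RInt_sin_pow.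
have := is_RInt_unique _ _ _ _ H; rewrite (is_RInt_unique _ _ _ _ H2).
rewrite cos_PI2 sin_0 /minus /plus /opp /scal /= /mult /=; lra.
Qed.

Lemma wallis_decr k : wallis k.+1 <= wallis k.
Proof.
have P0 := PI_RGT_0.
apply: RInt_le; [lra | exact: ex_RInt_sin_pow | exact: ex_RInt_sin_pow |].
move=> x hx.
have h1 : 0 <= sin x by apply: sin_ge_0; lra.
have h2 := SIN_bound x.
have := pow_le _ k h1; rewrite /=; nra.
Qed.

Lemma wallis_even j : wallis (2 * j) = cbin j * (PI / 2).
Proof.
elim: j => [|j IH].
  by rewrite /wallis /= RInt_const /scal /= /mult /=; ring.
have -> : (2 * j.+1 = (2 * j).+2)%N by lia.
have := wallis_rec (2 * j); rewrite IH /= mult_INR /= => h.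
have := pos_INR j => hj.
apply: (Rmult_eq_reg_l (2 * INR j + 2)); last lra.
rewrite (_ : 2 * INR j + 2 = (1+1) * INR j + 2) ?h; last lra.
field; lra.
Qed.

Lemma wallis_odd j : wallis (2 * j).+1 * (cbin j * (2 * INR j + 1)) = 1.
Proof.
elim: j => [|j IH].
  have H : is_RInt (fun x => sin x ^ 1) 0 (PI / 2) (minus (- cos (PI/2)) (- cos 0)).
    apply: (is_RInt_derive (fun x => - cos x)) => x _.
      by auto_derive=> //=; ring.
    apply: ex_derive_continuous; auto_derive; done.
  rewrite /wallis muln0 (is_RInt_unique _ _ _ _ H) cos_PI2 cos_0 /minus /plus /opp /=; ring.
have -> : (2 * j.+1 = (2 * j).+2)%N by lia.
have := wallis_rec (2 * j).+1; rewrite S_INR mult_INR [cbin _]/= [INR j.+1]S_INR => h.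
have := pos_INR j => hj.
rewrite -[RHS]IH.
have -> : wallis (2 * j).+3 = (INR 2 * INR j + 1 + 1) * wallis (2 * j).+1 / (INR 2 * INR j + 1 + 2).
  rewrite -h; field; rewrite /=; lra.
rewrite /=; field; lra.
Qed.

(** In I_(2j+1) <= I_(2j) one integral is proportional to [cbin j] and the other to its inverse, so
    monotonicity becomes a bound on the square. The upper bound below uses I_(2j+2) <= I_(2j+1) in
    the same way. *)
Lemma cbin_sqr_ge j : 1 / (PI * (INR j + 1 / 2)) <= cbin j ^ 2.
Proof.
have P0 := PI_RGT_0; have := pos_INR j => hj; have ha := cbin_gt0 j.
have := wallis_decr (2 * j); rewrite wallis_even => h.
have ho := wallis_odd j.
apply: (Rmult_le_reg_l (PI * (INR j + 1 / 2))); first by apply: Rmult_lt_0_compat; lra.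
rewrite (_ : _ * (1 / _) = 1); last by field; lra.
rewrite -[X in X <= _]ho [cbin j ^ 2]/= Rmult_1_r.
have hp : 0 <= cbin j * (2 * INR j + 1) by apply: Rmult_le_pos; lra.
have := Rmult_le_compat_r _ _ _ hp h; lra.
Qed.

Lemma cbin_sqr_le j : (0 < j)%N -> cbin j ^ 2 <= 1 / (PI * INR j).
Proof.
case: j => // j _.
have P0 := PI_RGT_0; have := pos_INR j => hj; have ha := cbin_gt0 j.+1.
have := wallis_decr (2 * j).+1.
rewrite (_ : (2 * j).+2 = (2 * j.+1)%N); last by lia.
rewrite wallis_even => h.
have ho := wallis_odd j.
have E : cbin j * (2 * INR j + 1) = cbin j.+1 * (2 * (INR j + 1)).
  by rewrite /=; field; lra.
rewrite E in ho; rewrite S_INR.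
apply: (Rmult_le_reg_l (PI * (INR j + 1))); first by apply: Rmult_lt_0_compat; lra.
rewrite (_ : _ * (1 / _) = 1); last by field; lra.
rewrite -[X in _ <= X]ho -Rsqr_pow2 /Rsqr.
have hp : 0 <= cbin j.+1 * (2 * (INR j + 1)) by apply: Rmult_le_pos; lra.
have := Rmult_le_compat_r _ _ _ hp h; lra.
Qed.

(** * Sums of real numbers *)

HB.instance Definition _ := Monoid.isComLaw.Build R R0 Rplus
  (fun x y z => esym (Rplus_assoc x y z)) Rplus_comm Rplus_0_l.
HB.instance Definition _ := Monoid.isMulLaw.Build R R0 Rmult Rmult_0_l Rmult_0_r.
HB.instance Definition _ := Monoid.isAddLaw.Build R Rmult Rplus
  Rmult_plus_distr_r Rmult_plus_distr_l.

Notation "\sum_ ( i <- r | P ) F" := (\big[Rplus/R0]_(i <- r | P%B) F) : R_scope.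
Notation "\sum_ ( i | P ) F" := (\big[Rplus/R0]_(i | P%B) F) : R_scope.
Notation "\sum_ i F" := (\big[Rplus/R0]_i F) : R_scope.
Notation "\sum_ ( i : t | P ) F" := (\big[Rplus/R0]_(i : t | P%B) F) (only parsing) : R_scope.
Notation "\sum_ ( i : t ) F" := (\big[Rplus/R0]_(i : t) F) (only parsing) : R_scope.
Notation "\sum_ ( i < n | P ) F" := (\big[Rplus/R0]_(i < n | P%B) F) : R_scope.
Notation "\sum_ ( i < n ) F" := (\big[Rplus/R0]_(i < n) F) : R_scope.
Notation "\sum_ ( i 'in' A | P ) F" := (\big[Rplus/R0]_(i in A | P%B) F) : R_scope.
Notation "\sum_ ( i 'in' A ) F" := (\big[Rplus/R0]_(i in A) F) : R_scope.

Lemma rsum_le (I : Type) (r : seq I) (P : pred I) (F G : I -> R) :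
  (forall i, P i -> F i <= G i) ->
  \sum_(i <- r | P i) F i <= \sum_(i <- r | P i) G i.
Proof.
move=> h; apply: (big_ind2 Rle) => //; first exact: Rle_refl.
move=> *; exact: Rplus_le_compat.
Qed.

Lemma rsum_ge0 (I : Type) (r : seq I) (P : pred I) (F : I -> R) :
  (forall i, P i -> 0 <= F i) -> 0 <= \sum_(i <- r | P i) F i.
Proof.
move=> h; apply: (big_ind (fun x => 0 <= x)) => //; first exact: Rle_refl.
move=> *; exact: Rplus_le_le_0_compat.
Qed.

Lemma rsum_sub (I : Type) (r : seq I) (P Q : pred I) (F : I -> R) :
  (forall i, P i -> Q i) -> (forall i, Q i -> 0 <= F i) ->
  \sum_(i <- r | P i) F i <= \sum_(i <- r | Q i) F i.
Proof.
move=> hPQ hF; rewrite (bigID P Q) /=.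
rewrite -[X in X <= _]Rplus_0_r; apply: Rplus_le_compat.
  rewrite (eq_bigl (fun i => Q i && P i)); first exact: Rle_refl.
  by move=> i; case hp: (P i); rewrite ?andbF // andbT; have := hPQ _ hp => ->.
by apply: rsum_ge0 => i /andP[hq _]; exact: hF.
Qed.

Lemma rsum_const (I : finType) (A : pred I) (c : R) :
  \sum_(i in A) c = INR #|A| * c.
Proof.
rewrite big_const; elim: #|A| => [|j IH]; first by rewrite /= Rmult_0_l.
by rewrite iterS IH S_INR; ring.
Qed.

Lemma rsum_if (I : Type) (r : seq I) (P Q : pred I) (F : I -> R) :
  \sum_(i <- r | P i) (if Q i then F i else 0) = \sum_(i <- r | P i && Q i) F i.
Proof. by rewrite big_mkcondr. Qed.

Lemma rsum_telescope_le (F : nat -> R) (G : nat -> R) n :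
  (forall i, (i < n)%N -> F i <= G i.+1 - G i) -> \sum_(i < n) F i <= G n - G 0%N.
Proof.
elim: n => [|n IH] h; first by rewrite big_ord0; lra.
rewrite big_ord_recr /=.
have h1 := h n (ltnSn n).
have /= h2 := IH (fun i hi => h i (ltnW hi)); lra.
Qed.

Lemma rsum_telescope_ge (F : nat -> R) (G : nat -> R) n :
  (forall i, (i < n)%N -> G i.+1 - G i <= F i) -> G n - G 0%N <= \sum_(i < n) F i.
Proof.
elim: n => [|n IH] h; first by rewrite big_ord0; lra.
rewrite big_ord_recr /=.
have h1 := h n (ltnSn n).
have /= h2 := IH (fun i hi => h i (ltnW hi)); lra.
Qed.

Lemma rsum_ord_widen (F : nat -> R) m n :
  (m <= n)%N -> (forall i, 0 <= F i) -> \sum_(i < m) F i <= \sum_(i < n) F i.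
Proof.
move=> hmn hF; rewrite (big_ord_widen n F hmn); apply: rsum_sub => // i _; exact: hF.
Qed.

Lemma INR_addn m n : INR (m + n)%N = INR m + INR n.
Proof. by rewrite -plusE plus_INR. Qed.

Lemma INR_muln m n : INR (m * n)%N = INR m * INR n.
Proof. by rewrite -multE mult_INR. Qed.

Lemma INR_leq m n : (m <= n)%N -> INR m <= INR n.
Proof. by move/leP; exact: le_INR. Qed.

Lemma INR_gt0 m : (0 < m)%N -> 0 < INR m.
Proof. by move=> /ltP; exact: lt_0_INR. Qed.

(** * Logarithms, harmonic sums and sums of inverse square roots *)

Lemma ln_le_sub x : 0 < x -> ln x <= x - 1.
Proof.
move=> hx; have := exp_ineq1_le (ln x); rewrite exp_ln //; lra.
Qed.

Lemma ln_succ_sub x : 0 < x -> ln (x + 1) - ln x <= 1 / x.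
Proof.
move=> hx; rewrite -ln_div; try lra.
apply: Rle_trans (ln_le_sub _) _; first by apply: Rdiv_lt_0_compat; lra.
apply: Req_le; field; lra.
Qed.

Lemma ln_succ_sub_ge x : 0 < x -> 1 / (x + 1) <= ln (x + 1) - ln x.
Proof.
move=> hx; have h : 0 < x / (x + 1) by apply: Rdiv_lt_0_compat; lra.
have := ln_le_sub h; rewrite ln_div; try lra.
have -> : x / (x + 1) - 1 = - (1 / (x + 1)) by field; lra.
lra.
Qed.

Lemma harmonic_le n : (0 < n)%N -> \sum_(i < n) (1 / (INR i + 1)) <= 1 + ln (INR n).
Proof.
case: n => // n _; rewrite big_ord_recl /=.
have h := @rsum_telescope_le (fun i => 1 / (INR i.+1 + 1)) (fun i => ln (INR i + 1)) n.
have {}h := h _.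
apply: Rle_trans (_ : 1 / (0 + 1) + (ln (INR n + 1) - ln (INR 0 + 1)) <= _).
  apply: Rplus_le_compat_l; apply: Rle_trans (h _); first by apply: Req_le; apply: eq_bigr.
  move=> i _; rewrite S_INR; apply: ln_succ_sub_ge; have := pos_INR i; lra.
rewrite -[match n with | 0%N => 1 | _.+1 => INR n + 1 end]/(INR n.+1) S_INR /= Rplus_0_l ln_1; lra.
Qed.

Lemma harmonic_ge (c : R) n : 0 < c ->
  ln (INR n + c) - ln c <= \sum_(i < n) (1 / (INR i + c)).
Proof.
move=> hc.
have := @rsum_telescope_ge (fun i => 1 / (INR i + c)) (fun i => ln (INR i + c)) n.
rewrite /= Rplus_0_l; apply=> i _.
rewrite (_ : INR i.+1 + c = INR i + c + 1); last by rewrite S_INR; ring.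
apply: ln_succ_sub; have := pos_INR i; lra.
Qed.

Lemma sqrt_ge1 x : 1 <= x -> 1 <= sqrt x.
Proof. by move=> h; rewrite -sqrt_1; apply: sqrt_le_1_alt. Qed.

Lemma sum_inv_sqrt n : \sum_(i < n) (1 / sqrt (INR i + 1)) <= 2 * sqrt (INR n).
Proof.
apply: Rle_trans (_ : 2 * sqrt (INR n) - 2 * sqrt (INR 0) <= _); last first.
  rewrite /= sqrt_0; lra.
apply: (@rsum_telescope_le (fun i => 1 / sqrt (INR i + 1)) (fun i => 2 * sqrt (INR i))) => i _.
have hi := pos_INR i; rewrite S_INR.
have h1 := sqrt_lt_R0 (INR i + 1) ltac:(lra).
have h2 := sqrt_pos (INR i).
have e1 := sqrt_sqrt (INR i + 1) ltac:(lra).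
have e2 := sqrt_sqrt (INR i) hi.
apply: (Rmult_le_reg_l (sqrt (INR i + 1))) => //.
rewrite (_ : _ * (1 / _) = 1); last by field; lra.
nra.
Qed.

(** * The function x^(-3/2), which governs the decay of arc probabilities *)

Definition w32 (x : R) : R := 1 / (x * sqrt x).

Lemma w32_gt0 x : 0 < x -> 0 < w32 x.
Proof.
move=> hx; apply: Rdiv_lt_0_compat; first lra.
by apply: Rmult_lt_0_compat => //; apply: sqrt_lt_R0.
Qed.

Lemma w32_anti x y : 0 < x -> x <= y -> w32 y <= w32 x.
Proof.
move=> hx hxy; have h1 := sqrt_lt_R0 x hx; have h2 := sqrt_le_1_alt _ _ hxy.
rewrite /w32 /Rdiv !Rmult_1_l; apply: Rinv_le_contravar; first nra.
apply: Rmult_le_compat; lra.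
Qed.

(** With [s] and [r] the roots of [x] and [x + 1], 1/s - 1/r = 1 / (s r (r + s)). The factor 2 is
    asymptotically sharp, as the lower bound for the mean requires. *)
Lemma w32_telescope_ge x : 0 < x -> 2 * (1 / sqrt x - 1 / sqrt (x + 1)) <= w32 x.
Proof.
move=> hx; rewrite /w32.
have h1 := sqrt_lt_R0 x hx; have e1 := sqrt_sqrt x ltac:(lra).
have h2 := sqrt_lt_R0 (x + 1) ltac:(lra); have e2 := sqrt_sqrt (x + 1) ltac:(lra).
rewrite -{3}e1; move: (sqrt x) (sqrt (x + 1)) h1 e1 h2 e2 => s r hs es hr er.
have hsr : s <= r by nra.
have -> : 1 / s - 1 / r = 1 / (s * r * (r + s)).
  have : r * r - s * s = 1 by lra.
  move=> e; rewrite -{3}e; field; lra.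
rewrite (_ : 2 * (1 / (s * r * (r + s))) = 1 / (s * r * (r + s) / 2)); last by field; nra.
rewrite /Rdiv !Rmult_1_l; apply: Rinv_le_contravar; first by apply: Rmult_lt_0_compat; nra.
have : s * s <= r * (r + s) * / 2 by nra.
by move=> h; have := Rmult_le_compat_l s _ _ (Rlt_le _ _ hs) h; lra.
Qed.

(** Same identity; for [x >= 1] one has [r <= 3 / 2 * s]. This direction only enters error terms, so
    6 in place of 2 is harmless. *)
Lemma w32_telescope_le x : 1 <= x -> w32 x <= 6 * (1 / sqrt x - 1 / sqrt (x + 1)).
Proof.
move=> hx; rewrite /w32.
have h1 := sqrt_lt_R0 x ltac:(lra); have e1 := sqrt_sqrt x ltac:(lra).
have h2 := sqrt_lt_R0 (x + 1) ltac:(lra); have e2 := sqrt_sqrt (x + 1) ltac:(lra).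
rewrite -{1}e1; move: (sqrt x) (sqrt (x + 1)) h1 e1 h2 e2 => s r hs es hr er.
have hsr : s <= r by nra.
have -> : 1 / s - 1 / r = 1 / (s * r * (r + s)).
  have : r * r - s * s = 1 by lra.
  move=> e; rewrite -{3}e; field; lra.
rewrite (_ : 6 * (1 / (s * r * (r + s))) = 1 / (s * r * (r + s) / 6)); last by field; nra.
rewrite /Rdiv !Rmult_1_l; apply: Rinv_le_contravar; first by apply: Rmult_lt_0_compat; nra.
have h32 : r <= 3 / 2 * s by nra.
have : r * (r + s) * / 6 <= s * s by nra.
by move=> h; have := Rmult_le_compat_l s _ _ (Rlt_le _ _ hs) h; lra.
Qed.

Lemma inv_sqrt_gt0 x : 0 < x -> 0 < 1 / sqrt x.
Proof. by move=> hx; apply: Rdiv_lt_0_compat; [lra | apply: sqrt_lt_R0]. Qed.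

Lemma sum_w32_ge u n : 0 < u ->
  2 * (1 / sqrt u - 1 / sqrt (INR n + u)) <= \sum_(i < n) w32 (INR i + u).
Proof.
move=> hu.
have := @rsum_telescope_ge (fun i => w32 (INR i + u)) (fun i => - (2 / sqrt (INR i + u))) n.
rewrite /= Rplus_0_l => h; apply: Rle_trans (h _); first lra.
move=> i _; have hi := pos_INR i.
have := @w32_telescope_ge (INR i + u) ltac:(lra).
rewrite (_ : INR i.+1 + u = INR i + u + 1); [lra | rewrite S_INR; ring].
Qed.

Lemma sum_w32_le u n : 1 <= u -> \sum_(i < n) w32 (INR i + u) <= 6 / sqrt u.
Proof.
move=> hu.
have := @rsum_telescope_le (fun i => w32 (INR i + u)) (fun i => - (6 / sqrt (INR i + u))) n.
rewrite /= Rplus_0_l => h; apply: Rle_trans (h _) _.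
  move=> i _; have hi := pos_INR i.
  have := @w32_telescope_le (INR i + u) ltac:(lra).
  rewrite (_ : INR i.+1 + u = INR i + u + 1); [lra | rewrite S_INR; ring].
have hn := pos_INR n; have := @inv_sqrt_gt0 (INR n + u) ltac:(lra); lra.
Qed.

(** Up to a constant, this bounds the probability of a short arc with [g] points of its own colour
    below it; the shift by 1 covers [g = 0]. *)
Definition wgap (g : nat) : R := w32 (INR g + 1).

Lemma wgap_gt0 g : 0 < wgap g.
Proof. by apply: w32_gt0; have := pos_INR g; lra. Qed.

Lemma wgap_anti g h : (g <= h)%N -> wgap h <= wgap g.
Proof.
move=> /INR_leq hgh; apply: w32_anti; last lra.
have := pos_INR g; lra.
Qed.

Lemma sum_wgap i n : \sum_(j < n) wgap (i + j) <= 6 / sqrt (INR i + 1).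
Proof.
apply: Rle_trans (@sum_w32_le (INR i + 1) n _); last by have := pos_INR i; lra.
apply: Req_le; apply: eq_bigr => j _; rewrite /wgap INR_addn; congr w32; ring.
Qed.

(** The bound is independent of [n]: the expected number of short arcs joining [t] consecutive
    points to one side is of order [sqrt t], however many points lie there. *)
Lemma sum2_wgap t n : \sum_(i < t) \sum_(j < n) wgap (i + j) <= 12 * sqrt (INR t).
Proof.
apply: Rle_trans (_ : \sum_(i < t) (6 * (1 / sqrt (INR i + 1))) <= _).
  apply: rsum_le => i _; have := sum_wgap i n; lra.
by rewrite -big_distrr /=; have /= := sum_inv_sqrt t; lra.
Qed.

Lemma sum2_wgapC t n : \sum_(i < n) \sum_(j < t) wgap (i + j) <= 12 * sqrt (INR t).
Proof.
rewrite exchange_big /=; apply: Rle_trans (sum2_wgap t n); apply: rsum_le => i _.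
by apply: rsum_le => j _; rewrite addnC; exact: Rle_refl.
Qed.

Lemma sum_inv_sqr i n : \sum_(j < n) (1 / (INR (i + j) + 1) ^ 2) <= 2 / (INR i + 1).
Proof.
have hi := pos_INR i.
have := @rsum_telescope_le (fun j => 1 / (INR (i + j) + 1) ^ 2) (fun j => - (2 / (INR i + INR j + 1))) n.
cbv beta; rewrite [INR 0]/= Rplus_0_r => h; apply: Rle_trans (h _) _.
  move=> j _; rewrite [INR j.+1]S_INR INR_addn; have hj := pos_INR j.
  rewrite (_ : INR i + (INR j + 1) + 1 = INR i + INR j + 2); last ring.
  move: (INR i + INR j) (Rplus_le_le_0_compat _ _ hi hj) => x hx.
  rewrite (_ : - (2 / (x + 2)) - - (2 / (x + 1)) = 1 / ((x + 1) * (x + 2) / 2)); last by field; lra.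
  rewrite /Rdiv !Rmult_1_l; apply: Rinv_le_contravar; nra.
have := pos_INR n => hn.
have : 0 < 2 / (INR i + INR n + 1) by apply: Rdiv_lt_0_compat; lra.
lra.
Qed.

(** * Normalised Catalan numbers: monotonicity, sums and asymptotics *)

Definition psi (j : nat) : R := cbin j / (INR j + 1).

Lemma psi_gt0 j : 0 < psi j.
Proof. by apply: Rdiv_lt_0_compat; [exact: cbin_gt0 | have := pos_INR j; lra]. Qed.

Lemma psiS j : psi j.+1 = psi j * ((2 * INR j + 1) / (2 * INR j + 4)).
Proof. by rewrite /psi S_INR /=; have := pos_INR j => hj; field; lra. Qed.

Lemma psi_anti i j : (i <= j)%N -> psi j <= psi i.
Proof.
move=> /subnKC <-; elim: (j - i)%N => [|d IH]; first by rewrite addn0; apply: Rle_refl.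
rewrite addnS psiS; apply: Rle_trans IH; have h := psi_gt0 (i + d).
have hd := pos_INR (i + d).
have : (2 * INR (i + d) + 1) / (2 * INR (i + d) + 4) <= 1 by apply/Rle_div_l; lra.
nra.
Qed.

(** Since [psi j] decays like j^(-3/2), any larger power compensates it; the square keeps everything
    rational. It serves to bound ratios [psi (k - d) / psi k] from above. *)
Lemma psi_sqr_mono i j : (i <= j)%N -> psi i * (INR i + 1) ^ 2 <= psi j * (INR j + 1) ^ 2.
Proof.
move=> /subnKC <-; elim: (j - i)%N => [|d IH]; first by rewrite addn0; apply: Rle_refl.
rewrite addnS psiS S_INR; apply: Rle_trans IH _; have h := psi_gt0 (i + d).
move: (INR (i + d)) (pos_INR (i + d)) => x hx.
rewrite Rmult_assoc; apply: Rmult_le_compat_l; first lra.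
rewrite (_ : _ * (x + 1 + 1) ^ 2 = (2 * x + 1) * (x + 2) ^ 2 / (2 * x + 4)); last by field; lra.
apply (Rle_div_r _ _ (2 * x + 4)); first lra.
have := Rmult_le_pos x (x + 2) hx ltac:(lra); lra.
Qed.

(** For a simple random walk, [psi j / 2] is the probability of a first return at time [2 j + 2] and
    [cbin J] that of no return up to time [2 J]. In the infinite model the arcs from a point to one
    side have probabilities [psi j / 4], with total one half. *)
Lemma sum_psi_half J : \sum_(j < J) (psi j / 2) = 1 - cbin J.
Proof.
elim: J => [|J IH]; first by rewrite big_ord0 /=; ring.
rewrite big_ord_recr /= [X in X + _](_ : _ = 1 - cbin J); last exact: IH.
by rewrite /psi; have := pos_INR J => hJ; field; lra.
Qed.

(* The antidifference [G] is the one found by Gosper's algorithm. *)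
Lemma psi_convolution k : \sum_(i < k.+1) (psi i * psi (k - i)) = 4 * psi k.+1.
Proof.
pose G i := 2 * (2 * INR i - INR k - 1) * cbin i * cbin (k.+1 - i) /
            ((INR k + 1) * (INR k + 2)).
have hk := pos_INR k.
have step i : (i < k.+1)%N -> psi i * psi (k - i) = G i.+1 - G i.
  move=> hi; rewrite /G /psi.
  have [d ->] : exists d, k = (i + d)%N by exists (k - i)%N; lia.
  rewrite INR_addn subSS addKn (_ : ((i + d).+1 - i)%N = d.+1); last by lia.
  rewrite S_INR /=; have := pos_INR i; have := pos_INR d => hd hi'.
  field; lra.
have tele m : (m <= k.+1)%N -> \sum_(i < m) (psi i * psi (k - i)) = G m - G 0%N.
  elim: m => [|m IH] hm; first by rewrite big_ord0; ring.
  rewrite big_ord_recr /= step //.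
  by have /= -> := IH (ltnW hm); ring.
rewrite tele // /G /psi subnn subn0 !S_INR [INR 0]/= [cbin 0]/=; field; lra.
Qed.

Lemma cbin_le j : (0 < j)%N -> cbin j <= 1 / sqrt (PI * INR j).
Proof.
move=> hj; have h := cbin_sqr_le hj; have h0 := cbin_gt0 j.
have P0 := PI_RGT_0; have hj' := INR_gt0 hj.
have -> : 1 / sqrt (PI * INR j) = sqrt (1 / (PI * INR j)).
  by rewrite sqrt_div ?sqrt_1; [| lra | nra].
rewrite -(sqrt_pow2 (cbin j)); last lra.
exact: sqrt_le_1_alt.
Qed.

Lemma cbin_ge j : 1 / sqrt (PI * (INR j + 1)) <= cbin j.
Proof.
have h := cbin_sqr_ge j; have h0 := cbin_gt0 j.
have P0 := PI_RGT_0; have hj := pos_INR j.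
have -> : 1 / sqrt (PI * (INR j + 1)) = sqrt (1 / (PI * (INR j + 1))).
  by rewrite sqrt_div ?sqrt_1; [| lra | nra].
rewrite -(sqrt_pow2 (cbin j)); last lra.
apply: sqrt_le_1_alt; apply: Rle_trans h.
rewrite /Rdiv !Rmult_1_l; apply: Rinv_le_contravar; nra.
Qed.

Lemma PI_ge3 : 3 <= PI.
Proof. by have := PI2_3_2; lra. Qed.

Lemma psi_le_w32 j : psi j <= w32 (INR j + 1).
Proof.
have hj := pos_INR j; rewrite /psi /w32.
have hs := sqrt_lt_R0 (INR j + 1) ltac:(lra).
have -> : 1 / ((INR j + 1) * sqrt (INR j + 1)) = 1 / sqrt (INR j + 1) / (INR j + 1).
  by field; lra.
apply: Rmult_le_compat_r; first by apply/Rlt_le/Rinv_0_lt_compat; lra.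
case: j hj hs => [|j] hj hs; first by rewrite /= Rplus_0_l sqrt_1; lra.
have hj1 : 1 <= INR j.+1 by rewrite S_INR; have := pos_INR j; lra.
apply: Rle_trans (cbin_le _) _ => //; have hP := PI_ge3.
rewrite /Rdiv !Rmult_1_l; apply: Rinv_le_contravar => //.
apply: sqrt_le_1_alt; nra.
Qed.

Lemma psi_ge_w32 j : w32 (INR j + 1) / sqrt PI <= psi j.
Proof.
have hj := pos_INR j; have := cbin_ge j; rewrite /psi /w32.
have hs := sqrt_lt_R0 (INR j + 1) ltac:(lra); have P0 := PI_RGT_0.
have hP := sqrt_lt_R0 PI P0.
rewrite sqrt_mult; [|lra|lra] => h.
have -> : 1 / ((INR j + 1) * sqrt (INR j + 1)) / sqrt PI = 1 / (sqrt PI * sqrt (INR j + 1)) / (INR j + 1).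
  by field; lra.
by apply: Rmult_le_compat_r => //; apply/Rlt_le/Rinv_0_lt_compat; lra.
Qed.

(** Here [2 j + 1] is [g + 1] for a gap of [g = 2 j] points. The constant [sqrt (2 / PI)] is the
    limit of [cbin j * sqrt (2 j + 1)] and has to be exact, because it enters the leading
    coefficient; the error is put into a summable term. *)
Lemma psi_sqrt_le j :
  psi j * sqrt (2 * INR j + 1) <= sqrt (2 / PI) * (1 / (INR j + 1) + 1 / (INR j + 1) ^ 2).
Proof.
have hj := pos_INR j; have P0 := PI_RGT_0; have ha := cbin_gt0 j.
have hs2 := sqrt_lt_R0 (2 / PI) (Rdiv_lt_0_compat 2 PI ltac:(lra) P0).
rewrite /psi.
have -> : 1 / (INR j + 1) + 1 / (INR j + 1) ^ 2 = (1 + 1 / (INR j + 1)) / (INR j + 1) by field; lra.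
suff h : cbin j * sqrt (2 * INR j + 1) <= sqrt (2 / PI) * (1 + 1 / (INR j + 1)).
  have hi : 0 <= / (INR j + 1) by apply/Rlt_le/Rinv_0_lt_compat; lra.
  by have := Rmult_le_compat_r _ _ _ hi h; lra.
case: j hj ha => [|j] hj ha.
  rewrite /= Rmult_0_r !Rplus_0_l sqrt_1.
  have : 1 / 2 <= sqrt (2 / PI).
    have -> : 1 / 2 = sqrt ((1 / 2) ^ 2) by rewrite sqrt_pow2; lra.
    apply: sqrt_le_1_alt; have := PI_4 => h4; apply (Rle_div_r _ _ PI); lra.
  lra.
have hx : 1 <= INR j.+1 by rewrite S_INR; have := pos_INR j; lra.
have hsq := cbin_sqr_le (ltn0Sn j).
move: (INR j.+1) (cbin j.+1) hx ha hsq => x A hx ha hsq.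
have -> : A * sqrt (2 * x + 1) = sqrt (A ^ 2 * (2 * x + 1)).
  by rewrite sqrt_mult; [rewrite sqrt_pow2; lra | nra | lra].
have h1 : 0 < 1 / (x + 1) by apply: Rdiv_lt_0_compat; lra.
rewrite -(sqrt_pow2 (1 + 1 / (x + 1))); last lra.
rewrite -sqrt_mult; [|by apply/Rlt_le/Rdiv_lt_0_compat; lra | nra].
apply: sqrt_le_1_alt.
apply: Rle_trans (_ : 1 / (PI * x) * (2 * x + 1) <= _).
  by apply: Rmult_le_compat_r => //; lra.
have -> : 1 / (PI * x) * (2 * x + 1) = 2 / PI * (1 + 1 / (2 * x)) by field; lra.
apply: Rmult_le_compat_l; first by apply/Rlt_le/Rdiv_lt_0_compat; lra.
have : 1 / (2 * x) <= 1 / (x + 1).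
  by rewrite /Rdiv !Rmult_1_l; apply: Rinv_le_contravar; lra.
nra.
Qed.

Definition catal (k : nat) : R := 4 ^ k * psi k.

Lemma catal_gt0 k : 0 < catal k.
Proof. by apply: Rmult_lt_0_compat; [apply: pow_lt; lra | exact: psi_gt0]. Qed.

Lemma catal0 : catal 0 = 1.
Proof. by rewrite /catal /psi /=; field. Qed.

Lemma catal_convolution k : \sum_(i < k.+1) (catal i * catal (k - i)) = catal k.+1.
Proof.
rewrite (eq_bigr (fun i : 'I_k.+1 => 4 ^ k * (psi i * psi (k - i)))) => [|i _].
  by rewrite -big_distrr /= psi_convolution /catal /=; ring.
have e : (k = i + (k - i))%N by have := ltn_ord i; lia.
by rewrite /catal [4 ^ k](congr1 (pow 4) e) pow_add; ring.
Qed.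

(** * Noncrossing matchings *)

Section Ranks.
Variable N : nat.
Implicit Types A : {set 'I_N}.

(** Ranks in [A] run once through the integers below [#|A|]. The induction removes the largest
    point, which changes no other left rank; the mirror image below removes the smallest. *)
Lemma sum_rank_left A (phi : nat -> R) :
  \sum_(x in A) phi #|[set z in A | (z < x)%N]| = \sum_(i < #|A|) phi i.
Proof.
move: {2}#|A| (erefl #|A|) => s; elim: s A => [|s IH] A hs.
  by rewrite hs big_ord0 big_pred0 // => x; move/eqP: hs; rewrite cards_eq0 => /eqP->; rewrite inE.
have /set0Pn[i0 hi0] : A != set0 by rewrite -card_gt0 hs.
case: (@arg_maxnP _ i0 (fun i => i \in A) (@nat_of_ord N) hi0) => M hM hmax.
have hs' : #|A :\ M| = s by have := cardsD1 M A; rewrite hM hs; lia.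
rewrite (big_setD1 M) //= hs big_ord_recr /= Rplus_comm; congr (_ + phi _).
  rewrite -hs' -IH //; apply: eq_bigr => x; rewrite !inE => /andP[hxM hxA].
  congr phi; apply: eq_card => z; rewrite !inE.
  case: (eqVneq z M) => [->|_] //=; rewrite hM /=; apply/negbTE; have := hmax x hxA; lia.
rewrite -hs'; apply: eq_card => z; rewrite !inE; case hz: (z \in A); rewrite ?andbF //= andbT.
by have := hmax z hz; rewrite -val_eqE /=; lia.
Qed.

Lemma sum_rank_right A (phi : nat -> R) :
  \sum_(x in A) phi #|[set z in A | (x < z)%N]| = \sum_(i < #|A|) phi i.
Proof.
move: {2}#|A| (erefl #|A|) => s; elim: s A => [|s IH] A hs.
  by rewrite hs big_ord0 big_pred0 // => x; move/eqP: hs; rewrite cards_eq0 => /eqP->; rewrite inE.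
have /set0Pn[i0 hi0] : A != set0 by rewrite -card_gt0 hs.
case: (@arg_minnP _ i0 (fun i => i \in A) (@nat_of_ord N) hi0) => M hM hmax.
have hs' : #|A :\ M| = s by have := cardsD1 M A; rewrite hM hs; lia.
rewrite (big_setD1 M) //= hs big_ord_recr /= Rplus_comm; congr (_ + phi _).
  rewrite -hs' -IH //; apply: eq_bigr => x; rewrite !inE => /andP[hxM hxA].
  congr phi; apply: eq_card => z; rewrite !inE.
  case: (eqVneq z M) => [->|_] //=; rewrite hM /=; apply/negbTE; have := hmax x hxA; lia.
rewrite -hs'; apply: eq_card => z; rewrite !inE; case hz: (z \in A); rewrite ?andbF //= andbT.
by have := hmax z hz; rewrite -val_eqE /=; lia.
Qed.

Lemma card_interval A (a l : nat) :
  (forall z : 'I_N, z \in A -> (a <= z)%N && (z < a + l)%N) -> (#|A| <= l)%N.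
Proof.
move=> hA; rewrite -(size_iota a l) cardE -(size_map (@nat_of_ord _)).
apply: uniq_leq_size; first by rewrite map_inj_uniq ?enum_uniq //; exact: val_inj.
by move=> v /mapP[z]; rewrite mem_enum => /hA h ->; rewrite mem_iota.
Qed.

End Ranks.

Lemma sum_even m (phi : nat -> R) :
  \sum_(i < m) (if odd i then 0 else phi i./2) = \sum_(j < uphalf m) phi j.
Proof.
elim: m => [|m IH]; first by rewrite !big_ord0.
rewrite big_ord_recr /= IH uphalf_half; case: (boolP (odd m)) => hm /=; first by rewrite add1n Rplus_0_r.
by rewrite add0n big_ord_recr.
Qed.

(** * Splitting a noncrossing matching at one of its arcs *)

Section Matchings.
Variable n : nat.
Local Notation pt := 'I_(2 * n).
Implicit Types (x y z a b c d : pt) (S : {set pt}) (A B : {set pt}) (P : {set {set pt}}).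

(** Once arcs are named by their endpoints in increasing order, later case distinctions reduce to
    linear arithmetic on positions. *)
Lemma catalan_matchingP S P :
  reflect [/\ forall A, A \in P -> exists x y, [/\ (x < y)%N, x \in S, y \in S & A = [set x; y]],
              forall x, x \in S -> exists2 A, A \in P & x \in A,
              forall A B z, A \in P -> B \in P -> z \in A -> z \in B -> A = B &
              forall a b c d, (a < b)%N -> (b < c)%N -> (c < d)%N ->
                [set a; c] \in P -> [set b; d] \in P -> False]
          (catalan_matching S P).
Proof.
apply: (iffP idP) => [/and3P[/and3P[/eqP hc /trivIsetP ht h0] /forall_inP h2 hx]|[h1 h2 h3 h4]].
  split.
  - move=> A hA; have /cards2P[x [y [hxy eA]]] := h2 A hA.
    have hS z : z \in A -> z \in S by move=> hz; rewrite -hc; apply/bigcupP; exists A.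
    have [hxS hyS] : x \in S /\ y \in S by split; apply: hS; rewrite eA !inE eqxx ?orbT.
    case: (ltngtP x y) => h; last by move: hxy; rewrite (val_inj h) eqxx.
      by exists x, y.
    by exists y, x; split => //; rewrite eA setUC.
  - by move=> x; rewrite -hc => /bigcupP[A hA hxA]; exists A.
  - move=> A B z hA hB hzA hzB; apply/eqP; apply/negPn/negP => hAB.
    by have := ht A B hA hB hAB; rewrite disjoint_subset => /subsetP /(_ z hzA); rewrite inE hzB.
  - move=> a b c d hab hbc hcd hA hB; move/negP: hx; apply.
    apply/existsP; exists [set a; c]; rewrite hA /=; apply/existsP; exists [set b; d]; rewrite hB /=.
    apply/existsP; exists a; apply/existsP; exists b; apply/existsP; exists c; apply/existsP; exists d.
    by rewrite hab hbc hcd !eqxx.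
apply/and3P; split.
- apply/and3P; split.
  + apply/eqP/setP => z; apply/bigcupP/idP => [[A hA hz]|hz]; last by have [A hA hzA] := h2 z hz; exists A.
    by have [x [y [_ hx hy e]]] := h1 A hA; move: hz; rewrite e !inE => /orP[]/eqP->.
  + apply/trivIsetP => A B hA hB hAB; rewrite disjoint_subset; apply/subsetP => z hzA.
    by rewrite inE; apply/negP => hzB; move/eqP: hAB; apply; exact: h3 hzA hzB.
  + by apply/negP => /h1[x [y [_ _ _ /setP /(_ x)]]]; rewrite !inE eqxx.
- apply/forall_inP => A /h1[x [y [hxy _ _ ->]]]; rewrite cards2.
  by case: (eqVneq x y) hxy => [->|//]; rewrite ltnn.
- apply/negP => /exists_inP[A hA /exists_inP[B hB]].
  move=> /existsP[a /existsP[b /existsP[c /existsP[d /and5P[hab hbc hcd /eqP eA /eqP eB]]]]].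
  by apply: (h4 a b c d) => //; rewrite -?eA -?eB.
Qed.

Lemma arc_inj x y x' y' : (x < y)%N -> (x' < y')%N -> [set x; y] = [set x'; y'] -> x = x' /\ y = y'.
Proof.
move=> h h' e.
have : x \in [set x'; y'] by rewrite -e !inE eqxx.
have : y \in [set x'; y'] by rewrite -e !inE eqxx orbT.
have : x' \in [set x; y] by rewrite e !inE eqxx.
rewrite !inE -!val_eqE /= => h1 h2 h3; split; apply: val_inj => /=; lia.
Qed.

Definition inside S x y : {set pt} := [set z in S | (x < z)%N && (z < y)%N].
Definition outside S x y : {set pt} := [set z in S | (z < x)%N || (y < z)%N].
Definition add_arc x y (Q : {set {set pt}} * {set {set pt}}) : {set {set pt}} :=
  [set x; y] |: (Q.1 :|: Q.2).

Lemma mem_arc z x y : (z \in [set x; y]) = (z == x) || (z == y).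
Proof. by rewrite !inE. Qed.

Lemma catalan_sub S P A z : catalan_matching S P -> A \in P -> z \in A -> z \in S.
Proof.
by move=> /catalan_matchingP[h1 _ _ _] /h1[x [y [_ hx hy ->]]]; rewrite mem_arc => /orP[]/eqP->.
Qed.

Lemma add_arc_catalan S x y P1 P2 : (x < y)%N -> x \in S -> y \in S ->
  catalan_matching (inside S x y) P1 -> catalan_matching (outside S x y) P2 ->
  catalan_matching S (add_arc x y (P1, P2)).
Proof.
move=> hxy hx hy h1 h2.
have s1 A z : A \in P1 -> z \in A -> [/\ z \in S, (x < z)%N & (z < y)%N].
  by move=> hA hz; have := catalan_sub h1 hA hz; rewrite inE => /and3P.
have s2 A z : A \in P2 -> z \in A -> z \in S /\ ((z < x)%N || (y < z)%N).
  by move=> hA hz; have := catalan_sub h2 hA hz; rewrite inE => /andP.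
case/catalan_matchingP: (h1) => a1 a2 a3 a4; case/catalan_matchingP: (h2) => b1 b2 b3 b4.
apply/catalan_matchingP; split.
- move=> A; rewrite !inE => /or3P[/eqP->|/a1|/b1].
  + by exists x, y.
  + by move=> [u [v [huv]]]; rewrite !inE => /andP[hu _] /andP[hv _] ->; exists u, v.
  + by move=> [u [v [huv]]]; rewrite !inE => /andP[hu _] /andP[hv _] ->; exists u, v.
- move=> z hz; case: (boolP (z \in [set x; y])) => hzxy.
    by exists [set x; y] => //; rewrite !inE eqxx.
  case: (boolP (z \in inside S x y)) => hin.
    by have [A hA hzA] := a2 z hin; exists A => //; rewrite !inE hA orbT.
  have : z \in outside S x y.
    move: hzxy hin; rewrite !inE hz /= -!val_eqE /=; lia.
  by move/b2 => [A hA hzA]; exists A => //; rewrite !inE hA !orbT.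
- move=> A B z; rewrite !inE => /or3P[/eqP->|hA|hA] /or3P[/eqP->|hB|hB] //; rewrite ?mem_arc; move=> hzA hzB.
  + have [_ u v] := s1 _ _ hB hzB; move: hzA; rewrite -!val_eqE /=; lia.
  + have [_ u] := s2 _ _ hB hzB; move: hzA; rewrite -!val_eqE /=; lia.
  + have [_ u v] := s1 _ _ hA hzA; move: hzB; rewrite -!val_eqE /=; lia.
  + exact: a3 hzA hzB.
  + have [_ u v] := s1 _ _ hA hzA; have [_ w] := s2 _ _ hB hzB; clear -u v w; lia.
  + have [_ u] := s2 _ _ hA hzA; move: hzB; rewrite -!val_eqE /=; lia.
  + have [_ u v] := s1 _ _ hB hzB; have [_ w] := s2 _ _ hA hzA; clear -u v w; lia.
  + exact: b3 hzA hzB.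
- move=> a b c d hab hbc hcd; rewrite !inE => /or3P[/eqP e|hA|hA] /or3P[/eqP e'|hB|hB].
  + have [||e1 e2] := arc_inj _ _ e => //; first exact: ltn_trans hbc.
    have [||e3 e4] := arc_inj _ _ e' => //; first exact: ltn_trans hcd.
    by move: hab; rewrite e1 e3 ltnn.
  + have [||e1 e2] := arc_inj _ _ e => //; first lia.
    have [|_ u v] := s1 _ d hB; first by rewrite mem_arc eqxx orbT.
    by move: hcd; rewrite e2; lia.
  + have [||e1 e2] := arc_inj _ _ e => //; first lia.
    have [|_ u] := s2 _ b hB; first by rewrite mem_arc eqxx.
    by move: hab hbc; rewrite e1 e2; lia.
  + have [||e1 e2] := arc_inj _ _ e' => //; first lia.
    have [|_ u v] := s1 _ a hA; first by rewrite mem_arc eqxx.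
    by move: hab; rewrite e1; lia.
  + exact: (a4 a b c d).
  + have [|_ u v] := s1 _ a hA; first by rewrite mem_arc eqxx.
    have [|_ u' v'] := s1 _ c hA; first by rewrite mem_arc eqxx orbT.
    have [|_ w] := s2 _ b hB; first by rewrite mem_arc eqxx.
    clear -u v u' v' w hab hbc hcd; lia.
  + have [||e1 e2] := arc_inj _ _ e' => //; first lia.
    have [|_ u] := s2 _ c hA; first by rewrite mem_arc eqxx orbT.
    by move: hbc hcd; rewrite e1 e2; lia.
  + have [|_ u v] := s1 _ b hB; first by rewrite mem_arc eqxx.
    have [|_ u' v'] := s1 _ d hB; first by rewrite mem_arc eqxx orbT.
    have [|_ w] := s2 _ c hA; first by rewrite mem_arc eqxx orbT.
    clear -u v u' v' w hab hbc hcd; lia.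
  + exact: (b4 a b c d).
Qed.

(** Disjointness forbids a common endpoint and noncrossing forbids the two alternating orders; in
    every other order both endpoints of [A] are on the same side of the arc. *)
Lemma catalan_arc_split S P x y A : catalan_matching S P -> (x < y)%N -> [set x; y] \in P ->
  A \in P -> A != [set x; y] -> (A \subset inside S x y) || (A \subset outside S x y).
Proof.
move=> hP hxy hin hA hne; case/catalan_matchingP: (hP) => h1 h2 h3 h4.
have [u [v [huv hu hv e]]] := h1 A hA.
have disj z : z \in A -> z \notin [set x; y].
  by move=> hz; apply/negP => hz'; move/eqP: hne; apply; exact: h3 hz hz'.
have := disj u; have := disj v; rewrite e !mem_arc !eqxx !orbT -!val_eqE /= => /(_ isT) nv /(_ isT) nu.
rewrite e in hA; rewrite !subUset !sub1set !inE hu hv /=.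
have c1 : ~ ((x < u)%N /\ (u < y)%N /\ (y < v)%N) by move=> [q1 [q2 q3]]; apply: (h4 x u y v).
have c2 : ~ ((u < x)%N /\ (x < v)%N /\ (v < y)%N) by move=> [q1 [q2 q3]]; apply: (h4 u x v y).
lia.
Qed.

Lemma catalan_restrict S S' P : catalan_matching S P -> S' \subset S ->
  (forall A z, A \in P -> z \in A -> z \in S' -> A \subset S') ->
  catalan_matching S' [set A in P | A \subset S'].
Proof.
move=> /catalan_matchingP[h1 h2 h3 h4] /subsetP hS hcl; apply/catalan_matchingP; split.
- move=> A; rewrite inE => /andP[/h1[u [v [huv hu hv ->]]] /subsetP hs].
  by exists u, v; split => //; apply: hs; rewrite mem_arc eqxx ?orbT.
- by move=> z hz; have [A hA hzA] := h2 z (hS z hz); exists A => //; rewrite inE hA; exact: hcl hzA hz.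
- by move=> A B z; rewrite !inE => /andP[hA _] /andP[hB _]; exact: h3.
- by move=> a b c d hab hbc hcd; rewrite !inE => /andP[hA _] /andP[hB _]; exact: (h4 a b c d).
Qed.

Definition arc_ind P x y : R := if [set x; y] \in P then 1 else 0.

(** A bijection: a matching containing the arc amounts to a matching of the points inside it
    together with one of the points outside. Applied once or twice, it yields all one- and two-arc
    counts. *)
Lemma sum_with_arc S x y (F : {set {set pt}} -> R) : (x < y)%N -> x \in S -> y \in S ->
  \sum_(P in catalan_matchings S) arc_ind P x y * F P =
  \sum_(P1 in catalan_matchings (inside S x y))
    \sum_(P2 in catalan_matchings (outside S x y)) F (add_arc x y (P1, P2)).
Proof.
move=> hxy hx hy.
have io z : z \in inside S x y -> z \in outside S x y -> False by rewrite !inE; lia.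
have ioA A : A \subset inside S x y -> A \subset outside S x y -> A = set0.
  move=> /subsetP i /subsetP o; apply/setP => z; rewrite inE; apply/negP => hz; exact: io (i z hz) (o z hz).
have xyn A : A = [set x; y] -> A \subset inside S x y -> False.
  by move=> -> /subsetP /(_ x); rewrite mem_arc eqxx inE ltnn andbF => /(_ isT).
have xyn2 A : A = [set x; y] -> A \subset outside S x y -> False.
  by move=> -> /subsetP /(_ x); rewrite mem_arc eqxx inE ltnn /= => /(_ isT); lia.
have sub T P A : P \in catalan_matchings T -> A \in P -> A \subset T /\ A <> set0.
  rewrite inE => hP hA; split; first by apply/subsetP => z; exact: catalan_sub hP hA.
  by case/catalan_matchingP: hP => /(_ _ hA) [u [v [_ _ _ ->]]] _ _ _ /setP /(_ u); rewrite !inE eqxx.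
rewrite pair_big_dep /=.
rewrite (eq_bigr (fun P => if [set x; y] \in P then F P else 0)); last first.
  by move=> P _; rewrite /arc_ind; case: ifP => _; ring.
rewrite rsum_if.
rewrite (reindex_onto (fun Q => add_arc x y Q)
   (fun P => ([set A in P | A \subset inside S x y], [set A in P | A \subset outside S x y]))) /=.
  apply: eq_big => [[P1 P2]|[P1 P2]] //=.
  apply/andP/andP => [[/andP[hP hxyP] /eqP[e1 e2]]|[hP1 hP2]].
    rewrite inE in hP.
    split; [rewrite -[X in X \in _]e1 | rewrite -[X in X \in _]e2]; rewrite inE;
      apply: (catalan_restrict hP).
    - by apply/subsetP => z; rewrite inE => /andP[].
    - move=> A z hA hz hzin; case: (eqVneq A [set x; y]) => [eA|ne].
        by move: hz hzin; rewrite eA !inE -!val_eqE /=; lia.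
      have /orP[//|/subsetP /(_ z hz) ho] := catalan_arc_split hP hxy hxyP hA ne.
      by case: (io _ hzin ho).
    - by apply/subsetP => z; rewrite inE => /andP[].
    - move=> A z hA hz hzin; case: (eqVneq A [set x; y]) => [eA|ne].
        by move: hz hzin; rewrite eA !inE -!val_eqE /=; lia.
      have /orP[/subsetP /(_ z hz) ho|//] := catalan_arc_split hP hxy hxyP hA ne.
      by case: (io _ ho hzin).
  split; first (apply/andP; split).
  - by rewrite inE; apply: add_arc_catalan => //; rewrite -?inE.
  - by rewrite !inE eqxx.
  - apply/eqP; congr pair; apply/setP => A; rewrite !inE; apply/andP/idP.
    + move=> [/or3P[/eqP e|//|hA] hs]; first by case: (xyn _ e hs).
      by have [q1 q2] := sub _ _ _ hP2 hA; case: q2; exact: ioA.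
    + by move=> hA; rewrite hA orbT; split=> //; have [] := sub _ _ _ hP1 hA.
    + move=> [/or3P[/eqP e|hA|//] hs]; first by case: (xyn2 _ e hs).
      by have [q1 q2] := sub _ _ _ hP1 hA; case: q2; exact: ioA.
    + by move=> hA; rewrite hA !orbT; split=> //; have [] := sub _ _ _ hP2 hA.
move=> P /andP[]; rewrite inE => hP hin; apply/setP => A; rewrite !inE.
apply/idP/idP => [/or3P[/eqP->|/andP[]|/andP[]] //|hA].
case: (eqVneq A [set x; y]) => //= ne; rewrite hA /=; exact: (catalan_arc_split hP hxy hin hA ne).
Qed.

End Matchings.

(** * Arc probabilities *)

(** The number of noncrossing matchings of [s] points. Indexing by points lets the recursion run
    over all positions of a partner, odd gaps contributing zero. *)
Definition catv (s : nat) : R := if odd s then 0 else catal s./2.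

Lemma catv_rec s : \sum_(i < s.+1) (catv i * catv (s - i)) = catv s.+2.
Proof.
case: (boolP (odd s)) => hs.
  rewrite /catv /= negbK hs big1 // => i _.
  rewrite oddB; last by have := ltn_ord i; lia.
  by rewrite hs; case: (odd i); rewrite /= ?Rmult_0_l ?Rmult_0_r.
have e : s = (2 * s./2)%N by lia.
rewrite (eq_bigr (fun i : 'I_s.+1 => if odd i then 0 else catal i./2 * catal (s./2 - i./2))).
  rewrite (sum_even s.+1 (fun j => catal j * catal (s./2 - j))).
  rewrite /catv /= (negbTE hs) /= -catal_convolution.
  by have -> : (s./2.+1 = uphalf s.+1)%N by lia.
move=> i _; rewrite /catv; have hi := ltn_ord i; case: (boolP (odd i)) => hi2; first by rewrite Rmult_0_l.
rewrite oddB ?(negbTE hs) ?(negbTE hi2) /=; last lia.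
by congr (_ * catal _); lia.
Qed.

Definition qk (k l : nat) : R := psi l * psi (k - l.+1) / (4 * psi k).

Lemma qk_gt0 k l : 0 < qk k l.
Proof.
have h1 := psi_gt0 l; have h2 := psi_gt0 (k - l.+1); have h3 := psi_gt0 k.
by apply: Rdiv_lt_0_compat; nra.
Qed.

Lemma qk_ge k l : psi l / 4 <= qk k l.
Proof.
have h1 := psi_gt0 l; have h3 := psi_gt0 k.
have h2 := psi_anti (leq_subr l.+1 k).
rewrite /qk; apply (Rle_div_r _ _ (4 * psi k)); nra.
Qed.

Lemma psi_ratio_le k d : (d <= k)%N -> psi (k - d) / psi k <= ((INR k + 1) / (INR (k - d) + 1)) ^ 2.
Proof.
move=> hd; have h := psi_sqr_mono (leq_subr d k); have h3 := psi_gt0 k.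
have hk := pos_INR (k - d).
apply (Rle_div_l _ _ (psi k)) => //.
have -> : ((INR k + 1) / (INR (k - d) + 1)) ^ 2 * psi k = psi k * (INR k + 1) ^ 2 / (INR (k - d) + 1) ^ 2.
  by field; lra.
by apply (Rle_div_r _ _ ((INR (k - d) + 1) ^ 2)) => //; nra.
Qed.

(** The excess over [psi l / 4] is at most [(1 + t) ^ 2] with t = (l + 1) / (k - l). For an arc
    covering at most about half of the points, t <= 2 (l + 1) / (k + 1) <= 1, whence
    [(1 + t) ^ 2 <= 1 + 3 t]. *)
Lemma qk_le_main k l : (2 * l.+1 <= k.+1)%N ->
  qk k l <= psi l / 4 * (1 + 6 * (INR l + 1) / (INR k + 1)).
Proof.
move=> hl; have h1 := psi_gt0 l; have h3 := psi_gt0 k.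
have -> : qk k l = psi l / 4 * (psi (k - l.+1) / psi k) by rewrite /qk; field; lra.
apply: Rmult_le_compat_l; first lra.
have hlk : (l.+1 <= k)%N by lia.
apply: Rle_trans (psi_ratio_le hlk) _.
have -> : INR (k - l.+1) + 1 = INR k - INR l.
  by rewrite minus_INR; [rewrite S_INR; ring | apply/leP].
have hl' : 2 * (INR l + 1) <= INR k + 1.
  by have := INR_leq hl; rewrite INR_muln !S_INR /=; lra.
have hl0 := pos_INR l; move: (INR l) (INR k) hl' hl0 => x y hl' hl0.
have -> : ((y + 1) / (y - x)) ^ 2 = (1 + (x + 1) / (y - x)) ^ 2 by field; lra.
have ht : (x + 1) / (y - x) <= 2 * ((x + 1) / (y + 1)).
  have -> : 2 * ((x + 1) / (y + 1)) = (x + 1) / ((y + 1) / 2) by field; lra.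
  by apply: Rmult_le_compat_l; [lra | apply: Rinv_le_contravar; lra].
have ht1 : 2 * ((x + 1) / (y + 1)) <= 1.
  have -> : 2 * ((x + 1) / (y + 1)) = (2 * (x + 1)) / (y + 1) by field; lra.
  by apply (Rle_div_l _ _ (y + 1)); lra.
have ht0 : 0 < (x + 1) / (y - x) by apply: Rdiv_lt_0_compat; lra.
rewrite (_ : 6 * (x + 1) / (y + 1) = 3 * (2 * ((x + 1) / (y + 1)))); last by field; lra.
nra.
Qed.

(** In this range the correction [6 * (l + 1) / (k + 1)] is at most 3, so the factor (1 + 3) / 4
    equals 1. *)
Lemma qk_le_psi k l : (2 * l.+1 <= k.+1)%N -> qk k l <= psi l.
Proof.
move=> hl; apply: Rle_trans (qk_le_main hl) _; have h1 := psi_gt0 l.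
have hk := pos_INR k.
have : 6 * (INR l + 1) / (INR k + 1) <= 3.
  apply (Rle_div_l _ _ (INR k + 1)); first lra.
  by have := INR_leq hl; rewrite INR_muln !S_INR /=; lra.
nra.
Qed.

Lemma qk_sym k l : (l < k)%N -> qk k (k - l.+1) = qk k l.
Proof.
by move=> hl; rewrite /qk (_ : (k - (k - l.+1).+1)%N = l); [rewrite (Rmult_comm (psi l)) | lia].
Qed.

(** The gap [g] is twice the index, which costs at most a factor 2^(3/2) < 3. *)
Lemma psi_half_le g : ~~ odd g -> psi g./2 <= 3 * wgap g.
Proof.
move=> hg; apply: Rle_trans (psi_le_w32 _) _; rewrite /wgap /w32.
have e : INR g = 2 * INR g./2 by rewrite -[2]/(INR 2) -INR_muln; congr INR; lia.
rewrite e; move: (INR g./2) (pos_INR g./2) => x hx.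
have h1 := sqrt_lt_R0 (x + 1) ltac:(lra); have e1 := sqrt_sqrt (x + 1) ltac:(lra).
have h2 := sqrt_lt_R0 (2 * x + 1) ltac:(lra); have e2 := sqrt_sqrt (2 * x + 1) ltac:(lra).
have h : sqrt (2 * x + 1) <= 3 / 2 * sqrt (x + 1) by nra.
have -> : 3 * (1 / ((2 * x + 1) * sqrt (2 * x + 1))) = 1 / ((2 * x + 1) * sqrt (2 * x + 1) / 3).
  by field; lra.
rewrite /Rdiv !Rmult_1_l; apply: Rinv_le_contravar; first nra.
nra.
Qed.

(** * Probabilities of one arc and of two arcs *)

Section Probabilities.
Variable n : nat.
Local Notation pt := 'I_(2 * n).
Implicit Types (x y z : pt) (S : {set pt}) (P : {set {set pt}}).

Definition ncat S : R := INR #|catalan_matchings S|.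
Definition avgM S (F : {set {set pt}} -> R) : R := / ncat S * \sum_(P in catalan_matchings S) F P.

Lemma arc_ind_ge0 P x y : 0 <= arc_ind P x y.
Proof. by rewrite /arc_ind; case: ifP => _; lra. Qed.

Lemma arc_indC P x y : arc_ind P x y = arc_ind P y x.
Proof. by rewrite /arc_ind setUC. Qed.

Lemma arc_ind_out S P x y : P \in catalan_matchings S -> ~~ ((x \in S) && (y \in S)) -> arc_ind P x y = 0.
Proof.
rewrite inE => hP h; rewrite /arc_ind; case: ifP => // hA; move/negP: h; case.
by apply/andP; split; apply: (catalan_sub hP hA); rewrite mem_arc eqxx ?orbT.
Qed.

Lemma sum_partner S P x : P \in catalan_matchings S -> x \in S ->
  \sum_(y in S | y != x) arc_ind P x y = 1.
Proof.
rewrite inE => hP hx; case/catalan_matchingP: (hP) => h1 h2 h3 _.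
have [A hA hxA] := h2 x hx; have [u [v [huv hu hv e]]] := h1 A hA.
have [y [hy hyx eA]] : exists y, [/\ y \in S, y != x & A = [set x; y]].
  move: hxA; rewrite e mem_arc => /orP[/eqP->|/eqP->]; [exists v | exists u]; split=> //.
  - by rewrite -val_eqE /=; lia.
  - by rewrite -val_eqE /=; lia.
  - by rewrite setUC.
rewrite (bigD1 y) ?hy //= {1}/arc_ind -eA hA big1 ?Rplus_0_r // => z /andP[/andP[hz hzx] hzy].
rewrite /arc_ind; case: ifP => // hB.
have eB := h3 _ _ x hB hA; rewrite mem_arc eqxx hxA in eB.
have := eB isT isT; rewrite eA => /setP /(_ z); rewrite !mem_arc eqxx orbT.
by rewrite (negbTE hzx) (negbTE hzy).
Qed.

Lemma card_in_out S x y : (x < y)%N -> x \in S -> y \in S ->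
  #|S| = (#|inside S x y| + #|outside S x y|).+2.
Proof.
move=> hxy hx hy.
have hyx : y != x by rewrite -val_eqE /=; lia.
rewrite (cardsD1 x) hx (cardsD1 y (S :\ x)) !inE hy hyx /= !add1n.
congr _.+2; rewrite -cardsUI; set X := _ :&: _.
have -> : X = set0 by apply/setP => z; rewrite !inE; lia.
rewrite cards0 addn0; apply: eq_card => z; rewrite !inE -!val_eqE /=.
by case: (z \in S); rewrite ?andbF //=; lia.
Qed.

Lemma sum_catalan1 S : \sum_(P in catalan_matchings S) 1 = ncat S.
Proof. by rewrite rsum_const Rmult_1_r. Qed.

Lemma ncat_with_arc S x y : (x < y)%N -> x \in S -> y \in S ->
  \sum_(P in catalan_matchings S) arc_ind P x y = ncat (inside S x y) * ncat (outside S x y).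
Proof.
move=> hxy hx hy; rewrite (eq_bigr (fun P => arc_ind P x y * 1)); last by move=> *; ring.
rewrite sum_with_arc // -!sum_catalan1.
by rewrite big_distrl /=; apply: eq_bigr => P _; rewrite Rmult_1_l.
Qed.

(** Summing over the partner of the leftmost point gives the Catalan recursion: the points inside
    its arc are exactly those between it and the partner. *)
Lemma ncatE S : ncat S = catv #|S|.
Proof.
move: {2}#|S|.+1 (ltnSn #|S|) => s; elim: s S => [|s IH] S hs //.
case: (posnP #|S|) => hS.
  rewrite hS; have -> : S = set0 by apply/eqP; rewrite -cards_eq0 hS.
  rewrite /catv /= catal0 /ncat (_ : catalan_matchings set0 = [set set0]) ?cards1 //.
  apply/setP => P; rewrite !inE; apply/idP/eqP => [/catalan_matchingP[h1 _ _ _]|->].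
    by apply/setP => A; rewrite inE; apply/negP => /h1[u [v [_]]]; rewrite inE.
  by apply/catalan_matchingP; split=> [A|z|A B z|a b c d _ _ _]; rewrite inE.
have /set0Pn[i0 hi0] : S != set0 by rewrite -card_gt0.
case: (@arg_minnP _ i0 (fun i => i \in S) (@nat_of_ord _) hi0) => x hx hmin.
rewrite -sum_catalan1.
rewrite (eq_bigr (fun P => \sum_(y in S | y != x) arc_ind P x y)); last by move=> P hP; rewrite sum_partner.
rewrite exchange_big /=.
have lt y : y \in S -> y != x -> (x < y)%N.
  by move=> hy; have := hmin y hy; rewrite -val_eqE /=; lia.
rewrite (eq_bigr (fun y => catv #|[set z in S :\ x | (z < y)%N]| *
           catv (#|S| - 2 - #|[set z in S :\ x | (z < y)%N]|))); last first.
  move=> y /andP[hy hyx]; have hxy := lt y hy hyx.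
  have hc := card_in_out hxy hx hy.
  rewrite ncat_with_arc // !IH; try lia.
  have e : inside S x y = [set z in S :\ x | (z < y)%N].
    apply/setP => z; rewrite !inE; case: (boolP (z \in S)) => hz; rewrite ?andbF //= andbT.
    by have := hmin z hz; rewrite -val_eqE /=; lia.
  by rewrite -e; congr (_ * catv _); lia.
rewrite (eq_bigl (fun y => y \in S :\ x)); last by move=> y; rewrite !inE andbC.
rewrite (sum_rank_left (S :\ x) (fun i => catv i * catv (#|S| - 2 - i))).
have := cardsD1 x S; rewrite hx; move: #|S| #|S :\ x| => a b -> /=.
rewrite add1n; case: b => [|b]; first by rewrite big_ord0.
by rewrite subn2 /= catv_rec.
Qed.

Lemma ncat_even S k : #|S| = (2 * k)%N -> ncat S = catal k.
Proof. by move=> h; rewrite ncatE h /catv mul2n odd_double doubleK. Qed.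

Lemma arc_ind_add_arc_in S x y P1 P2 x' y' : P1 \in catalan_matchings (inside S x y) ->
  P2 \in catalan_matchings (outside S x y) -> (x < x')%N -> (x' < y)%N ->
  arc_ind (add_arc x y (P1, P2)) x' y' = arc_ind P1 x' y'.
Proof.
move=> h1 h2 hx hy; rewrite /arc_ind !inE.
have -> : ([set x'; y'] == [set x; y]) = false.
  by apply/eqP => /setP /(_ x'); rewrite !mem_arc eqxx -!val_eqE /=; lia.
have -> : ([set x'; y'] \in P2) = false; last by rewrite orbF.
apply/negP => hA; rewrite inE in h2; have := catalan_sub h2 hA; move=> /(_ x').
by rewrite mem_arc eqxx inE; lia.
Qed.

Lemma arc_ind_add_arc_out S x y P1 P2 x' y' : P1 \in catalan_matchings (inside S x y) ->
  P2 \in catalan_matchings (outside S x y) -> (x <= y)%N -> (x' < x)%N || (y < x')%N ->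
  arc_ind (add_arc x y (P1, P2)) x' y' = arc_ind P2 x' y'.
Proof.
move=> h1 h2 hxy hx; rewrite /arc_ind !inE.
have -> : ([set x'; y'] == [set x; y]) = false.
  by apply/eqP => /setP /(_ x'); rewrite !mem_arc eqxx -!val_eqE /=; lia.
have -> : ([set x'; y'] \in P1) = false; last by [].
apply/negP => hA; rewrite inE in h1; have := catalan_sub h1 hA; move=> /(_ x').
by rewrite mem_arc eqxx inE; lia.
Qed.

Definition prob1 S x y : R := avgM S (fun P => arc_ind P x y).
Definition prob2 S x y x' y' : R := avgM S (fun P => arc_ind P x y * arc_ind P x' y').

Lemma avgM_le S F G : (forall P, P \in catalan_matchings S -> F P <= G P) -> avgM S F <= avgM S G.
Proof.
move=> h; rewrite /avgM; apply: Rmult_le_compat_l; last exact: rsum_le.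
(* A set without matchings has [ncat S = 0]; the convention [/ 0 = 0] keeps the weight
   nonnegative. *)
rewrite /ncat; case: (#|_|) => [|j]; first by rewrite /= Rinv_0; lra.
by apply/Rlt_le/Rinv_0_lt_compat; apply: INR_gt0.
Qed.

Lemma avgM_eq S F G : (forall P, P \in catalan_matchings S -> F P = G P) -> avgM S F = avgM S G.
Proof. by move=> h; rewrite /avgM (eq_bigr _ h). Qed.

Lemma avgM0 S : avgM S (fun _ => 0) = 0.
Proof. by rewrite /avgM big1 // Rmult_0_r. Qed.

Lemma avgM_ge0 S F : (forall P, P \in catalan_matchings S -> 0 <= F P) -> 0 <= avgM S F.
Proof. by move=> h; rewrite -(avgM0 S); exact: avgM_le. Qed.

Lemma avgMZ S c F : avgM S (fun P => c * F P) = c * avgM S F.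
Proof. by rewrite /avgM -big_distrr /=; ring. Qed.

Lemma avgM_sum S (I : Type) (r : seq I) (Q : pred I) (F : I -> {set {set pt}} -> R) :
  avgM S (fun P => \sum_(i <- r | Q i) F i P) = \sum_(i <- r | Q i) avgM S (F i).
Proof. by rewrite /avgM exchange_big /= big_distrr. Qed.

Lemma avgMD S F G : avgM S (fun P => F P + G P) = avgM S F + avgM S G.
Proof. by rewrite /avgM big_split /=; ring. Qed.

Lemma avgM_const S k c : #|S| = (2 * k)%N -> avgM S (fun _ => c) = c.
Proof.
move=> h; rewrite /avgM rsum_const -/(ncat S) (ncat_even h); have := catal_gt0 k => h0; field; lra.
Qed.

Lemma prob1_ge0 S x y : 0 <= prob1 S x y.
Proof. by apply: avgM_ge0 => P _; exact: arc_ind_ge0. Qed.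

Lemma prob1C S x y : prob1 S x y = prob1 S y x.
Proof. by apply: avgM_eq => P _; exact: arc_indC. Qed.

Lemma prob1_out S x y : ~~ ((x \in S) && (y \in S)) -> prob1 S x y = 0.
Proof. by move=> h; rewrite -(avgM0 S); apply: avgM_eq => P hP; exact: arc_ind_out h. Qed.

Lemma prob1E S k x y : #|S| = (2 * k)%N -> (x < y)%N -> x \in S -> y \in S ->
  prob1 S x y = if odd #|inside S x y| then 0 else qk k #|inside S x y|./2.
Proof.
move=> hk hxy hx hy; have hc := card_in_out hxy hx hy.
rewrite /prob1 /avgM ncat_with_arc // (ncat_even hk) !ncatE /catv.
case: ifP => ho; first by rewrite Rmult_0_l Rmult_0_r.
rewrite (_ : odd #|outside S x y| = false); last lia.
set l := #|inside S x y|./2.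
have -> : #|outside S x y|./2 = (k - l.+1)%N by lia.
have e : (k = l + (k - l.+1) + 1)%N by lia.
rewrite /catal [in 4 ^ k]e !pow_add /qk; have h := psi_gt0 k.
have := pow_lt 4 l ltac:(lra); have := pow_lt 4 (k - l.+1) ltac:(lra) => h1 h2.
by field; lra.
Qed.

Lemma prob1_ge S k x y : #|S| = (2 * k)%N -> (x < y)%N -> x \in S -> y \in S ->
  (if odd #|inside S x y| then 0 else psi #|inside S x y|./2 / 4) <= prob1 S x y.
Proof.
by move=> hk hxy hx hy; rewrite (prob1E hk) //; case: ifP => _; [lra | exact: qk_ge].
Qed.

Lemma prob1_short S k x y : #|S| = (2 * k)%N -> (x < y)%N -> (#|inside S x y| < k)%N ->
  prob1 S x y <= 3 * wgap #|inside S x y|.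
Proof.
move=> hk hxy hs; have hw := wgap_gt0 #|inside S x y|.
case: (boolP ((x \in S) && (y \in S))) => [/andP[hx hy]|h]; last by rewrite prob1_out //; lra.
rewrite (prob1E hk) //; case: ifP => ho; first lra.
apply: Rle_trans (psi_half_le _); last by rewrite ho.
by apply: qk_le_psi; lia.
Qed.

Lemma prob2_out S x y x' y' : ~~ [&& x \in S, y \in S, x' \in S & y' \in S] -> prob2 S x y x' y' = 0.
Proof.
move=> h; rewrite -(avgM0 S); apply: avgM_eq => P hP.
case: (boolP ((x \in S) && (y \in S))) => h1; last by rewrite (arc_ind_out hP h1) Rmult_0_l.
case: (boolP ((x' \in S) && (y' \in S))) => h2; last by rewrite (arc_ind_out hP h2) Rmult_0_r.
by move: h; rewrite andbA h1 h2.
Qed.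

(** Splitting at the outer arc and then at the inner one leaves three independent blocks: under the
    inner arc, between the arcs, and outside. The outside block contributes a bounded ratio since
    the outer arc is short, and 9/4 = 3 * 3 / 4 from [psi_half_le] used twice. *)
Lemma prob2_nested S k x y x' y' : #|S| = (2 * k)%N -> (x < x')%N -> (x' < y')%N -> (y' < y)%N ->
  (#|inside S x y| < k)%N ->
  prob2 S x y x' y' <= 9 / 4 * wgap #|inside S x' y'| * wgap #|outside (inside S x y) x' y'|.
Proof.
move=> hk hx hxy hy hs.
have w1 := wgap_gt0 #|inside S x' y'|; have w2 := wgap_gt0 #|outside (inside S x y) x' y'|.
case: (boolP [&& x \in S, y \in S, x' \in S & y' \in S]) => [/and4P[h1 h2 h3 h4]|h]; last first.
  by rewrite prob2_out //; nra.
rewrite /prob2 /avgM sum_with_arc //; last lia.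
have hx' : x' \in inside S x y by rewrite inE h3; lia.
have hy' : y' \in inside S x y by rewrite inE h4; lia.
have hc := card_in_out (ltn_trans hx (ltn_trans hxy hy)) h1 h2.
have hc' := card_in_out hxy hx' hy'.
have ei : inside (inside S x y) x' y' = inside S x' y'.
  by apply/setP => z; rewrite !inE; case: (z \in S) => //=; lia.
rewrite ei in hc'.
rewrite (eq_bigr (fun P1 => arc_ind P1 x' y' * ncat (outside S x y))); last first.
  move=> P1 hP1; rewrite -sum_catalan1 big_distrr /=; apply: eq_bigr => P2 hP2.
  by rewrite (arc_ind_add_arc_in _ hP1 hP2) //; [ring | lia].
rewrite -big_distrl /= ncat_with_arc // ei (ncat_even hk) !ncatE /catv.
have c0 := catal_gt0 k.
have nn : 0 <= 9 / 4 * wgap #|inside S x' y'| * wgap #|outside (inside S x y) x' y'| by nra.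
case: (boolP (odd #|inside S x' y'|)) => o1; first by rewrite Rmult_0_l Rmult_0_l Rmult_0_r.
case: (boolP (odd #|outside (inside S x y) x' y'|)) => o2; first by rewrite Rmult_0_r Rmult_0_l Rmult_0_r.
rewrite (_ : odd #|outside S x y| = false); last lia.
have arc_prob := psi_half_le o1; have arc_prob2 := psi_half_le o2.
set l1 := #|inside S x' y'|./2 in arc_prob *; set l2 := #|outside (inside S x y) x' y'|./2 in arc_prob2 *.
have -> : #|outside S x y|./2 = (k - (l1 + l2 + 1).+1)%N by lia.
have hq : qk k (l1 + l2 + 1) <= psi (l1 + l2 + 1) by apply: qk_le_psi; lia.
have e : (k = l1 + l2 + 2 + (k - (l1 + l2 + 1).+1))%N by lia.
have E : / catal k * (catal l1 * catal l2 * catal (k - (l1 + l2 + 1).+1)) =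
   psi l1 * psi l2 * (qk k (l1 + l2 + 1) / psi (l1 + l2 + 1)) / 4.
  rewrite /catal [in 4 ^ k]e !pow_add /qk; have h := psi_gt0 k; have h' := psi_gt0 (l1 + l2 + 1).
  have a1 := pow_lt 4 l1 ltac:(lra); have a2 := pow_lt 4 l2 ltac:(lra).
  have a3 := pow_lt 4 (k - (l1 + l2 + 1).+1) ltac:(lra).
  by rewrite /=; field; lra.
rewrite E; have h' := psi_gt0 (l1 + l2 + 1).
have hr : qk k (l1 + l2 + 1) / psi (l1 + l2 + 1) <= 1 by apply (Rle_div_l _ _ (psi (l1 + l2 + 1))); lra.
have r0 : 0 < qk k (l1 + l2 + 1) / psi (l1 + l2 + 1) by apply: Rdiv_lt_0_compat => //; exact: qk_gt0.
have q1 := psi_gt0 l1; have q2 := psi_gt0 l2.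
have := Rmult_le_compat _ _ _ _ (Rlt_le _ _ q1) (Rlt_le _ _ q2) arc_prob arc_prob2.
have q12 := Rmult_lt_0_compat _ _ q1 q2.
have := Rmult_le_compat_l _ _ _ (Rlt_le _ _ q12) hr; rewrite Rmult_1_r => u v.
have -> a b : 9 / 4 * a * b = 3 * a * (3 * b) / 4 by field.
by apply: Rmult_le_compat_r; [lra | exact: Rle_trans u v].
Qed.

(** The joint probability is exactly [(psi l1 / 4) * (psi l2 / 4)] times
    [psi (k - (l1 + l2 + 2)) / psi k]. The first two factors are at most the single-arc
    probabilities, and the last is controlled because the arcs cover few points. *)
Lemma prob2_side S k D x y x' y' : #|S| = (2 * k)%N -> (x < y)%N -> (y < x')%N -> (x' < y')%N ->
  (#|inside S x y| + #|inside S x' y'| <= 2 * D)%N -> (D.+1 < k)%N ->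
  prob2 S x y x' y' <= ((INR k + 1) / (INR (k - D.+2) + 1)) ^ 2 * (prob1 S x y * prob1 S x' y').
Proof.
move=> hk hxy hx hxy' hD hDk.
set rho := _ ^ 2.
have rho0 : 0 <= rho by apply: pow2_ge_0.
have g1 := prob1_ge0 S x y; have g2 := prob1_ge0 S x' y'.
case: (boolP [&& x \in S, y \in S, x' \in S & y' \in S]) => [/and4P[h1 h2 h3 h4]|h]; last first.
  by rewrite prob2_out //; apply: Rmult_le_pos => //; nra.
have P1 := prob1_ge hk hxy h1 h2; have P2 := prob1_ge hk hxy' h3 h4.
rewrite /prob2 /avgM sum_with_arc //.
have hx' : x' \in outside S x y by rewrite inE h3; lia.
have hy' : y' \in outside S x y by rewrite inE h4; lia.
have hc := card_in_out hxy h1 h2; have hc' := card_in_out hxy' hx' hy'.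
have ei : inside (outside S x y) x' y' = inside S x' y'.
  by apply/setP => z; rewrite !inE; case: (z \in S) => //=; lia.
rewrite ei in hc'.
rewrite (eq_bigr (fun P1 => ncat (inside (outside S x y) x' y') * ncat (outside (outside S x y) x' y'))); last first.
  move=> P hP; rewrite -ncat_with_arc //; apply: eq_bigr => P' hP'.
  by rewrite (arc_ind_add_arc_out _ hP hP') //; lia.
rewrite rsum_const -/(ncat _) ei (ncat_even hk) !ncatE /catv.
have rhs0 : 0 <= rho * (prob1 S x y * prob1 S x' y') by apply: Rmult_le_pos => //; nra.
move: P1 P2.
case: (boolP (odd #|inside S x y|)) => o1 P1; first by rewrite Rmult_0_l Rmult_0_r.
case: (boolP (odd #|inside S x' y'|)) => o2 P2; first by rewrite Rmult_0_l !Rmult_0_r.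
rewrite (_ : odd #|outside (outside S x y) x' y'| = false); last lia.
set l1 := #|inside S x y|./2 in P1 *; set l2 := #|inside S x' y'|./2 in P2 *.
have -> : #|outside (outside S x y) x' y'|./2 = (k - (l1 + l2 + 2))%N by lia.
have e : (k = l1 + l2 + 2 + (k - (l1 + l2 + 2)))%N by lia.
have E : / catal k * (catal l1 * (catal l2 * catal (k - (l1 + l2 + 2)))) =
   psi (k - (l1 + l2 + 2)) / psi k * ((psi l1 / 4) * (psi l2 / 4)).
  rewrite /catal [in 4 ^ k]e !pow_add; have h := psi_gt0 k.
  have a1 := pow_lt 4 l1 ltac:(lra); have a2 := pow_lt 4 l2 ltac:(lra).
  have a3 := pow_lt 4 (k - (l1 + l2 + 2)) ltac:(lra).
  by rewrite /=; field; lra.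
rewrite E; have q1 := psi_gt0 l1; have q2 := psi_gt0 l2.
apply: Rmult_le_compat; [| nra | | by apply: Rmult_le_compat; lra].
  by apply/Rlt_le/Rdiv_lt_0_compat; exact: psi_gt0.
apply: (@Rle_trans _ (psi (k - D.+2) / psi k)); last by apply: psi_ratio_le; lia.
apply: Rmult_le_compat_r; first by apply/Rlt_le/Rinv_0_lt_compat/psi_gt0.
by apply: psi_anti; lia.
Qed.

End Probabilities.

(** * Arcs leaving a window *)

(** At most [g + 1] pairs [(i, j)] have sum [g]. *)
Lemma sum_diag (F : nat -> R) N : (forall g, 0 <= F g) ->
  \sum_(i < N) \sum_(j < N) F (i + j)%N <= \sum_(g < 2 * N) (INR g + 1) * F g.
Proof.
move=> hF.
apply: (@Rle_trans _ (\sum_(i < N) \sum_(g < 2 * N | (i <= g)%N) F g)).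
  apply: rsum_le => i _; have hi := ltn_ord i.
  have hlt (j : 'I_N) : (i + j < 2 * N)%N by have := ltn_ord j; lia.
  pose h (j : 'I_N) := Ordinal (hlt j).
  have hinj : {in [set: 'I_N] &, injective h}.
    by move=> j j' _ _ /(congr1 val) /= /addnI /val_inj.
  apply: (@Rle_trans _ (\sum_(g in h @: [set: 'I_N]) F g)).
    by rewrite big_imset //=; apply: Req_le; apply: eq_bigl => j; rewrite inE.
  apply: rsum_sub => // g /imsetP[j _ ->] /=; exact: leq_addr.
rewrite (exchange_big_dep predT) //=; apply: rsum_le => g _.
rewrite -(big_mkord (fun i => (i <= g)%N) (fun _ => F g)).
apply: (@Rle_trans _ (\sum_(i < g.+1) F g)); last first.
  by rewrite rsum_const card_ord S_INR; apply: Rle_refl.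
rewrite -(big_mkord predT (fun _ => F g)).
case: (leqP N g.+1) => h.
  rewrite (big_cat_nat (n := N) (p := g.+1)) //=.
  rewrite -[X in X <= _]Rplus_0_r; apply: Rplus_le_compat; last by apply: rsum_ge0.
  by apply: rsum_sub.
rewrite (big_cat_nat (n := g.+1) (p := N)) //=; last lia.
rewrite [X in _ + X]big_nat_cond [X in _ + X]big_pred0 ?Rplus_0_r; last by move=> i; lia.
by apply: rsum_sub.
Qed.

Section Upper.
Variable n : nat.
Local Notation pt := 'I_(2 * n).
Implicit Types (x y z b d : pt) (S T W : {set pt}) (P : {set {set pt}}).

Lemma card_le2n S : (#|S| <= 2 * n)%N.
Proof. by rewrite -[X in (_ <= X)%N]card_ord max_card. Qed.

(** For fixed [x] the gap is the rank of [y] among the points of [S] to the right of [x], so it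
    takes each value once. *)
Lemma sum_gap_right S x (F : nat -> R) :
  \sum_(y in S | (x < y)%N) F #|inside S x y| = \sum_(i < #|[set z in S | (x < z)%N]|) F i.
Proof.
rewrite -sum_rank_left; apply: eq_big => [y|y /andP[hy hxy]]; first by rewrite inE.
by congr F; apply: eq_card => z; rewrite !inE andbA.
Qed.

Lemma sum_gap_left S y (F : nat -> R) :
  \sum_(x in S | (x < y)%N) F #|inside S x y| = \sum_(i < #|[set z in S | (z < y)%N]|) F i.
Proof.
rewrite -sum_rank_right; apply: eq_big => [x|x /andP[hx hxy]]; first by rewrite inE.
by congr F; apply: eq_card => z; rewrite !inE andbAC andbA.
Qed.

Lemma sum_gap_right_le S x N (F : nat -> R) : (forall i, 0 <= F i) ->
  (#|[set z in S | (x < z)%N]| <= N)%N ->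
  \sum_(y in S | (x < y)%N) F #|inside S x y| <= \sum_(i < N) F i.
Proof. by move=> hF hN; rewrite sum_gap_right; exact: rsum_ord_widen. Qed.

Lemma sum_gap_left_le S y N (F : nat -> R) : (forall i, 0 <= F i) ->
  (#|[set z in S | (z < y)%N]| <= N)%N ->
  \sum_(x in S | (x < y)%N) F #|inside S x y| <= \sum_(i < N) F i.
Proof. by move=> hF hN; rewrite sum_gap_left; exact: rsum_ord_widen. Qed.

Lemma inside_split S x b y : (x < b)%N -> (b < y)%N -> b \notin S ->
  #|inside S x y| = (#|inside S x b| + #|inside S b y|)%N.
Proof.
move=> h1 h2 hb; rewrite -cardsUI; set X := _ :&: _.
have -> : X = set0 by apply/setP => z; rewrite !inE; lia.
rewrite cards0 addn0; apply: eq_card => z; rewrite !inE.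
case: (boolP (z \in S)) => hz //=.
have : z != b by apply: contraNneq hb => <-.
by rewrite -val_eqE /=; lia.
Qed.

(** Double counting from a point [b] of [T] below the arc: [b] cuts the gap into [i] points on its
    left and [j] on its right, and these two numbers determine the arc. This turns a count of
    [T]-points into the factor [#|T|]. *)
Lemma sum_window S T (F : nat -> R) N : [disjoint S & T] -> (forall i, 0 <= F i) ->
  (forall b, #|[set z in S | (z < b)%N]| <= N)%N -> (forall b, #|[set z in S | (b < z)%N]| <= N)%N ->
  \sum_(x in S) \sum_(y in S | (x < y)%N) F #|inside S x y| * INR #|inside T x y| <=
  INR #|T| * \sum_(i < N) \sum_(j < N) F (i + j)%N.
Proof.
move=> hST hF h1 h2.
have cardsum x y : INR #|inside T x y| = \sum_(b in T | (x < b)%N && (b < y)%N) 1.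
  rewrite -[LHS]Rmult_1_r -rsum_const; apply: eq_bigl => b; rewrite inE //.
under eq_bigr do under eq_bigr do rewrite cardsum big_distrr.
rewrite /=.
rewrite (eq_bigr (fun x => \sum_(b in T) \sum_(y | ((y \in S) && (x < y)%N) &&
   ((b \in T) && ((x < b)%N && (b < y)%N))) F #|inside S x y| * 1)); last first.
  by move=> x _; rewrite (exchange_big_dep (mem T)) //= => y b _ /andP[].
rewrite exchange_big /= -rsum_const; apply: rsum_le => b hb.
have hbS : b \notin S.
  by apply: contraL hb => hb; move: hST; rewrite disjoint_subset => /subsetP /(_ _ hb); rewrite inE.
apply: (@Rle_trans _ (\sum_(x in S | (x < b)%N) \sum_(y in S | (b < y)%N) F (#|inside S x b| + #|inside S b y|)%N)).
  rewrite [X in _ <= X]big_mkcondr /=; apply: rsum_le => x hx; case: ifP => hxb.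
    apply: Req_le; apply: eq_big => [y|y /and3P[/andP[hy hxy] _ hby]].
      by rewrite hb /=; case: (y \in S) => //=; lia.
    by rewrite Rmult_1_r; congr F; apply: inside_split => //; case/andP: hby.
  by rewrite big_pred0; [apply: Rle_refl | move=> y; rewrite /= !andbF].
apply: Rle_trans (_ : \sum_(x in S | (x < b)%N) \sum_(j < N) F (#|inside S x b| + j)%N <= _).
  apply: rsum_le => x _; apply: (sum_gap_right_le (F := fun j => F (#|inside S x b| + j)%N)) => //.
apply: (sum_gap_left_le (F := fun i => \sum_(j < N) F (i + j)%N)) => // i; exact: rsum_ge0.
Qed.

Lemma prob1_total T m b : #|T| = (2 * m)%N -> b \in T -> \sum_(d in T | d != b) prob1 T b d = 1.
Proof.
move=> hm hb; rewrite -avgM_sum (avgM_eq (G := fun _ => 1)) ?(avgM_const _ hm) //.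
by move=> P hP; exact: sum_partner.
Qed.

Lemma cbin_uphalf_le s : cbin (uphalf s.+1) <= sqrt (2 / PI) * (1 / sqrt (INR s + 1)).
Proof.
have P0 := PI_RGT_0; have hs := pos_INR s.
apply: Rle_trans (cbin_le _) _; first lia.
have h1 : INR s + 1 <= 2 * INR (uphalf s.+1).
  by rewrite -S_INR -[2]/(INR 2) -INR_muln; apply: INR_leq; lia.
rewrite /Rdiv !Rmult_1_l -sqrt_inv -sqrt_inv -sqrt_mult; last 2 first.
  - by apply/Rlt_le/Rmult_lt_0_compat; [lra | apply: Rinv_0_lt_compat].
  - by apply/Rlt_le/Rinv_0_lt_compat; lra.
apply: sqrt_le_1_alt.
have -> : 2 * / PI * / (INR s + 1) = / (PI * ((INR s + 1) / 2)) by field; lra.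
apply: Rinv_le_contravar; first by apply: Rmult_lt_0_compat; lra.
by apply: Rmult_le_compat_l; lra.
Qed.

Lemma sum_cbin_uphalf t : \sum_(s < t) cbin (uphalf s) <= 1 + 2 * sqrt (2 / PI) * sqrt (INR t).
Proof.
have P0 := PI_RGT_0; have h0 := sqrt_pos (2 / PI).
case: t => [|t]; first by rewrite big_ord0 [INR 0]/= sqrt_0; lra.
rewrite big_ord_recl [cbin _]/=; apply: Rplus_le_compat_l.
apply: (@Rle_trans _ (\sum_(s < t) sqrt (2 / PI) * (1 / sqrt (INR s + 1)))).
  by apply: rsum_le => s _; exact: cbin_uphalf_le.
rewrite -big_distrr /=.
apply: (@Rle_trans _ (sqrt (2 / PI) * (2 * sqrt (INR t)))).
  by apply: Rmult_le_compat_l => //; exact: sum_inv_sqrt.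
have : sqrt (INR t) <= sqrt (INR t.+1) by apply/sqrt_le_1_alt/INR_leq.
rewrite -[match t with | 0%N => 1 | _.+1 => INR t + 1 end]/(INR t.+1); nra.
Qed.

(* The expected number of arcs leaving a window is computed from the two-point function alone:
   each point of the window is matched outside with probability one minus the sum of
   its arc probabilities inside, and the latter are at least those of the infinite model. *)
Lemma window_exit T m W : #|T| = (2 * m)%N -> W \subset T ->
  (forall b d z, b \in W -> d \in W -> (b < z)%N -> (z < d)%N -> z \in T -> z \in W) ->
  \sum_(b in W) \sum_(d in T :\: W) prob1 T b d <= 1 + 2 * sqrt (2 / PI) * sqrt (INR #|W|).
Proof.
move=> hm /subsetP hWT hcv; apply: Rle_trans (sum_cbin_uphalf _).
pose phi g := if odd g then 0 else psi g./2 / 4.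
have sphi r : \sum_(i < r) phi i = (1 - cbin (uphalf r)) / 2.
  rewrite /phi (sum_even r (fun j => psi j / 4)) -sum_psi_half /Rdiv big_distrl /=.
  by apply: eq_bigr => i _; field.
have insW b d : b \in W -> d \in W -> inside W b d = inside T b d.
  move=> hb hd; apply/setP => z; rewrite !inE; apply/and3P/and3P => -[h1 h2 h3]; split => //; auto.
  exact: hcv h2 h3 h1.
(* The probability that [b] is matched out of [W] splits into two halves governed by its right and
   its left rank in [W]. Each rank runs through all values below [#|W|], so the halves recombine
   into one sum. *)
apply: (@Rle_trans _ (\sum_(b in W) (cbin (uphalf #|[set z in W | (b < z)%N]|) / 2 +
                                cbin (uphalf #|[set z in W | (z < b)%N]|) / 2))); last first.
  rewrite big_split /= (sum_rank_right W (fun s => cbin (uphalf s) / 2))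
    (sum_rank_left W (fun s => cbin (uphalf s) / 2)) -big_split /=.
  by apply: Req_le; apply: eq_bigr => s _; field.
apply: rsum_le => b hb.
have := prob1_total hm (hWT b hb).
rewrite (bigID (mem W)) /= => htot.
have -> : \sum_(d in T :\: W) prob1 T b d = \sum_(i in T | (i != b) && (i \notin W)) prob1 T b i.
  apply: eq_bigl => d; rewrite !inE; case: (boolP (d \in W)) => hd; rewrite ?andbF //= andbT.
  by rewrite (_ : d != b) ?andbT //; apply: contraNneq hd => ->.
have e2 : \sum_(i in T | (i != b) && (i \in W)) prob1 T b i =
   \sum_(d in W | (b < d)%N) prob1 T b d + \sum_(d in W | (d < b)%N) prob1 T b d.
  rewrite (bigID (fun d : pt => (b < d)%N)) /=; congr (_ + _); apply: eq_bigl => d.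
    case: (boolP (d \in W)) => hd; rewrite ?andbF //= (hWT _ hd) /= andbT -val_eqE /=; lia.
  case: (boolP (d \in W)) => hd; rewrite ?andbF //= (hWT _ hd) /= andbT -val_eqE /=; lia.
have l1 : (1 - cbin (uphalf #|[set z in W | (b < z)%N]|)) / 2 <= \sum_(d in W | (b < d)%N) prob1 T b d.
  rewrite -sphi -sum_gap_right; apply: rsum_le => d /andP[hd hbd].
  by rewrite insW //; apply: (prob1_ge hm) => //; apply: hWT.
have l2 : (1 - cbin (uphalf #|[set z in W | (z < b)%N]|)) / 2 <= \sum_(d in W | (d < b)%N) prob1 T b d.
  rewrite -sphi -sum_gap_left; apply: rsum_le => d /andP[hd hbd].
  by rewrite insW // prob1C; apply: (prob1_ge hm) => //; apply: hWT.
have {}htot : \sum_(i in T | (i != b) && (i \in W)) prob1 T b i +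
   \sum_(i in T | (i != b) && (i \notin W)) prob1 T b i = 1.
  by rewrite -htot; congr (_ + _); apply: eq_bigl => d; rewrite andbA.
rewrite e2 in htot; move: htot l1 l2.
set X1 := \sum_(d in W | (b < d)%N) _; set X2 := \sum_(d in W | (d < b)%N) _.
set X3 := \sum_(i in T | _) _; set a1 := cbin _; set a2 := cbin _; lra.
Qed.

End Upper.

Lemma sqrt_2PI_le1 : sqrt (2 / PI) <= 1.
Proof.
have P3 := PI_ge3; rewrite -sqrt_1; apply: sqrt_le_1_alt.
by apply (Rle_div_l _ _ PI); lra.
Qed.

(** * Upper bound for the mean number of crossings, uniform in the colouring *)

Section CrossUpper.
Variable n : nat.
Local Notation pt := 'I_(2 * n).
Local Notation arc := (pt * pt)%type.
Implicit Types (x y z b d : pt) (A B : arc) (S T W : {set pt}) (P : {set {set pt}}).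

(** Arcs are ordered pairs; either alternative forces the left endpoint first, so every arc is
    counted once. The two alternatives say which arc starts first, and [L] bounds the span of all
    four endpoints. *)
Definition crosses (L : nat) A B : bool :=
  [&& A.1 < B.1, B.1 < A.2, A.2 < B.2 & B.2 - A.1 <= L]%N ||
  [&& B.1 < A.1, A.1 < B.2, B.2 < A.2 & A.2 - B.1 <= L]%N.

Lemma crossesC L A B : crosses L A B = crosses L B A.
Proof. by rewrite /crosses orbC. Qed.

Definition arc_in P A : R := arc_ind P A.1 A.2.
Definition arc_prob S A : R := prob1 S A.1 A.2.

Definition ncross (L : nat) P P' : R := \sum_A \sum_(B | crosses L A B) arc_in P A * arc_in P' B.
Definition mcross (L : nat) S T : R := \sum_A \sum_(B | crosses L A B) arc_prob S A * arc_prob T B.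

Lemma avgM_ncross L S T :
  avgM S (fun P => avgM T (fun P' => ncross L P P')) = mcross L S T.
Proof.
rewrite /ncross /mcross.
under avgM_eq => P _ do rewrite avgM_sum.
rewrite avgM_sum; apply: eq_bigr => A _.
under avgM_eq => P _ do rewrite avgM_sum.
rewrite avgM_sum; apply: eq_bigr => B _.
under avgM_eq => P _ do rewrite avgMZ Rmult_comm.
by rewrite avgMZ Rmult_comm.
Qed.

(** An arc of [T] crosses [A] precisely when it joins a point below [A] to one outside, so this is
    an exit count for a window; the span condition is simply dropped. *)
Lemma cross_exit L T m A : #|T| = (2 * m)%N -> A.1 \notin T -> A.2 \notin T ->
  \sum_(B | crosses L A B) arc_prob T B <= 1 + 2 * sqrt (2 / PI) * sqrt (INR #|inside T A.1 A.2|).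
Proof.
move=> hm hx hy; case: A hx hy => x y /= hx hy.
set W := inside T x y.
have hW : W \subset T by apply/subsetP => z; rewrite inE => /andP[].
apply: Rle_trans (window_exit hm hW _); last first.
  by move=> b d z; rewrite !inE => /and3P[_ h1 h2] /and3P[_ h3 h4] h5 h6 ->; lia.
rewrite pair_big_dep /=.
pose V B := ((x < B.1)%N && (B.1 < y)%N).
rewrite (bigID V) /= [X in _ <= X](bigID (fun B : arc => (y < B.2)%N)) /=.
have zero B : ~~ ((B.1 \in T) && (B.2 \in T)) -> arc_prob T B = 0 by exact: prob1_out.
apply: Rplus_le_compat.
  rewrite (bigID (fun B : arc => (B.1 \in T) && (B.2 \in T))) /= [X in _ + X]big1 ?Rplus_0_r; last first.
    by move=> B /andP[_ /zero].
  apply: rsum_sub => [B|B _]; last exact: prob1_ge0.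
  rewrite !inE /crosses /V /=; case: (B.1 \in T) => //=; rewrite ?andbF //.
  by case: (B.2 \in T) => //=; rewrite ?andbF //; lia.
(* Arcs leaving on the left have their right endpoint in the window; reversing them fits the sum
   over pairs that start in [W]. *)
rewrite [X in _ <= X](reindex (fun B : arc => (B.2, B.1))) /=; last first.
  by exists (fun B : arc => (B.2, B.1)) => -[u v].
rewrite (bigID (fun B : arc => (B.1 \in T) && (B.2 \in T))) /= [X in _ + X]big1 ?Rplus_0_r; last first.
  by move=> B /andP[_ /zero].
apply: (@Rle_trans _ (\sum_(i : arc | (i.2 \in W) && (i.1 \in T :\: W) && ~~ (y < i.1)%N) arc_prob T i)).
  apply: rsum_sub => [B|B _]; last exact: prob1_ge0.
  rewrite !inE /crosses /V /=; case: (B.1 \in T) => //=; rewrite ?andbF //.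
  by case: (B.2 \in T) => //=; rewrite ?andbF //; lia.
by apply: Req_le; apply: eq_bigr => B _; rewrite prob1C.
Qed.

(** Equality holds at [t = r]. Typically about as many points of either colour lie below an arc, so
    nothing is lost to leading order, and the bound is linear in [t], so that double counting
    applies for every colouring. *)
Lemma sqrt_split t r : 0 <= t -> 0 < r -> sqrt t <= (t / sqrt r + sqrt r) / 2.
Proof.
move=> ht hr; have h1 := sqrt_lt_R0 r hr; have h2 := sqrt_pos t.
have e1 := sqrt_sqrt t ht.
apply: (Rmult_le_reg_r (2 * sqrt r)); first lra.
have -> : (t / sqrt r + sqrt r) / 2 * (2 * sqrt r) = t + sqrt r * sqrt r by field; lra.
have := Rle_0_sqr (sqrt t - sqrt r); rewrite /Rsqr; nra.
Qed.

(** Majorant for arcs covering at most about half of the points of their colour; longer arcs get 0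
    here and are measured by the points outside them. *)
Definition phi1 (k g : nat) : R :=
  if odd g then 0 else
  if (2 * g./2.+1 <= k.+1)%N then psi g./2 / 4 * (1 + 6 * (INR g./2 + 1) / (INR k + 1)) else 0.

Lemma phi1_ge0 k g : 0 <= phi1 k g.
Proof.
rewrite /phi1; case: ifP => _; first lra; case: ifP => _; last lra.
have h := psi_gt0 g./2; have hk := pos_INR k; have hg := pos_INR g./2.
have : 0 <= 6 * (INR g./2 + 1) / (INR k + 1) by apply/Rlt_le/Rdiv_lt_0_compat; lra.
nra.
Qed.

(** The probability is symmetric in the numbers of points inside and outside the arc, so a long arc
    is treated as a short one seen from outside. *)
Lemma prob1_le_phi S k x y : #|S| = (2 * k)%N -> (x < y)%N -> x \in S -> y \in S ->
  prob1 S x y <= phi1 k #|inside S x y| + 3 * wgap #|outside S x y|.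
Proof.
move=> hk hxy hx hy; have hc := card_in_out hxy hx hy.
rewrite (prob1E hk) // /phi1; have hw := wgap_gt0 #|outside S x y|.
case: (boolP (odd _)) => ho; first lra.
case: ifP => hs; first by have := qk_le_main hs; lra.
rewrite Rplus_0_l; apply: Rle_trans (psi_half_le _); last lia.
rewrite -qk_sym; last lia.
rewrite (_ : (k - _.+1)%N = #|outside S x y|./2); last lia.
by apply: qk_le_psi; lia.
Qed.

(** Only even gaps [g = 2 l] contribute, each about a multiple of [1 / (l + 1)]. The 9 collects 1
    from the harmonic sum, 2 from the inverse squares and 6 from the correction, at most
    [12 / (k + 1)] for each of at most [(k + 1) / 2] indices. *)
Lemma sum_phi1_sqrt k N : (0 < n)%N -> (k <= n)%N ->
  \sum_(g < N) phi1 k g * sqrt (INR g + 1) <= sqrt (2 / PI) / 4 * (ln (INR n) + 9).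
Proof.
move=> hn hkn; set c := sqrt (2 / PI).
have c0 : 0 <= c by exact: sqrt_pos.
pose F l := if (2 * l.+1 <= k.+1)%N then
  c / 4 * ((1 / (INR l + 1) + 1 / (INR l + 1) ^ 2) * (1 + 6 * (INR l + 1) / (INR k + 1))) else 0.
have hk0 := pos_INR k.
have F0 l : 0 <= F l.
  rewrite /F; case: ifP => _; last lra; have hl := pos_INR l.
  have h1 : 0 <= 1 / (INR l + 1) by apply/Rlt_le/Rdiv_lt_0_compat; lra.
  have h2 : 0 <= 1 / (INR l + 1) ^ 2 by apply/Rlt_le/Rdiv_lt_0_compat; nra.
  have h3 : 0 <= 6 * (INR l + 1) / (INR k + 1) by apply/Rlt_le/Rdiv_lt_0_compat; lra.
  by apply: Rmult_le_pos; [lra | apply: Rmult_le_pos; lra].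
apply: (@Rle_trans _ (\sum_(g < N) if odd g then 0 else F g./2)).
  apply: rsum_le => g _; rewrite /phi1 /F; case: (boolP (odd g)) => ho; first by rewrite Rmult_0_l; lra.
  case: ifP => hs; last by rewrite Rmult_0_l; lra.
  have h := psi_sqrt_le g./2; rewrite -/c in h.
  have -> : INR g = 2 * INR g./2 by rewrite -[2]/(INR 2) -INR_muln; congr INR; lia.
  have h3 : 0 <= 6 * (INR g./2 + 1) / (INR k + 1).
    by apply/Rlt_le/Rdiv_lt_0_compat; have := pos_INR g./2; lra.
  move: (6 * _ / _) h3 h => q h3 h.
  have := Rmult_le_compat_r (1 + q) _ _ ltac:(lra) h; lra.
rewrite sum_even.
apply: (@Rle_trans _ (\sum_(l < n + N) F l)); first by apply: rsum_ord_widen => //; lia.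
rewrite big_split_ord /= [X in _ + X]big1 ?Rplus_0_r; last first.
  by move=> j _; rewrite /F ifF //; lia.
apply: (@Rle_trans _ (\sum_(l < n) (c / 4 * (1 / (INR l + 1)) + c / 4 * (1 / (INR (0 + l) + 1) ^ 2) +
    c / 4 * (if (2 * l.+1 <= k.+1)%N then 12 / (INR k + 1) else 0)))).
  apply: rsum_le => l _; rewrite /F add0n; have hl := pos_INR l.
  have h1 : 0 < 1 / (INR l + 1) by apply: Rdiv_lt_0_compat; lra.
  have h2 : 0 < 1 / (INR l + 1) ^ 2 by apply: Rdiv_lt_0_compat; nra.
  case: ifP => _; last by nra.
  rewrite -!Rmult_plus_distr_l; apply: Rmult_le_compat_l; first lra.
  rewrite [X in X <= _](_ : _ = 1 / (INR l + 1) + 1 / (INR l + 1) ^ 2 +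
    6 * (1 + 1 / (INR l + 1)) / (INR k + 1)); last by field; lra.
  apply: Rplus_le_compat; first by apply: Req_le; field; lra.
  apply: Rmult_le_compat_r; first by apply/Rlt_le/Rinv_0_lt_compat; lra.
  have : 1 / (INR l + 1) <= 1 by apply (Rle_div_l _ _ (INR l + 1)); lra.
  lra.
rewrite !big_split -!(big_distrr (c / 4)) /=.
have H1 := harmonic_le hn.
have H2 := sum_inv_sqr 0 n; rewrite [INR 0]/= in H2.
have H3 : \sum_(l < n) (if (2 * l.+1 <= k.+1)%N then 12 / (INR k + 1) else 0) <= 6.
  rewrite -big_mkcond /=.
  rewrite -(big_mkord (fun l => (2 * l.+1 <= k.+1)%N) (fun _ => 12 / (INR k + 1))).
  have hK : (k.+1./2 <= n)%N by lia.
  rewrite (big_cat_nat (n := k.+1./2) (p := n)) //=.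
  rewrite [X in _ + X]big_nat_cond [X in _ + X]big_pred0 ?Rplus_0_r; last by move=> i; lia.
  have p0 : 0 <= 12 / (INR k + 1) by apply/Rlt_le/Rdiv_lt_0_compat; lra.
  apply: (@Rle_trans _ (\sum_(l < k.+1./2) (12 / (INR k + 1)))).
    by rewrite big_mkord; apply: rsum_sub.
  rewrite rsum_const card_ord.
  have hK2 : 2 * INR (k.+1./2) <= INR k + 1.
    by rewrite -S_INR -[2]/(INR 2) -INR_muln; apply: INR_leq; lia.
  rewrite (_ : INR k.+1./2 * (12 / (INR k + 1)) = (12 * INR k.+1./2) / (INR k + 1)); last by field; lra.
  by apply (Rle_div_l _ _ (INR k + 1)); lra.
rewrite -!Rmult_plus_distr_l; apply: Rmult_le_compat_l; first lra.
apply: (@Rle_trans _ ((1 + ln (INR n)) + 2 / (0 + 1) + 6)); last by rewrite Rplus_0_l; lra.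
exact: (Rplus_le_compat _ _ _ _ (Rplus_le_compat _ _ _ _ H1 H2) H3).
Qed.

Lemma outsideE S x y : (x < y)%N ->
  #|outside S x y| = (#|[set z in S | (z < x)%N]| + #|[set z in S | (y < z)%N]|)%N.
Proof.
move=> hxy; rewrite -cardsUI; set X := _ :&: _.
have -> : X = set0 by apply/setP => z; rewrite !inE; lia.
by rewrite cards0 addn0; apply: eq_card => z; rewrite !inE andb_orr.
Qed.

(** After [sqrt_split] the two main sums are at most [#|T| * C1] and [#|S| * C1], with equal
    weights, so only the total [2 n] matters and [c * c = 2 / PI] gives the leading term. The linear
    term collects 2 from the summand 1 in [cross_exit], at most 3 from [9 / PI], and 144 from long
    arcs. *)
Lemma mcross_le L S T k m : (0 < n)%N -> [disjoint S & T] ->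
  #|S| = (2 * k)%N -> #|T| = (2 * m)%N -> (k + m = n)%N ->
  mcross L S T <= / PI * INR n * ln (INR n) + 149 * INR n.
Proof.
move=> hn hST hk hm hkm; set c := sqrt (2 / PI).
have c0 : 0 <= c by exact: sqrt_pos.
have c1 : c <= 1 by exact: sqrt_2PI_le1.
have P0 := PI_RGT_0; have P3 := PI_ge3.
have cc : c * c = 2 / PI by apply: sqrt_sqrt; apply/Rlt_le/Rdiv_lt_0_compat; lra.
have n0 := INR_gt0 hn.
have lnn : 0 <= ln (INR n).
  by rewrite -ln_1; apply: ln_le; [lra | apply: (@INR_leq 1)].
have nT z : z \in S -> z \notin T.
  by move=> hz; move: hST; rewrite disjoint_subset => /subsetP /(_ _ hz); rewrite inE.
have hsq g : 0 < sqrt (INR g + 1) by apply: sqrt_lt_R0; have := pos_INR g; lra.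
set t := fun x y => INR #|inside T x y|.
have t0 x y : 0 <= t x y by exact: pos_INR.
have step1 : mcross L S T <=
    \sum_(x in S) \sum_(y in S | (x < y)%N) prob1 S x y * (1 + 2 * c * sqrt (t x y)).
  rewrite /mcross [X in _ <= X]pair_big_dep /=.
  rewrite (bigID (fun A : arc => (A.1 \in S) && ((A.2 \in S) && (A.1 < A.2)%N))) /=.
  rewrite [X in _ + X]big1 ?Rplus_0_r; last first.
    move=> A hA; rewrite -big_distrr /=.
    case: (boolP ((A.1 \in S) && (A.2 \in S))) => h; last by rewrite /arc_prob prob1_out // Rmult_0_l.
    rewrite big_pred0 ?Rmult_0_r // => B.
    have hlt : ~~ (A.1 < A.2)%N by move: hA; case/andP: h => -> ->.
    by rewrite /crosses; lia.
  apply: rsum_le => A /and3P[h1 h2 h3]; rewrite -big_distrr /=.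
  apply: Rmult_le_compat_l; first exact: prob1_ge0.
  by apply: (cross_exit _ hm); exact: nT.
apply: Rle_trans step1 _.
pose G x y := prob1 S x y + 2 * c * (phi1 k #|inside S x y| / sqrt (INR #|inside S x y| + 1) * t x y / 2 +
   phi1 k #|inside S x y| * sqrt (INR #|inside S x y| + 1) / 2 +
   3 * sqrt (2 * INR n) * wgap #|outside S x y|).
have step2 : \sum_(x in S) \sum_(y in S | (x < y)%N) prob1 S x y * (1 + 2 * c * sqrt (t x y)) <=
    \sum_(x in S) \sum_(y in S | (x < y)%N) G x y.
  apply: rsum_le => x hx; apply: rsum_le => y /andP[hy hxy].
  rewrite /G Rmult_plus_distr_l Rmult_1_r; apply: Rplus_le_compat_l.
  rewrite (_ : prob1 S x y * (2 * c * sqrt (t x y)) = 2 * c * (prob1 S x y * sqrt (t x y))); last ring.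
  apply: Rmult_le_compat_l; first lra.
  have hg : 0 < INR #|inside S x y| + 1 by have := pos_INR #|inside S x y|; lra.
  have hs := sqrt_split (t0 x y) hg.
  have hs2 : sqrt (t x y) <= sqrt (2 * INR n).
    by apply: sqrt_le_1_alt; rewrite -[2]/(INR 2) -INR_muln; apply: INR_leq; exact: card_le2n.
  have hp := prob1_le_phi hk hxy hx hy; have f0 := phi1_ge0 k #|inside S x y|.
  have w0 := wgap_gt0 #|outside S x y|; have st0 := sqrt_pos (t x y).
  apply: Rle_trans (Rmult_le_compat_r _ _ _ st0 hp) _.
  rewrite Rmult_plus_distr_r; apply: Rplus_le_compat.
    apply: Rle_trans (Rmult_le_compat_l _ _ _ f0 hs) _; apply: Req_le; field.
    by have := sqrt_lt_R0 _ hg; lra.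
  rewrite -[X in _ <= X](Rmult_comm (wgap _)).
  have := Rmult_le_compat_l (3 * wgap #|outside S x y|) _ _ ltac:(lra) hs2; lra.
apply: Rle_trans step2 _; rewrite /G.
set b1 := \sum_(x in S) \sum_(y in S | (x < y)%N) prob1 S x y.
set b2 := \sum_(x in S) \sum_(y in S | (x < y)%N)
   (phi1 k #|inside S x y| / sqrt (INR #|inside S x y| + 1)) * t x y.
set b3 := \sum_(x in S) \sum_(y in S | (x < y)%N)
   phi1 k #|inside S x y| * sqrt (INR #|inside S x y| + 1).
set b4 := \sum_(x in S) \sum_(y in S | (x < y)%N) wgap #|outside S x y|.
have -> : \sum_(x in S) \sum_(y in S | (x < y)%N) (prob1 S x y +
     2 * c *
     (phi1 k #|inside S x y| / sqrt (INR #|inside S x y| + 1) * t x y / 2 +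
      phi1 k #|inside S x y| * sqrt (INR #|inside S x y| + 1) / 2 +
      3 * sqrt (2 * INR n) * wgap #|outside S x y|)) =
   b1 + 2 * c * (b2 / 2 + b3 / 2 + 3 * sqrt (2 * INR n) * b4).
  rewrite (_ : 2 * c * (b2 / 2 + b3 / 2 + 3 * sqrt (2 * INR n) * b4) =
     c * b2 + (c * b3 + (6 * c * sqrt (2 * INR n)) * b4)); last by field.
  rewrite /b1 /b2 /b3 /b4 !big_distrr -!big_split /=; apply: eq_bigr => x _.
  rewrite !big_distrr -!big_split /=; apply: eq_bigr => y _; field.
  exact/Rgt_not_eq/hsq.
have eS : INR #|S| + INR #|T| = 2 * INR n.
  by rewrite -INR_addn hk hm -[2]/(INR 2) -INR_muln; congr INR; lia.
have S0 := pos_INR #|S|; have T0 := pos_INR #|T|.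
set C1 := c / 4 * (ln (INR n) + 9).
have hb1 : b1 <= INR #|S|.
  rewrite -[INR #|S|]Rmult_1_r -rsum_const; apply: rsum_le => x hx.
  rewrite -(prob1_total hk hx); apply: rsum_sub => [y /andP[-> h]|y _]; last exact: prob1_ge0.
  by rewrite -val_eqE /=; lia.
have hphi N : \sum_(g < N) phi1 k g * sqrt (INR g + 1) <= C1 by apply: sum_phi1_sqrt => //; lia.
have hb3 : b3 <= INR #|S| * C1.
  rewrite -rsum_const; apply: rsum_le => x hx.
  apply: Rle_trans (hphi (2 * n)%N).
  apply: (@sum_gap_right_le _ S x _ (fun g => phi1 k g * sqrt (INR g + 1))); last exact: card_le2n.
  by move=> i; apply: Rmult_le_pos; [exact: phi1_ge0 | exact: Rlt_le].
have hb2 : b2 <= INR #|T| * C1.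
  have F0 g : 0 <= phi1 k g / sqrt (INR g + 1).
    by apply: Rmult_le_pos; [exact: phi1_ge0 | apply/Rlt_le/Rinv_0_lt_compat].
  apply: Rle_trans (sum_window (N := 2 * n) hST F0 _ _) _; try by move=> b; exact: card_le2n.
  apply: Rmult_le_compat_l => //.
  apply: Rle_trans (sum_diag _ F0) _; apply: Rle_trans (hphi _).
  apply: rsum_le => g _; apply: Req_le.
  have e := sqrt_sqrt (INR g + 1) ltac:(have := pos_INR g; lra).
  rewrite -{1}e; field; have := hsq g; lra.
have hb4 : b4 <= 12 * sqrt (2 * INR n).
  have -> : 2 * INR n = INR (2 * n) by rewrite INR_muln.
  apply: Rle_trans (sum2_wgap _ (2 * n)).
  apply: (@Rle_trans _ (\sum_(x in S) \sum_(j < 2 * n) wgap (#|[set z in S | (z < x)%N]| + j))).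
    apply: rsum_le => x hx.
    apply: (@Rle_trans _ (\sum_(y in S) wgap (#|[set z in S | (z < x)%N]| + #|[set z in S | (y < z)%N]|))).
      rewrite (eq_bigr (fun y => wgap (#|[set z in S | (z < x)%N]| + #|[set z in S | (y < z)%N]|))); last first.
        by move=> y /andP[_ hxy]; rewrite outsideE.
      by apply: rsum_sub => [y /andP[]|y _] //; exact/Rlt_le/wgap_gt0.
    rewrite (sum_rank_right S (fun j => wgap (#|[set z in S | (z < x)%N]| + j))).
    apply: (@rsum_ord_widen (fun j => wgap (#|[set z in S | (z < x)%N]| + j))); first exact: card_le2n.
    by move=> i; exact/Rlt_le/wgap_gt0.
  rewrite (sum_rank_left S (fun i => \sum_(j < 2 * n) wgap (i + j))).
  apply: (@rsum_ord_widen (fun i => \sum_(j < 2 * n) wgap (i + j))); first exact: card_le2n.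
  by move=> i; apply: rsum_ge0 => j _; exact/Rlt_le/wgap_gt0.
move: b1 b2 b3 b4 hb1 hb2 hb3 hb4 => b1 b2 b3 b4 hb1 hb2 hb3 hb4.
have q0 := sqrt_pos (2 * INR n); have qq := sqrt_sqrt (2 * INR n) ltac:(lra).
have hb4' : 3 * sqrt (2 * INR n) * b4 <= 72 * INR n by nra.
have h23 : b2 / 2 + b3 / 2 <= INR n * C1.
  have -> : INR n = (INR #|S| + INR #|T|) / 2 by rewrite eS; field.
  lra.
have h5 := Rmult_le_compat_l (2 * c) _ _ ltac:(lra) (Rplus_le_compat _ _ _ _ h23 hb4').
have e5 : 2 * c * (INR n * C1) = / PI * INR n * ln (INR n) + 9 / PI * INR n.
  rewrite /C1 (_ : 2 * c * (INR n * (c / 4 * (ln (INR n) + 9))) = (c * c) / 2 * INR n * (ln (INR n) + 9)); last by field.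
  by rewrite cc; field; lra.
have h9 : 9 / PI <= 3 by apply (Rle_div_l _ _ PI); lra.
have h10 : 9 / PI * INR n <= 3 * INR n by apply: Rmult_le_compat_r; lra.
have h11 : 2 * c * (72 * INR n) <= 144 * INR n by nra.
have h12 : b1 <= 2 * INR n by lra.
lra.
Qed.

End CrossUpper.

(** * Second moments *)

Section SecondMoment.
Variable n : nat.
Local Notation pt := 'I_(2 * n).
Local Notation arc := (pt * pt)%type.
Implicit Types (x y z b d : pt) (A B : arc) (S T U V : {set pt}) (P : {set {set pt}}).

Definition side_by_side A A' : bool := (A.2 < A'.1)%N || (A'.2 < A.1)%N.
Definition nested A A' : bool := (A.1 < A'.1)%N && (A'.2 < A.2)%N.
Definition arc_prob2 S A A' : R := prob2 S A.1 A.2 A'.1 A'.2.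

Lemma arc_prob2_ge0 S A A' : 0 <= arc_prob2 S A A'.
Proof. by apply: avgM_ge0 => P _; apply: Rmult_le_pos; exact: arc_ind_ge0. Qed.

Lemma arc_prob2C S A A' : arc_prob2 S A A' = arc_prob2 S A' A.
Proof. by apply: avgM_eq => P _; rewrite Rmult_comm. Qed.

Lemma arc_ind_sqr P x y : arc_ind P x y * arc_ind P x y = arc_ind P x y.
Proof. by rewrite /arc_ind; case: ifP => _; ring. Qed.

Lemma arc_prob2_diag S A : arc_prob2 S A A = arc_prob S A.
Proof. by apply: avgM_eq => P _; exact: arc_ind_sqr. Qed.

(** Two distinct arcs of one noncrossing matching are nested or side by side. *)
Lemma arc_prob2_zero S A A' : (A.1 < A.2)%N -> (A'.1 < A'.2)%N -> ~~ side_by_side A A' -> A != A' ->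
  ~~ nested A A' -> ~~ nested A' A -> arc_prob2 S A A' = 0.
Proof.
case: A A' => [x y] [x' y'] /= h1 h2; rewrite /side_by_side /nested /= => h3 h4 h5 h6.
rewrite -(avgM0 S); apply: avgM_eq => P; rewrite inE => /catalan_matchingP[_ _ hd hc] /=.
rewrite /arc_ind; case: ifP => hA; last by rewrite Rmult_0_l.
case: ifP => hA'; last by rewrite Rmult_0_r.
exfalso; case: (eqVneq [set x; y] [set x'; y']) => [/arc_inj [] // e1 e2|ne].
  by move: h4; rewrite e1 e2 eqxx.
have dj z : z \in [set x; y] -> z \in [set x'; y'] -> False.
  by move=> hz hz'; move/eqP: ne; apply; exact: hd hz hz'.
have n1 : x != x' by apply/eqP => e; apply: (dj x); rewrite mem_arc ?e eqxx.
have n2 : x != y' by apply/eqP => e; apply: (dj x); rewrite mem_arc ?e eqxx ?orbT.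
have n3 : y != x' by apply/eqP => e; apply: (dj y); rewrite mem_arc ?e eqxx ?orbT.
have n4 : y != y' by apply/eqP => e; apply: (dj y); rewrite mem_arc ?e eqxx ?orbT.
move: n1 n2 n3 n4; rewrite -!val_eqE /= => n1 n2 n3 n4.
have c1 : ~ ((x < x')%N /\ (x' < y)%N /\ (y < y')%N) by move=> [q1 [q2 q3]]; apply: (hc x x' y y').
have c2 : ~ ((x' < x)%N /\ (x < y')%N /\ (y' < y)%N) by move=> [q1 [q2 q3]]; apply: (hc x' x y' y).
by clear hd hc dj hA hA' ne h4; lia.
Qed.

Lemma card_inside_lt S x y : (x < y)%N -> (#|inside S x y| < y - x)%N.
Proof.
move=> hxy; apply: (@leq_ltn_trans (y - x).-1); last lia.
by apply: (@card_interval _ _ x.+1) => z; rewrite inE; lia.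
Qed.

Lemma card_disjoint_le (Q1 Q2 Q : {set pt}) : Q1 \subset Q -> Q2 \subset Q ->
  (forall z, z \in Q1 -> z \in Q2 -> False) -> (#|Q1| + #|Q2| <= #|Q|)%N.
Proof.
move=> h1 h2 h; rewrite -cardsUI (_ : Q1 :&: Q2 = set0) ?cards0 ?addn0.
  by apply: subset_leq_card; rewrite subUset h1.
by apply/setP => z; rewrite !inE; apply/negP => /andP[]; exact: h.
Qed.

(** The points of [U] between [x] and [x'] and those of [V] between [y'] and [y] lie under the outer
    arc and not under the inner one. Hence the middle gap is at least a sum of two ranks, and
    summing over outer arcs gives the double sum of [wgap]. *)
Lemma nested_sum S k U V x' y' : #|S| = (2 * k)%N -> U \subset S -> V \subset S -> (x' < y')%N ->
  (forall u v, u \in U -> v \in V -> (u < v)%N -> (#|inside S u v| < k)%N) ->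
  \sum_(x in U | (x < x')%N) \sum_(y in V | (y' < y)%N) prob2 S x y x' y' <=
  9 / 4 * wgap #|inside S x' y'| * \sum_(i < #|U|) \sum_(j < #|V|) wgap (i + j).
Proof.
move=> hk /subsetP hU /subsetP hV hxy hs.
have w0 := wgap_gt0 #|inside S x' y'|.
apply: (@Rle_trans _ (\sum_(x in U | (x < x')%N) \sum_(y in V | (y' < y)%N)
   9 / 4 * wgap #|inside S x' y'| * wgap (#|inside U x x'| + #|inside V y' y|))).
  apply: rsum_le => x /andP[hx hxx]; apply: rsum_le => y /andP[hy hyy].
  apply: Rle_trans (prob2_nested hk hxx hxy hyy _) _; first by apply: hs => //; lia.
  apply: Rmult_le_compat_l; first lra.
  apply: wgap_anti; apply: card_disjoint_le.
  - by apply/subsetP => z; rewrite !inE => /and3P[/hU -> h1 h2]; lia.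
  - by apply/subsetP => z; rewrite !inE => /and3P[/hV -> h1 h2]; lia.
  - by move=> z; rewrite !inE; lia.
under eq_bigr do rewrite -big_distrr.
rewrite -big_distrr /=.
apply: Rmult_le_compat_l; first by apply: Rmult_le_pos; [lra | exact/Rlt_le/wgap_gt0].
have wg g : 0 <= wgap g by exact/Rlt_le/wgap_gt0.
apply: (@Rle_trans _ (\sum_(x in U | (x < x')%N) \sum_(j < #|V|) wgap (#|inside U x x'| + j))).
  apply: rsum_le => x _; apply: (@sum_gap_right_le _ V y' #|V| (fun j => wgap (#|inside U x x'| + j))) => //.
  by apply: subset_leq_card; apply/subsetP => z; rewrite inE => /andP[].
apply: (@sum_gap_left_le _ U x' #|U| (fun i => \sum_(j < #|V|) wgap (i + j))).
  by move=> i; exact: rsum_ge0.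
by apply: subset_leq_card; apply/subsetP => z; rewrite inE => /andP[].
Qed.

(* The arcs from [U] to [V] are pairwise nested, so only the nested two-point function enters. *)
Lemma exit_sqr T m U V s : #|T| = (2 * m)%N -> U \subset T -> V \subset T ->
  (forall u v, u \in U -> v \in V -> (u < v)%N /\ (#|inside T u v| < m)%N) ->
  \sum_(i < #|U|) \sum_(j < #|V|) wgap (i + j) <= 12 * sqrt (INR s) ->
  avgM T (fun P => (\sum_(b in U) \sum_(d in V) arc_ind P b d) ^ 2) <= 684 * INR s.
Proof.
move=> hm hU hV hUV hsum.
set sg := \sum_(i < #|U|) _ in hsum.
have wg g : 0 <= wgap g by exact/Rlt_le/wgap_gt0.
have sg0 : 0 <= sg by apply: rsum_ge0 => i _; exact: rsum_ge0.
pose Q := [pred B : arc | (B.1 \in U) && (B.2 \in V)].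
have pairs (F : pt -> pt -> R) : \sum_(b in U) \sum_(d in V) F b d = \sum_(B in Q) F B.1 B.2.
  by rewrite pair_big_dep.
have E2 : avgM T (fun P => (\sum_(b in U) \sum_(d in V) arc_ind P b d) ^ 2) =
   \sum_(B in Q) \sum_(B' in Q) arc_prob2 T B B'.
  under avgM_eq => P _ do rewrite pairs -Rsqr_pow2 /Rsqr big_distrl.
  rewrite avgM_sum; apply: eq_bigr => B _.
  under avgM_eq => P _ do rewrite big_distrr.
  by rewrite avgM_sum; apply: eq_bigr.
rewrite E2.
have hgap b d : b \in U -> d \in V -> wgap #|inside T b d| <=
    wgap (#|[set z in U | (b < z)%N]| + #|[set z in V | (z < d)%N]|).
  move=> hb hd; apply: wgap_anti; apply: card_disjoint_le.
  - by apply/subsetP => z; rewrite !inE => /andP[hz ->]; rewrite (subsetP hU _ hz) (proj1 (hUV _ _ hz hd)).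
  - by apply/subsetP => z; rewrite !inE => /andP[hz ->]; rewrite (subsetP hV _ hz) (proj1 (hUV _ _ hb hz)).
  - by move=> z; rewrite !inE => /andP[hz _] /andP[hz' _]; have [] := hUV z z hz hz'; rewrite ltnn.
have S1 : \sum_(b in U) \sum_(d in V) wgap #|inside T b d| <= sg.
  apply: (@Rle_trans _ (\sum_(b in U) \sum_(d in V) wgap (#|[set z in U | (b < z)%N]| + #|[set z in V | (z < d)%N]|))).
    by apply: rsum_le => b hb; apply: rsum_le => d hd; exact: hgap.
  rewrite (eq_bigr (fun b => \sum_(j < #|V|) wgap (#|[set z in U | (b < z)%N]| + j))).
    by rewrite (sum_rank_right U (fun i => \sum_(j < #|V|) wgap (i + j))); exact: Rle_refl.
  by move=> b _; rewrite (sum_rank_left V (fun j => wgap (#|[set z in U | (b < z)%N]| + j))).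
have D1 : \sum_(B in Q) arc_prob T B <= 3 * sg.
  rewrite /arc_prob -(pairs (fun b d => prob1 T b d)).
  apply: (@Rle_trans _ (\sum_(b in U) \sum_(d in V) 3 * wgap #|inside T b d|)).
    apply: rsum_le => b hb; apply: rsum_le => d hd; have [h1 h2] := hUV b d hb hd.
    exact: prob1_short h2.
  under eq_bigr do rewrite -big_distrr.
  by rewrite -big_distrr /=; apply: Rmult_le_compat_l; [lra | exact: S1].
have D2 : \sum_(B' in Q) \sum_(B in Q | nested B B') arc_prob2 T B B' <= 9 / 4 * sg * sg.
  apply: (@Rle_trans _ (\sum_(B' in Q) 9 / 4 * wgap #|inside T B'.1 B'.2| * sg)).
    apply: rsum_le => -[b' d'] /andP[/= hb' hd'].
    have [h1 h2] := hUV b' d' hb' hd'.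
    apply: Rle_trans (nested_sum hm hU hV h1 _); last by move=> u v hu hv _; have [] := hUV u v hu hv.
    rewrite pair_big_dep /=; apply: Req_le; apply: eq_bigl => -[b d]; rewrite !inE /nested /=.
    by case: (b \in U); case: (d \in V); rewrite ?andbF.
  rewrite -big_distrl /= -big_distrr /= -(pairs (fun b d => wgap #|inside T b d|)).
  by apply: Rmult_le_compat_r => //; apply: Rmult_le_compat_l; [lra | exact: S1].
have D3 : \sum_(B in Q) \sum_(B' in Q) arc_prob2 T B B' <=
  \sum_(B in Q) arc_prob T B + (\sum_(B in Q) \sum_(B' in Q | nested B B') arc_prob2 T B B' +
    \sum_(B in Q) \sum_(B' in Q | nested B' B) arc_prob2 T B B').
  rewrite -!big_split /=; apply: rsum_le => B hB.
  have qB : (B.1 < B.2)%N by case/andP: hB => h1 h2; have [] := hUV _ _ h1 h2.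
  rewrite (bigD1 B) //= arc_prob2_diag; apply: Rplus_le_compat_l.
  rewrite [X in X <= _](bigID (fun B' => nested B B')) /=; apply: Rplus_le_compat.
    by apply: rsum_sub => [B' /andP[/andP[-> _] ->]|B' _] //; exact: arc_prob2_ge0.
  rewrite (bigID (fun B' => nested B' B)) /= [X in _ + X]big1 ?Rplus_0_r.
    by apply: rsum_sub => [B' /andP[/andP[/andP[-> _] _] ->]|B' _] //; exact: arc_prob2_ge0.
  move=> B' /andP[/andP[/andP[hB' hne] h1] h2].
  have qB' : (B'.1 < B'.2)%N by case/andP: hB' => q1 q2; have [] := hUV _ _ q1 q2.
  apply: arc_prob2_zero => //; last by rewrite eq_sym.
  case/andP: hB => r1 r2; case/andP: hB' => r3 r4.
  by have [q1 _] := hUV _ _ r1 r4; have [q2 _] := hUV _ _ r3 r2; rewrite /side_by_side; lia.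
have D4 : \sum_(B in Q) \sum_(B' in Q | nested B B') arc_prob2 T B B' <= 9 / 4 * sg * sg.
  rewrite (exchange_big_dep (mem Q)) /=; last by move=> i j _ /andP[].
  apply: Rle_trans D2; apply: Req_le; apply: eq_bigr => B' hB'; apply: eq_bigl => B.
  by rewrite hB'.
have D5 : \sum_(B in Q) \sum_(B' in Q | nested B' B) arc_prob2 T B B' <= 9 / 4 * sg * sg.
  apply: Rle_trans D2; apply: Req_le; apply: eq_bigr => B' hB'; apply: eq_bigr => B _.
  by rewrite arc_prob2C.
(* 684 = 3 * 12 + 2 * (9 / 4) * 12 ^ 2: the diagonal, and the two orders of nesting. *)
apply: Rle_trans D3 _; apply: Rle_trans (Rplus_le_compat _ _ _ _ D1 (Rplus_le_compat _ _ _ _ D4 D5)) _.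
have s0 := sqrt_pos (INR s); have ss := sqrt_sqrt (INR s) (pos_INR s).
have sle : sqrt (INR s) <= INR s.
  case: (s) ss => [|s'] ss; first by rewrite /= sqrt_0; lra.
  have : 1 <= INR s'.+1 by apply: (@INR_leq 1).
  move=> h; have := sqrt_ge1 h; nra.
clear -sg0 hsum s0 ss sle.
move: sg (sqrt (INR s)) (INR s) sg0 hsum s0 ss sle => sg r q sg0 hsum s0 ss sle.
have : sg * sg <= 144 * q by rewrite -ss; nra.
lra.
Qed.

End SecondMoment.

(** * Second moment of the number of short crossings for a fixed colouring *)

Section CrossVariance.
Variable n : nat.
Local Notation pt := 'I_(2 * n).
Local Notation arc := (pt * pt)%type.
Implicit Types (x y z b d : pt) (A B : arc) (S T U V : {set pt}) (P : {set {set pt}}).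

Definition ncross_arc (L : nat) P A : R := \sum_(B | crosses L A B) arc_in P B.
Definition cross_moment2 (L : nat) T A A' : R := \sum_(B | crosses L A B) \sum_(B' | crosses L A' B') arc_prob2 T B B'.

Lemma crosses_short L A B : crosses L A B ->
  [/\ (A.1 < A.2)%N, (A.2 - A.1 <= L)%N, (B.1 < B.2)%N & (B.2 - B.1 <= L)%N].
Proof. by rewrite /crosses => h; split; lia. Qed.

Lemma cross_moment2E L T A A' : cross_moment2 L T A A' = avgM T (fun P => ncross_arc L P A * ncross_arc L P A').
Proof.
rewrite /ncross_arc; under avgM_eq => P _ do rewrite big_distrl.
rewrite avgM_sum; apply: eq_bigr => B _.
under avgM_eq => P _ do rewrite big_distrr.
by rewrite avgM_sum.
Qed.

Lemma ncross_arc_ge0 L P A : 0 <= ncross_arc L P A.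
Proof. by apply: rsum_ge0 => B _; exact: arc_ind_ge0. Qed.

Lemma cross_moment2_ge0 L T A A' : 0 <= cross_moment2 L T A A'.
Proof. by apply: rsum_ge0 => B _; apply: rsum_ge0 => B' _; exact: arc_prob2_ge0. Qed.

(** The arcs crossing [A] leave the window below [A] to the right ([V1]) or to the left ([U2]), and
    [exit_sqr] treats each side; 2736 = 4 * 684 from (u + v)^2 <= 2 u^2 + 2 v^2. The cut at [L] in
    both sets makes the exits short enough for that estimate. *)
Lemma cross_moment2_diag_le L T m A : #|T| = (2 * m)%N -> (L <= m)%N -> A.1 \notin T -> A.2 \notin T ->
  cross_moment2 L T A A <= 2736 * INR #|inside T A.1 A.2|.
Proof.
case: A => x y /= hm hL hx hy; set W := inside T x y.
have W0 := pos_INR #|W|.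
case: (ltnP x y) => hxy; last first.
  rewrite /cross_moment2 big_pred0; first by apply: Rmult_le_pos; [lra | exact: pos_INR].
  by move=> B; rewrite /crosses /=; lia.
pose V1 := [set z in T | (y < z)%N && (z - x <= L)%N].
pose U2 := [set z in T | (z < x)%N && (y - z <= L)%N].
have sub (Q : pred pt) : [set z in T | Q z] \subset T by apply/subsetP => z; rewrite inE => /andP[].
have short (u v : pt) : (u < v)%N -> (v - u <= L)%N -> (#|inside T u v| < m)%N.
  by move=> h1 h2; have := card_inside_lt T h1; lia.
have E1 : avgM T (fun P => (\sum_(b in W) \sum_(d in V1) arc_ind P b d) ^ 2) <= 684 * INR #|W|.
  apply: (exit_sqr hm (sub _) (sub _)); last exact: sum2_wgap.
  move=> u v; rewrite !inE => /and3P[_ h1 h2] /and3P[_ h3 h4].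
  have h : (u < v)%N by lia.
  by split=> //; apply: short => //; lia.
have E2 : avgM T (fun P => (\sum_(b in U2) \sum_(d in W) arc_ind P b d) ^ 2) <= 684 * INR #|W|.
  apply: (exit_sqr hm (sub _) (sub _)); last exact: sum2_wgapC.
  move=> u v; rewrite !inE => /and3P[_ h1 h2] /and3P[_ h3 h4].
  have h : (u < v)%N by lia.
  by split=> //; apply: short => //; lia.
rewrite cross_moment2E.
apply: (@Rle_trans _ (avgM T (fun P => 2 * (\sum_(b in W) \sum_(d in V1) arc_ind P b d) ^ 2 +
   2 * (\sum_(b in U2) \sum_(d in W) arc_ind P b d) ^ 2))); last first.
  rewrite avgMD !avgMZ.
  have le2 u v : u <= v -> 2 * u <= 2 * v by move=> ?; lra.
  apply: Rle_trans (Rplus_le_compat _ _ _ _ (le2 _ _ E1) (le2 _ _ E2)) _.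
  by have e r : 2 * (684 * r) + 2 * (684 * r) <= 2736 * r; [lra | exact: e].
apply: avgM_le => P hP.
have hY : ncross_arc L P (x, y) <= \sum_(b in W) \sum_(d in V1) arc_ind P b d + \sum_(b in U2) \sum_(d in W) arc_ind P b d.
  rewrite !pair_big_dep /= /ncross_arc (bigID (fun B : arc => (B.1 \in T) && (B.2 \in T))) /=.
  rewrite [X in _ + X]big1 ?Rplus_0_r; last by move=> B /andP[_ h]; exact: arc_ind_out h.
  rewrite (bigID (fun B : arc => (x < B.1)%N)) /=; apply: Rplus_le_compat.
    apply: rsum_sub => [B|B _]; last exact: arc_ind_ge0.
    by rewrite !inE /crosses /=; case: (B.1 \in T); case: (B.2 \in T); rewrite ?andbF //=; lia.
  apply: rsum_sub => [B|B _]; last exact: arc_ind_ge0.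
  by rewrite !inE /crosses /=; case: (B.1 \in T); case: (B.2 \in T); rewrite ?andbF //=; lia.
have Y0 := ncross_arc_ge0 L P (x, y).
move: (ncross_arc L P (x, y)) Y0 hY => q q0.
move: (\sum_(b in W) _) (\sum_(b in U2) _) => u v huv.
have := Rle_0_sqr (u - v); rewrite /Rsqr; nra.
Qed.

(** Weighted arithmetic-geometric mean inequality. The weight [th] stays free because the windows
    below two nested arcs may have very different sizes. *)
Lemma cross_moment2_le L T m A A' th : #|T| = (2 * m)%N -> (L <= m)%N -> 0 < th ->
  A.1 \notin T -> A.2 \notin T -> A'.1 \notin T -> A'.2 \notin T ->
  cross_moment2 L T A A' <= 1368 * (th * INR #|inside T A.1 A.2| + INR #|inside T A'.1 A'.2| / th).
Proof.
move=> hm hL hth h1 h2 h3 h4.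
have d1 := cross_moment2_diag_le hm hL h1 h2; have d2 := cross_moment2_diag_le hm hL h3 h4.
apply: (@Rle_trans _ (th / 2 * cross_moment2 L T A A + / th / 2 * cross_moment2 L T A' A')).
  rewrite !cross_moment2E -!avgMZ -avgMD; apply: avgM_le => P _.
  move: (ncross_arc L P A) (ncross_arc L P A') => u v.
  have : 0 <= / th / 2 * (th * u - v) ^ 2.
    by apply: Rmult_le_pos; [have := Rinv_0_lt_compat _ hth; lra | exact: pow2_ge_0].
  have -> : / th / 2 * (th * u - v) ^ 2 = th / 2 * (u * u) + / th / 2 * (v * v) - u * v by field; lra.
  lra.
have i0 := Rinv_0_lt_compat _ hth.
have a1 := Rmult_le_compat_l (th / 2) _ _ ltac:(lra) d1.
have a2 := Rmult_le_compat_l (/ th / 2) _ _ ltac:(lra) d2.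
apply: Rle_trans (Rplus_le_compat _ _ _ _ a1 a2) _; apply: Req_le; field; lra.
Qed.

(** The part of the second moment from pairs of crossings whose [S]-arcs are not side by side; the
    position of the [T]-arcs is unrestricted. *)
Definition overlap (L : nat) S T : R :=
  \sum_A \sum_(B | crosses L A B) \sum_A' \sum_(B' | crosses L A' B')
     (if side_by_side A A' then 0 else arc_prob2 S A A' * arc_prob2 T B B').

Lemma avgM_ncross_sqr L S T : avgM S (fun P => avgM T (fun P' => ncross L P P' ^ 2)) =
  \sum_A \sum_(B | crosses L A B) \sum_A' \sum_(B' | crosses L A' B') arc_prob2 S A A' * arc_prob2 T B B'.
Proof.
pose I2 P P' := \sum_A \sum_(B | crosses L A B) \sum_A' \sum_(B' | crosses L A' B')
   (arc_in P A * arc_in P A') * (arc_in P' B * arc_in P' B').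
have e P P' : ncross L P P' ^ 2 = I2 P P'.
  rewrite -Rsqr_pow2 /Rsqr /ncross /I2 big_distrl /=; apply: eq_bigr => A _.
  rewrite big_distrl /=; apply: eq_bigr => B _; rewrite big_distrr /=; apply: eq_bigr => A' _.
  rewrite big_distrr /=; apply: eq_bigr => B' _; ring.
transitivity (avgM S (fun P => avgM T (fun P' => I2 P P'))).
  by apply: avgM_eq => P _; apply: avgM_eq => P' _.
rewrite /I2.
under avgM_eq => P _ do rewrite avgM_sum.
rewrite avgM_sum; apply: eq_bigr => A _.
under avgM_eq => P _ do rewrite avgM_sum.
rewrite avgM_sum; apply: eq_bigr => B _.
under avgM_eq => P _ do rewrite avgM_sum.
rewrite avgM_sum; apply: eq_bigr => A' _.
under avgM_eq => P _ do rewrite avgM_sum.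
rewrite avgM_sum; apply: eq_bigr => B' _.
under avgM_eq => P _ do rewrite avgMZ Rmult_comm.
by rewrite avgMZ Rmult_comm.
Qed.

Lemma arc_prob2_side_le L S k rho A A' : #|S| = (2 * k)%N -> (L.+1 < k)%N ->
  ((INR k + 1) / (INR (k - L.+2) + 1)) ^ 2 <= rho ->
  (A.1 < A.2)%N -> (A.2 - A.1 <= L)%N -> (A'.1 < A'.2)%N -> (A'.2 - A'.1 <= L)%N ->
  side_by_side A A' -> arc_prob2 S A A' <= rho * (arc_prob S A * arc_prob S A').
Proof.
move=> hk hL hrho h1 h2 h3 h4 hs.
have g1 := card_inside_lt S h1; have g2 := card_inside_lt S h3.
have q0 := prob1_ge0 S A.1 A.2; have q0' := prob1_ge0 S A'.1 A'.2.
apply: (@Rle_trans _ (((INR k + 1) / (INR (k - L.+2) + 1)) ^ 2 * (arc_prob S A * arc_prob S A'))); last first.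
  by apply: Rmult_le_compat_r => //; apply: Rmult_le_pos.
case/orP: hs => hs; first by apply: prob2_side => //; lia.
by rewrite arc_prob2C (Rmult_comm (arc_prob S A)); apply: prob2_side => //; lia.
Qed.

(** For each pair of crossings, either the arcs of both colours are side by side, and each colour
    costs a factor [rho] against independence, or the arcs of one colour are not, and the pair is
    covered by one of the two [overlap] terms. *)
Lemma second_moment L S T k m rho : #|S| = (2 * k)%N -> #|T| = (2 * m)%N ->
  (L.+1 < k)%N -> (L.+1 < m)%N ->
  ((INR k + 1) / (INR (k - L.+2) + 1)) ^ 2 <= rho ->
  ((INR m + 1) / (INR (m - L.+2) + 1)) ^ 2 <= rho ->
  avgM S (fun P => avgM T (fun P' => ncross L P P' ^ 2)) <=
  rho ^ 2 * mcross L S T ^ 2 + overlap L S T + overlap L T S.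
Proof.
move=> hk hm hLk hLm hr1 hr2; rewrite avgM_ncross_sqr.
have rho0 : 0 <= rho by apply: Rle_trans hr1; exact: pow2_ge_0.
have e1 : rho ^ 2 * mcross L S T ^ 2 = \sum_A \sum_(B | crosses L A B) \sum_A' \sum_(B' | crosses L A' B')
   (rho * (arc_prob S A * arc_prob S A')) * (rho * (arc_prob T B * arc_prob T B')).
  rewrite -[mcross L S T ^ 2]Rsqr_pow2 /Rsqr /mcross big_distrl big_distrr /=; apply: eq_bigr => A _.
  rewrite big_distrl big_distrr /=; apply: eq_bigr => B _; rewrite big_distrr big_distrr /=; apply: eq_bigr => A' _.
  rewrite !big_distrr /=; apply: eq_bigr => B' _; ring.
have e2 : overlap L T S = \sum_A \sum_(B | crosses L A B) \sum_A' \sum_(B' | crosses L A' B')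
     (if side_by_side B B' then 0 else arc_prob2 S A A' * arc_prob2 T B B').
  rewrite /overlap (exchange_big_dep xpredT) //=; apply: eq_bigr => B _.
  apply: eq_big => [A|A _]; first exact: crossesC.
  rewrite (exchange_big_dep xpredT) //=; apply: eq_bigr => B' _.
  apply: eq_big => [A'|A' _]; first exact: crossesC.
  by case: ifP => _ //; rewrite Rmult_comm.
rewrite e1 e2 /overlap -!big_split /=; apply: rsum_le => A _.
rewrite -!big_split /=; apply: rsum_le => B hB.
rewrite -!big_split /=; apply: rsum_le => A' _.
rewrite -!big_split /=; apply: rsum_le => B' hB'.
have [a1 a2 a3 a4] := crosses_short hB; have [b1 b2 b3 b4] := crosses_short hB'.
have z1 := arc_prob2_ge0 S A A'; have z2 := arc_prob2_ge0 T B B'.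
have z := Rmult_le_pos _ _ z1 z2.
have q : 0 <= (rho * (arc_prob S A * arc_prob S A')) * (rho * (arc_prob T B * arc_prob T B')).
  have pp R' C : 0 <= arc_prob R' C by exact: prob1_ge0.
  by apply: Rmult_le_pos; apply: Rmult_le_pos => //; apply: Rmult_le_pos.
case: (boolP (side_by_side A A')) => s1; last by case: ifP => _; lra.
case: (boolP (side_by_side B B')) => s2; last by lra.
have u1 := arc_prob2_side_le hk hLk hr1 a1 a2 b1 b2 s1.
have u2 := arc_prob2_side_le hm hLm hr2 a3 a4 b3 b4 s2.
by rewrite !Rplus_0_r; apply: Rmult_le_compat.
Qed.

(** The arcs coincide or are nested. Summing out the outer arc costs [27 * sqrt L * wgap g], with
    [g] the gap of the inner arc, and what remains is a harmonic sum over inner arcs. The constant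
    is 5472 + 2 * 147744, with 147744 = 4 * 27 * 1368. *)
Lemma overlap_le L S T k m : (0 < n)%N -> [disjoint S & T] -> #|S| = (2 * k)%N -> #|T| = (2 * m)%N ->
  (k + m = n)%N -> (0 < L)%N -> (3 * L <= k)%N -> (L <= m)%N ->
  overlap L S T <= 300960 * INR n * INR L * (1 + ln (INR (2 * n))).
Proof.
move=> hn hST hk hm hkm hL hLk hLm.
set H := 1 + ln (INR (2 * n)).
have H1 : 1 <= H.
  have : 0 <= ln (INR (2 * n)) by rewrite -ln_1; apply: ln_le; [lra | apply: (@INR_leq 1); lia].
  rewrite /H; lra.
have L0 := INR_gt0 hL.
have nT z : z \in S -> z \notin T.
  by move=> hz; move: hST; rewrite disjoint_subset => /subsetP /(_ _ hz); rewrite inE.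
have eS : INR #|S| + INR #|T| = 2 * INR n.
  by rewrite -INR_addn hk hm -[2]/(INR 2) -INR_muln; congr INR; lia.
have S0 := pos_INR #|S|; have T0 := pos_INR #|T|.
pose Q := [pred A : arc | [&& A.1 \in S, A.2 \in S, (A.1 < A.2)%N & (A.2 - A.1 <= L)%N]].
have tL A : A \in Q -> INR #|inside T A.1 A.2| <= INR L.
  by case/and4P => _ _ h1 h2; apply: INR_leq; have := card_inside_lt T h1; lia.
have r1 : overlap L S T = \sum_A \sum_A' (if side_by_side A A' then 0 else arc_prob2 S A A' * cross_moment2 L T A A').
  rewrite /overlap; apply: eq_bigr => A _; rewrite exchange_big /=; apply: eq_bigr => A' _.
  rewrite /cross_moment2; case: ifP => hs; first by rewrite big1 // => B _; rewrite big1.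
  by rewrite big_distrr /=; apply: eq_bigr => B _; rewrite big_distrr.
have offQ A A' : ~~ ((A \in Q) && (A' \in Q)) -> arc_prob2 S A A' * cross_moment2 L T A A' = 0.
  move=> h; case: (boolP [&& A.1 \in S, A.2 \in S, A'.1 \in S & A'.2 \in S]) => hS; last first.
    by rewrite /arc_prob2 prob2_out // Rmult_0_l.
  case/and4P: hS => s1 s2 s3 s4; rewrite !inE s1 s2 s3 s4 /= in h.
  rewrite /cross_moment2; case: (boolP ((A.1 < A.2)%N && (A.2 - A.1 <= L)%N)) => hA.
    rewrite (eq_bigr (fun _ => 0)) ?big1 ?Rmult_0_r // => B _; rewrite big_pred0 // => B'.
    by apply/negP => /crosses_short[h1 h2 _ _]; move: h; rewrite hA h1 h2.
  rewrite big_pred0 ?Rmult_0_r // => B; apply/negP => /crosses_short[h1 h2 _ _].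
  by move: hA; rewrite h1 h2.
have r2 : overlap L S T <= \sum_(A in Q) arc_prob S A * cross_moment2 L T A A +
   (\sum_(A in Q) \sum_(A' in Q | nested A A') arc_prob2 S A A' * cross_moment2 L T A A' +
    \sum_(A in Q) \sum_(A' in Q | nested A' A) arc_prob2 S A A' * cross_moment2 L T A A').
  rewrite r1 (bigID (mem Q)) /= [X in _ + X]big1 ?Rplus_0_r; last first.
    by move=> A hA; rewrite big1 // => A' _; case: ifP => // _; rewrite offQ // (negbTE hA).
  rewrite -!big_split /=; apply: rsum_le => A hA.
  have pos A' : 0 <= arc_prob2 S A A' * cross_moment2 L T A A' by apply: Rmult_le_pos; [exact: arc_prob2_ge0 | exact: cross_moment2_ge0].
  have ltA : (A.1 < A.2)%N by case/and4P: hA.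
  rewrite (bigD1 A) //=; apply: Rplus_le_compat.
    by rewrite arc_prob2_diag ifF; [exact: Rle_refl | rewrite /side_by_side; lia].
  rewrite (bigID (fun A' => nested A A')) /=; apply: Rplus_le_compat.
    rewrite (bigID (mem Q)) /= [X in _ + X]big1 ?Rplus_0_r; last first.
      by move=> A' /andP[_ hA']; case: ifP => // _; rewrite offQ // (negbTE hA') andbF.
    apply: (@Rle_trans _ (\sum_(i | (i != A) && nested A i && (i \in Q)) arc_prob2 S A i * cross_moment2 L T A i)).
      by apply: rsum_le => A' _; case: ifP => _; [exact: pos | exact: Rle_refl].
    by apply: rsum_sub => [A' /andP[/andP[_ ->] ->]|A' _] //.
  rewrite (bigID (fun A' => (A' \in Q) && nested A' A)) /= [X in _ + X]big1 ?Rplus_0_r; last first.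
    move=> A' /andP[/andP[h1 h2] h3]; case: ifP => // hs.
    case: (boolP (A' \in Q)) => hA'; last by rewrite offQ // (negbTE hA') andbF.
    rewrite hA' /= in h3; rewrite arc_prob2_zero ?Rmult_0_l // ?hs //; last by rewrite eq_sym.
    by case/and4P: hA'.
  apply: (@Rle_trans _ (\sum_(i | (i != A) && ~~ nested A i && ((i \in Q) && nested i A)) arc_prob2 S A i * cross_moment2 L T A i)).
    by apply: rsum_le => A' _; case: ifP => _; [exact: pos | exact: Rle_refl].
  by apply: rsum_sub => [A' /andP[_ ->]|A' _].
pose h A := 1368 * sqrt (INR L) * (sqrt (INR #|inside S A.1 A.2| + 1) +
   INR #|inside T A.1 A.2| / sqrt (INR #|inside S A.1 A.2| + 1)).
have sL := sqrt_lt_R0 _ L0; have sLL := sqrt_sqrt (INR L) ltac:(lra).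
have INR1 g : 0 < INR g + 1 by have := pos_INR g; lra.
have hsq g : 0 < sqrt (INR g + 1) by apply: sqrt_lt_R0; have := pos_INR g; lra.
have yh A A' : A \in Q -> A' \in Q -> cross_moment2 L T A A' <= h A'.
  move=> hA hA'; case/and4P: (hA) => s1 s2 _ _; case/and4P: (hA') => s3 s4 _ _.
  have sg := hsq #|inside S A'.1 A'.2|.
  (* The window below the outer arc [A] is bounded merely by [L]. This weight balances [L] against
     the gap of the inner arc, so that after multiplication by [wgap] the two terms are of the forms
     [1 / (g + 1)] and [t / (g + 1) ^ 2], both summable to a logarithm. *)
  have th0 : 0 < sqrt (INR #|inside S A'.1 A'.2| + 1) / sqrt (INR L) by exact: Rdiv_lt_0_compat.
  apply: Rle_trans (cross_moment2_le hm hLm th0 (nT _ s1) (nT _ s2) (nT _ s3) (nT _ s4)) _.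
  have b1 := Rmult_le_compat_l _ _ _ (Rlt_le _ _ th0) (tL A hA).
  rewrite /h Rmult_assoc; apply: Rmult_le_compat_l; first lra.
  rewrite Rmult_plus_distr_l; apply: Rplus_le_compat.
    apply: Rle_trans b1 _; apply: Req_le; rewrite -{2}sLL; field; lra.
  by apply: Req_le; field; lra.
have h0 A : 0 <= h A.
  have sg := hsq #|inside S A.1 A.2|.
  have : 0 <= INR #|inside T A.1 A.2| / sqrt (INR #|inside S A.1 A.2| + 1).
    by apply: Rmult_le_pos; [exact: pos_INR | exact/Rlt_le/Rinv_0_lt_compat].
  by move=> q; apply: Rmult_le_pos; lra.
have nsum A' : A' \in Q -> \sum_(A in Q | nested A A') arc_prob2 S A A' <=
    27 * sqrt (INR L) * wgap #|inside S A'.1 A'.2|.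
  case: A' => x' y' /and4P[/= s1 s2 hxy hl].
  pose U := [set z in S | (z < x')%N && (x' - z <= L)%N].
  pose V := [set z in S | (y' < z)%N && (z - y' <= L)%N].
  have hU : U \subset S by apply/subsetP => z; rewrite inE => /andP[].
  have hV : V \subset S by apply/subsetP => z; rewrite inE => /andP[].
  apply: (@Rle_trans _ (\sum_(x in U | (x < x')%N) \sum_(y in V | (y' < y)%N) prob2 S x y x' y')).
    rewrite pair_big_dep /=; apply: rsum_sub => [A|A _]; last exact: arc_prob2_ge0.
    rewrite !inE /nested /= => /andP[/and4P[-> -> q1 q2] /andP[q3 q4]] /=; lia.
  apply: Rle_trans (nested_sum hk hU hV hxy _) _.
    (* The outer endpoints are within [L] of an arc of length at most [L], so their distance is at
       most [3 * L <= k]. *)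
    move=> u v; rewrite !inE => /and3P[_ q1 q2] /and3P[_ q3 q4] huv.
    by have := card_inside_lt S huv; lia.
  have w0 := wgap_gt0 #|inside S x' y'|.
  have cU : (#|U| <= L)%N by apply: (@card_interval _ _ (x' - L)%N) => z; rewrite inE; lia.
  have := sum2_wgap #|U| #|V|.
  have : sqrt (INR #|U|) <= sqrt (INR L) by apply/sqrt_le_1_alt/INR_leq.
  set sg := \sum_(i < #|U|) _ => q1 q2.
  have q3 : sg <= 12 * sqrt (INR L) by lra.
  apply: Rle_trans (Rmult_le_compat_l _ _ _ _ q3) _; first by apply: Rmult_le_pos; lra.
  by have e (a q : R) : 9 / 4 * a * (12 * q) <= 27 * q * a; [lra | exact: e].
have NS : \sum_(A' in Q) \sum_(A in Q | nested A A') arc_prob2 S A A' * cross_moment2 L T A A' <= 147744 * INR n * INR L * H.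
  apply: (@Rle_trans _ (\sum_(A' in Q) 36936 * INR L *
     (1 / (INR #|inside S A'.1 A'.2| + 1) + 1 / (INR #|inside S A'.1 A'.2| + 1) ^ 2 * INR #|inside T A'.1 A'.2|))).
    apply: rsum_le => A' hA'.
    apply: (@Rle_trans _ (\sum_(A in Q | nested A A') arc_prob2 S A A' * h A')).
      by apply: rsum_le => A /andP[hA _]; apply: Rmult_le_compat_l; [exact: arc_prob2_ge0 | exact: yh].
    rewrite -big_distrl /=.
    apply: Rle_trans (Rmult_le_compat_r _ _ _ (h0 A') (nsum A' hA')) _.
    apply: Req_le; rewrite /h /wgap /w32.
    have sg := hsq #|inside S A'.1 A'.2|.
    have ge := sqrt_sqrt (INR #|inside S A'.1 A'.2| + 1) ltac:(have := pos_INR #|inside S A'.1 A'.2|; lra).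
    move: (INR #|inside S A'.1 A'.2| + 1) (sqrt (INR #|inside S A'.1 A'.2| + 1)) sg ge => g s sg <-.
    move: (INR L) (sqrt (INR L)) sL sLL => l q q0 <-.
    set u := INR #|inside T _ _|.
    by field; lra.
  rewrite -big_distrr /= big_split /=.
  have b1 : \sum_(A in Q) (1 / (INR #|inside S A.1 A.2| + 1)) <= INR #|S| * H.
    apply: (@Rle_trans _ (\sum_(x in S) \sum_(y in S | (x < y)%N) (1 / (INR #|inside S x y| + 1)))).
      rewrite pair_big_dep /=; apply: rsum_sub => [A /and4P[-> -> -> _] //|A _].
      by apply/Rlt_le/Rdiv_lt_0_compat; [lra | exact: INR1].
    rewrite -rsum_const; apply: rsum_le => x _.
    apply: Rle_trans (harmonic_le _); last by lia.
    apply: (@sum_gap_right_le _ S x _ (fun g => 1 / (INR g + 1))); last exact: card_le2n.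
    by move=> i; apply/Rlt_le/Rdiv_lt_0_compat; [lra | have := pos_INR i; lra].
  have b2 : \sum_(A in Q) (1 / (INR #|inside S A.1 A.2| + 1) ^ 2 * INR #|inside T A.1 A.2|) <= INR #|T| * (2 * H).
    have F0 g : 0 <= 1 / (INR g + 1) ^ 2.
      by apply/Rlt_le/Rdiv_lt_0_compat; [lra | have := pos_INR g => hg; nra].
    apply: (@Rle_trans _ (\sum_(x in S) \sum_(y in S | (x < y)%N) (1 / (INR #|inside S x y| + 1) ^ 2 * INR #|inside T x y|))).
      rewrite pair_big_dep /=; apply: rsum_sub => [A /and4P[-> -> -> _] //|A _].
      by apply: Rmult_le_pos; [exact: F0 | exact: pos_INR].
    apply: Rle_trans (sum_window (N := 2 * n) hST F0 _ _) _; try by move=> b; exact: card_le2n.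
    apply: Rmult_le_compat_l => //.
    apply: (@Rle_trans _ (\sum_(i < 2 * n) (2 * (1 / (INR i + 1))))).
      apply: rsum_le => i _; apply: Rle_trans (sum_inv_sqr i _) _; apply: Req_le; field.
      by have := pos_INR i; lra.
    rewrite -(big_distrr 2) /=; apply: Rmult_le_compat_l; first lra.
    by apply: harmonic_le; lia.
  apply: (@Rle_trans _ (36936 * INR L * (INR #|S| * H + INR #|T| * (2 * H)))).
    by apply: Rmult_le_compat_l; [lra | apply: Rplus_le_compat].
  have : INR #|S| * H + INR #|T| * (2 * H) <= 4 * INR n * H by nra.
  move=> q; have := Rmult_le_compat_l (36936 * INR L) _ _ ltac:(lra) q; lra.
have NS1 : \sum_(A in Q) \sum_(A' in Q | nested A A') arc_prob2 S A A' * cross_moment2 L T A A' <= 147744 * INR n * INR L * H.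
  apply: Rle_trans NS; rewrite (exchange_big_dep (mem Q)) /=; last by move=> i j _ /andP[].
  by apply: Req_le; apply: eq_bigr => A' hA'; apply: eq_bigl => A; rewrite hA'.
have NS2 : \sum_(A in Q) \sum_(A' in Q | nested A' A) arc_prob2 S A A' * cross_moment2 L T A A' <= 147744 * INR n * INR L * H.
  apply: Rle_trans NS; apply: Req_le; apply: eq_bigr => A' hA'; apply: eq_bigr => A _.
  rewrite arc_prob2C !cross_moment2E; congr (_ * _); apply: avgM_eq => P _; exact: Rmult_comm.
have DG : \sum_(A in Q) arc_prob S A * cross_moment2 L T A A <= 5472 * INR n * INR L * H.
  apply: (@Rle_trans _ (\sum_(A in Q) arc_prob S A * (2736 * INR L))).
    apply: rsum_le => A hA; case/and4P: (hA) => s1 s2 _ _.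
    apply: Rmult_le_compat_l; first exact: prob1_ge0.
    apply: Rle_trans (cross_moment2_diag_le hm hLm (nT _ s1) (nT _ s2)) _.
    by apply: Rmult_le_compat_l; [lra | exact: tL].
  rewrite -big_distrl /=.
  have : \sum_(A in Q) arc_prob S A <= INR #|S|.
    apply: (@Rle_trans _ (\sum_(x in S) \sum_(y in S | y != x) prob1 S x y)).
      rewrite pair_big_dep /=; apply: rsum_sub => [A /and4P[-> -> q _]|A _]; last exact: prob1_ge0.
      by rewrite -val_eqE /=; lia.
    rewrite (eq_bigr (fun _ => 1)); last by move=> x hx; rewrite (prob1_total hk hx).
    by rewrite rsum_const Rmult_1_r; exact: Rle_refl.
  move=> q; have q' := Rmult_le_compat_r (2736 * INR L) _ _ ltac:(lra) q.
  apply: Rle_trans q' _.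
  apply: (@Rle_trans _ (5472 * INR n * INR L * 1)).
    have := Rmult_le_compat_r (INR L) (INR #|S|) (2 * INR n) ltac:(lra) ltac:(lra); lra.
  by apply: Rmult_le_compat_l => //; have := INR_gt0 hn => ?; nra.
apply: Rle_trans r2 _.
apply: Rle_trans (Rplus_le_compat _ _ _ _ DG (Rplus_le_compat _ _ _ _ NS1 NS2)) _.
by apply: Req_le; ring.
Qed.

End CrossVariance.

(** * Random colourings *)

Lemma rsum_inj_le (I J : finType) (h : I -> J) (Q : pred J) (G : J -> R) :
  injective h -> (forall i, Q (h i)) -> (forall j, Q j -> 0 <= G j) ->
  \sum_i G (h i) <= \sum_(j | Q j) G j.
Proof.
move=> hinj hQ hG; apply: (@Rle_trans _ (\sum_(j in h @: [set: I]) G j)).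
  rewrite big_imset /=; last by move=> i j _ _; exact: hinj.
  by apply: Req_le; apply: eq_bigl => i; rewrite inE.
by apply: rsum_sub => // j /imsetP[i _ ->].
Qed.

(** The tangent plane at [(x0, y0)] of the convex function (x y)^(-3/2). Used in place of Jensen's
    inequality, it asks only for the means of the two arguments, whatever their dependence. *)
Lemma w32_tangent x y x0 y0 : 0 < x -> 0 < y -> 0 < x0 -> 0 < y0 ->
  w32 x0 * w32 y0 * (4 - 3 / 2 * (x / x0) - 3 / 2 * (y / y0)) <= w32 x * w32 y.
Proof.
move=> hx hy hx0 hy0; rewrite /w32.
have := sqrt_lt_R0 x hx; have := sqrt_lt_R0 y hy; have := sqrt_lt_R0 x0 hx0; have := sqrt_lt_R0 y0 hy0.
have := sqrt_sqrt x (Rlt_le _ _ hx); have := sqrt_sqrt y (Rlt_le _ _ hy).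
have := sqrt_sqrt x0 (Rlt_le _ _ hx0); have := sqrt_sqrt y0 (Rlt_le _ _ hy0).
move: (sqrt x) (sqrt y) (sqrt x0) (sqrt y0) => a b a0 b0 <- <- <- <- hb0 ha0 hb ha.
have hs : 0 < a / a0 by apply: Rdiv_lt_0_compat.
have hr : 0 < b / b0 by apply: Rdiv_lt_0_compat.
have -> : a = a / a0 * a0 by field; lra.
have -> : b = b / b0 * b0 by field; lra.
move: (a / a0) (b / b0) hs hr => s r hs hr.
have hp : 0 < s * r by nra.
have key : 4 - 3 / 2 * (s * s) - 3 / 2 * (r * r) <= 1 / (s * r) ^ 3.
  apply: (@Rle_trans _ (4 - 3 * (s * r))); first by have := Rle_0_sqr (s - r); rewrite /Rsqr; lra.
  move: (s * r) hp => p hp; apply (Rle_div_r _ _ (p ^ 3)); first by apply: pow_lt.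
  (* The product expands to 3 p^4 - 4 p^3 + 1, which is the claim multiplied by p^3. *)
  have : 0 <= (p - 1) ^ 2 * (3 * p ^ 2 + 2 * p + 1).
    by apply: Rmult_le_pos; [exact: pow2_ge_0 | nra].
  lra.
have ab0 : 0 < 1 / (a0 * a0 * a0) * (1 / (b0 * b0 * b0)).
  by apply: Rmult_lt_0_compat; apply: Rdiv_lt_0_compat; try lra; do 2 apply: Rmult_lt_0_compat => //.
have -> : 1 / (s * a0 * (s * a0) * (s * a0)) * (1 / (r * b0 * (r * b0) * (r * b0))) =
   1 / (a0 * a0 * a0) * (1 / (b0 * b0 * b0)) * (1 / (s * r) ^ 3) by field; lra.
apply: Rmult_le_compat_l; first lra.
by rewrite [X in X <= _](_ : _ = 4 - 3 / 2 * (s * s) - 3 / 2 * (r * r)) //; field; lra.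
Qed.

Section Colorings.
Variable n : nat.
Local Notation pt := 'I_(2 * n).
Local Notation cpt := 'I_(2 * n).-1.
Implicit Types (c : coloring n) (p z : cpt) (F : coloring n -> R) (Z : {set cpt}) (col : bool).

Definition avg F : R := / INR (2 ^ (2 * n - 1))%N * \sum_c F c.

Lemma two_pow_gt0 : 0 < INR (2 ^ (2 * n - 1))%N.
Proof. by apply: INR_gt0; rewrite expn_gt0. Qed.

Lemma avg_le F G : (forall c, F c <= G c) -> avg F <= avg G.
Proof.
move=> h; apply: Rmult_le_compat_l; last by apply: rsum_le.
exact/Rlt_le/Rinv_0_lt_compat/two_pow_gt0.
Qed.

Lemma avgZ k F : avg (fun c => k * F c) = k * avg F.
Proof. by rewrite /avg -big_distrr /=; ring. Qed.

Lemma avgD F G : avg (fun c => F c + G c) = avg F + avg G.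
Proof. by rewrite /avg big_split /=; ring. Qed.

Lemma avg_sum (I : Type) (r : seq I) (Q : pred I) (F : I -> coloring n -> R) :
  avg (fun c => \sum_(i <- r | Q i) F i c) = \sum_(i <- r | Q i) avg (F i).
Proof. by rewrite /avg exchange_big /= big_distrr. Qed.

Lemma avg_const k : avg (fun _ => k) = k.
Proof.
have h := two_pow_gt0; rewrite /avg rsum_const card_ffun card_bool card_ord -subn1 in h *; field; lra.
Qed.

Definition recolor c p (v : bool) : coloring n := [ffun z => if z == p then v else c z].

Lemma sum_flip F p : \sum_c F (recolor c p (~~ c p)) = \sum_c F c.
Proof.
rewrite [RHS](reindex_inj (h := fun c => recolor c p (~~ c p))) //=.
apply: (can_inj (g := fun c => recolor c p (~~ c p))) => c; apply/ffunP => z; rewrite !ffunE.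
by case: eqP => [->|_]; rewrite ?eqxx ?negbK.
Qed.

Lemma sum_toggle F p : \sum_c (F (recolor c p true) + F (recolor c p false)) = 2 * \sum_c F c.
Proof.
rewrite (_ : 2 * _ = \sum_c F c + \sum_c F (recolor c p (~~ c p))); last by rewrite sum_flip; ring.
rewrite -big_split /=; apply: eq_bigr => c _.
have e : recolor c p (c p) = c by apply/ffunP => z; rewrite ffunE; case: eqP => [->|].
by case h: (c p); rewrite -{3 4}e h /=; [|rewrite Rplus_comm];
  congr (F _ + F _); apply/ffunP => z; rewrite !ffunE; case: eqP.
Qed.

Lemma avg_color z col : avg (fun c => if c z == col then 1 else 0) = 1 / 2.
Proof.
rewrite /avg; have h := two_pow_gt0.
have := sum_toggle (fun c => if c z == col then 1 else 0) z.
rewrite (eq_bigr (fun _ => 1)) => [|c _]; last by rewrite !ffunE eqxx; case: col => /=; lra.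
have ec : #|{ffun cpt -> bool}| = (2 ^ (2 * n - 1))%N by rewrite card_ffun card_bool card_ord subn1.
rewrite rsum_const ec => e.
move: e; set s := \sum_(c : coloring n) _ => e.
have -> : s = INR (2 ^ (2 * n - 1)) / 2 by lra.
field; lra.
Qed.

Definition color_count (Z : {set cpt}) (col : bool) c : nat := #|[set z in Z | c z == col]|.

Lemma INR_color_count Z col c : INR (color_count Z col c) = \sum_(z in Z) (if c z == col then 1 else 0).
Proof.
rewrite rsum_if /color_count -[LHS]Rmult_1_r -rsum_const; apply: eq_bigl => z; by rewrite inE.
Qed.

Lemma avg_color_count Z col : avg (fun c => INR (color_count Z col c)) = INR #|Z| / 2.
Proof.
transitivity (avg (fun c => \sum_(z in Z) (if c z == col then 1 else 0))).
  by rewrite /avg; congr (_ * _); apply: eq_bigr => c _; exact: INR_color_count.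
rewrite avg_sum (eq_bigr (fun _ => 1 / 2)); last by move=> z _; exact: avg_color.
rewrite rsum_const; field.
Qed.

Lemma color_count_add1 Z col c p : p \notin Z ->
  color_count (p |: Z) col c = ((c p == col) + color_count Z col c)%N.
Proof.
move=> hp; rewrite /color_count (cardsD1 p) !inE eqxx /=; congr addn.
apply: eq_card => z; rewrite !inE; case: (eqVneq z p) => [->|] //=.
by rewrite (negbTE hp).
Qed.

Definition emb (z : cpt) : pt := widen_ord (leq_pred _) z.

Lemma full_col_emb c z : full_col c (emb z) = c z.
Proof. by rewrite /full_col /= valK. Qed.

Definition open_itv (a b : cpt) : {set cpt} := [set z : cpt | (a < z)%N && (z < b)%N].

Lemma emb_inj : injective emb.
Proof. by move=> x y /(congr1 val) /= /val_inj. Qed.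

Lemma inside_colE (col : bool) c (a b : cpt) (S : {set pt}) :
  (forall z, (emb z \in S) = (c z == col)) ->
  #|inside S (emb a) (emb b)| = color_count (open_itv a b) col c.
Proof.
move=> hS; rewrite /color_count -(card_imset _ emb_inj); apply: eq_card => y.
apply/idP/imsetP => [|[z]]; rewrite !inE.
  move=> /and3P[hy h1 h2]; have hb := ltn_ord b; rewrite /= in h1 h2.
  have hlt : (y < (2 * n).-1)%N by lia.
  have e : y = emb (Ordinal hlt) by apply: val_inj.
  by exists (Ordinal hlt) => //; rewrite !inE /= h1 h2 -hS -e hy.
by move=> /andP[/andP[h1 h2] h3] ->; rewrite hS h3 /= h1 h2.
Qed.

(** A lower bound for an arc probability that does not involve the total number of points of the
    colour, hence depends on the colouring only through a local count. *)
Definition vlow (g : nat) : R := if odd g then 0 else psi g./2 / 4.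

Lemma vlow_ge0 g : 0 <= vlow g.
Proof. by rewrite /vlow; case: ifP => _; [lra | have := psi_gt0 g./2; lra]. Qed.

Lemma vlow_ge g N : ~~ odd g -> (g <= N.+1)%N ->
  w32 ((INR N + 3) / 2) / (4 * sqrt PI) <= vlow g.
Proof.
move=> hg hN; rewrite /vlow (negbTE hg).
have P0 := sqrt_lt_R0 _ PI_RGT_0; have h := psi_ge_w32 g./2.
have e : INR g = 2 * INR g./2 by rewrite -[2]/(INR 2) -INR_muln; congr INR; lia.
have h1 : INR g <= INR N + 1 by rewrite -S_INR; apply: INR_leq.
have h2 := pos_INR g./2.
have h3 := @w32_anti (INR g./2 + 1) ((INR N + 3) / 2) ltac:(lra) ltac:(lra).
have -> : w32 ((INR N + 3) / 2) / (4 * sqrt PI) = w32 ((INR N + 3) / 2) / sqrt PI / 4 by field; lra.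
apply: Rmult_le_compat_r; first lra.
apply: Rle_trans h; apply: Rmult_le_compat_r => //.
by apply/Rlt_le/Rinv_0_lt_compat.
Qed.

(** Lower bound, given the colouring, for the probability that the arc from [a] to [e] in colour
    [col] and the arc from [b] to [d] in the other colour are both present. *)
Definition quad_term (col : bool) (a b e d : cpt) c : R :=
  if [&& c a == col, c e == col, c b == ~~ col & c d == ~~ col] then
    vlow (color_count (open_itv a e) col c) * vlow (color_count (open_itv b d) (~~ col) c) else 0.

Lemma quad_term_ge0 col a b e d c : 0 <= quad_term col a b e d c.
Proof.
by rewrite /quad_term; case: ifP => _; [apply: Rmult_le_pos; exact: vlow_ge0 | lra].
Qed.

Lemma w32_quarter u : 0 < u -> w32 (u / 4) = 8 * w32 u.
Proof.
move=> hu; rewrite /w32; have h := sqrt_lt_R0 u hu.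
have -> : sqrt (u / 4) = sqrt u / 2.
  by rewrite sqrt_div; [rewrite (_ : 4 = 2 * 2) ?sqrt_square; lra | lra | lra].
by field; lra.
Qed.

(** A map that alters only the colours of points in [s] is at most [2 ^ size s] to one. *)
Lemma sum_recolor (s : seq cpt) F (sg : coloring n -> coloring n) : (forall c, 0 <= F c) ->
  (forall c z, z \notin s -> sg c z = c z) -> \sum_c F (sg c) <= 2 ^ size s * \sum_c F c.
Proof.
elim: s F sg => [|p s IH] F sg hF hs.
  rewrite /= Rmult_1_l; apply: Req_le; apply: eq_bigr => c _; congr F; apply/ffunP => z; exact: hs.
pose F' c := F (recolor c p true) + F (recolor c p false).
pose sg' c := recolor (sg c) p (c p).
have h1 : \sum_c F (sg c) <= \sum_c F' (sg' c).
  apply: rsum_le => c _; rewrite /F'.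
  have e v : recolor (sg' c) p v = recolor (sg c) p v by apply/ffunP => z; rewrite !ffunE; case: eqP.
  have e' : recolor (sg c) p (sg c p) = sg c by apply/ffunP => z; rewrite ffunE; case: eqP => [->|].
  have g1 := hF (recolor (sg c) p true); have g2 := hF (recolor (sg c) p false).
  by rewrite !e -{1}e'; case: (sg c p); lra.
apply: Rle_trans h1 _; apply: Rle_trans (IH F' sg' _ _) _.
- by move=> c; apply: Rplus_le_le_0_compat.
- by move=> c z hz; rewrite ffunE; case: (eqVneq z p) => [->|hzp] //; rewrite hs // inE negb_or hzp.
by rewrite sum_toggle /=; apply: Req_le; ring.
Qed.

Lemma ord_ltF (u v : cpt) : (u < v)%N -> ((u == v) = false) * ((v == u) = false).
Proof. by move=> h; rewrite -!val_eqE /= (ltn_eqF h) (gtn_eqF h). Qed.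

(* Recolouring the four endpoints and the two points following [a] and [e] forces the right
   colours and even gaps; convexity of [(x y)^(-3/2)] then replaces the two colour counts by
   their means. *)
Lemma avg_quad_term col (a p b e q d : cpt) :
  p = a.+1 :> nat -> (p < b)%N -> (b < e)%N -> q = e.+1 :> nat -> (q < d)%N ->
  1 / (16 * PI) * (w32 (INR (e - a) + 3) * w32 (INR (d - b) + 3)) <= avg (quad_term col a b e d).
Proof.
move=> hp pb be hq qd.
have ap : (a < p)%N by rewrite hp.
have eq : (e < q)%N by rewrite hq.
pose ab := ltn_trans ap pb; pose ae := ltn_trans ab be; pose pe := ltn_trans pb be.
pose aq := ltn_trans ae eq; pose ad := ltn_trans aq qd; pose pq := ltn_trans pe eq.
pose pd := ltn_trans pq qd; pose bq := ltn_trans be eq; pose bd := ltn_trans bq qd.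
pose ed := ltn_trans eq qd.
pose ne := (ord_ltF ap, ord_ltF ab, ord_ltF ae, ord_ltF aq, ord_ltF ad, ord_ltF pb, ord_ltF pe,
  ord_ltF pq, ord_ltF pd, ord_ltF be, ord_ltF bq, ord_ltF bd, ord_ltF eq, ord_ltF ed, ord_ltF qd).
pose Z1 := open_itv a e :\ p :\ b; pose Z2 := open_itv b d :\ e :\ q.
(* Among the two intervals, [p] lies only in that of [(a, e)] and [q] only in that of [(b, d)], so
   the two parities are corrected independently. *)
pose v1 c := if odd (color_count Z1 col c) then col else ~~ col.
pose v2 c := if odd (color_count Z2 (~~ col) c) then ~~ col else col.
pose sg c : coloring n := [ffun z => if (z == a) || (z == e) then col else
   if (z == b) || (z == d) then ~~ col else if z == p then v1 c else if z == q then v2 c else c z].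
pose s6 := [:: a; e; b; d; p; q].
have off c z : z \notin s6 -> sg c z = c z.
  by rewrite !inE !negb_or ffunE => /and5P[/negbTE-> /negbTE-> /negbTE-> /negbTE-> /andP[/negbTE-> /negbTE->]].
have bound := sum_recolor (@quad_term_ge0 col a b e d) off.
have eZ1 : open_itv a e = b |: (p |: Z1).
  apply/setP => z; rewrite !inE; case: (eqVneq z b) => [->|] /=; first by rewrite ab be.
  by case: (eqVneq z p) => [->|] //=; rewrite ap pe.
have eZ2 : open_itv b d = q |: (e |: Z2).
  apply/setP => z; rewrite !inE; case: (eqVneq z q) => [->|] /=; first by rewrite bq qd.
  by case: (eqVneq z e) => [->|] //=; rewrite be ed.
have out z : z \in s6 -> (z \notin Z1) && (z \notin Z2).
  rewrite !inE; case/or4P=> [/eqP->|/eqP->|/eqP->|/or3P[/eqP->|/eqP->|/eqP->]];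
    rewrite !ne ?eqxx ?ltnn /= ?andbF //=; move: (ab) (ad) (bq) (qd) (pb) (eq); lia.
have cZ1 c : color_count Z1 col (sg c) = color_count Z1 col c.
  apply: eq_card => z; rewrite !inE; case: (boolP (z \in s6)) => [/out /andP[h _]|/off -> //].
  by move: h; rewrite !inE => /negbTE h; rewrite !andbA in h *; rewrite h.
have cZ2 c : color_count Z2 (~~ col) (sg c) = color_count Z2 (~~ col) c.
  apply: eq_card => z; rewrite !inE; case: (boolP (z \in s6)) => [/out /andP[_ h]|/off -> //].
  by move: h; rewrite !inE => /negbTE h; rewrite !andbA in h *; rewrite h.
have sa c : sg c a = col by rewrite ffunE eqxx.
have se c : sg c e = col by rewrite ffunE eqxx orbT.
have sb c : sg c b = ~~ col by rewrite ffunE !ne eqxx.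
have sd c : sg c d = ~~ col by rewrite ffunE !ne eqxx.
have sp c : sg c p = v1 c by rewrite ffunE !ne eqxx.
have sq c : sg c q = v2 c by rewrite ffunE !ne eqxx.
have c1 c : color_count (open_itv a e) col (sg c) = (odd (color_count Z1 col c) + color_count Z1 col c)%N.
  rewrite eZ1 color_count_add1; last by rewrite !inE eqxx !ne.
  rewrite color_count_add1; last by rewrite !inE eqxx /= andbF.
  rewrite cZ1 sb sp /v1; move: (color_count Z1 col c) => N.
  by case: (odd N); case: (col).
have c2 c : color_count (open_itv b d) (~~ col) (sg c) = (odd (color_count Z2 (~~ col) c) + color_count Z2 (~~ col) c)%N.
  rewrite eZ2 color_count_add1; last by rewrite !inE eqxx !ne.
  rewrite color_count_add1; last by rewrite !inE eqxx /= andbF.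
  rewrite cZ2 se sq /v2; move: (color_count Z2 (~~ col) c) => N.
  by case: (odd N); case: (col).
have P0 := PI_RGT_0; have sP := sqrt_lt_R0 _ P0; have sPP := sqrt_sqrt PI (Rlt_le _ _ P0).
(* With [N] the count in [Z1], the mean of [(N + 3) / 2] is [(#|Z1| + 6) / 4], at most [x0] because
   [#|Z1| + 3 <= e - a]; likewise for [y0]. Hence the tangent plane has mean at least 4 - 3/2 - 3/2
   = 1. *)
set x0 := (INR (e - a) + 3) / 4; set y0 := (INR (d - b) + 3) / 4.
have x00 : 0 < x0 by rewrite /x0; have := pos_INR (e - a); lra.
have y00 : 0 < y0 by rewrite /y0; have := pos_INR (d - b); lra.
have kZ1 : (#|Z1| + 3 <= e - a)%N.
  have : #|open_itv a e| = #|Z1|.+2 by rewrite eZ1 !cardsU1 !inE !eqxx !ne /= ?andbF.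
  have : (#|open_itv a e| <= e - a.+1)%N.
    by apply: (@card_interval _ _ a.+1) => z; rewrite inE; clear; lia.
  by move: (ae); lia.
have kZ2 : (#|Z2| + 3 <= d - b)%N.
  have : #|open_itv b d| = #|Z2|.+2 by rewrite eZ2 !cardsU1 !inE !eqxx !ne /= ?andbF.
  have : (#|open_itv b d| <= d - b.+1)%N.
    by apply: (@card_interval _ _ b.+1) => z; rewrite inE; clear; lia.
  by move: (bd); lia.
pose lin c := 4 - 3 / 2 * ((INR (color_count Z1 col c) + 3) / 2 / x0) - 3 / 2 * ((INR (color_count Z2 (~~ col) c) + 3) / 2 / y0).
have low c : 1 / (16 * PI) * (w32 x0 * w32 y0) * lin c <= quad_term col a b e d (sg c).
  rewrite /quad_term sa se sb sd !eqxx /= c1 c2.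
  have od (m : nat) : ~~ odd (odd m + m) by rewrite oddD oddb addbb.
  have ol (m : nat) : (odd m + m <= m.+1)%N by case: (odd m).
  have n1 := pos_INR (color_count Z1 col c); have n2 := pos_INR (color_count Z2 (~~ col) c).
  have g1 := vlow_ge (od (color_count Z1 col c)) (ol _); have g2 := vlow_ge (od (color_count Z2 (~~ col) c)) (ol _).
  have t1 := @w32_gt0 ((INR (color_count Z1 col c) + 3) / 2) ltac:(lra).
  have t2 := @w32_gt0 ((INR (color_count Z2 (~~ col) c) + 3) / 2) ltac:(lra).
  have tg := @w32_tangent ((INR (color_count Z1 col c) + 3) / 2) ((INR (color_count Z2 (~~ col) c) + 3) / 2) x0 y0
     ltac:(lra) ltac:(lra) x00 y00.
  have u1 : 0 <= w32 ((INR (color_count Z1 col c) + 3) / 2) / (4 * sqrt PI) by apply/Rlt_le/Rdiv_lt_0_compat; lra.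
  have u2 : 0 <= w32 ((INR (color_count Z2 (~~ col) c) + 3) / 2) / (4 * sqrt PI) by apply/Rlt_le/Rdiv_lt_0_compat; lra.
  apply: Rle_trans (Rmult_le_compat _ _ _ _ u1 u2 g1 g2).
  have i0 : 0 <= 1 / (16 * PI) by apply/Rlt_le/Rdiv_lt_0_compat; lra.
  have := Rmult_le_compat_l _ _ _ i0 tg; rewrite -/(lin c) -Rmult_assoc => tg'.
  apply: Rle_trans tg' _; apply: Req_le; rewrite -{1}sPP; field; lra.
have alin : 1 <= avg lin.
  have -> : avg lin = avg (fun c => (4 - 9 / 4 / x0 - 9 / 4 / y0) +
     ((- (3 / 4 / x0)) * INR (color_count Z1 col c) + (- (3 / 4 / y0)) * INR (color_count Z2 (~~ col) c))).
    by rewrite /avg; congr (_ * _); apply: eq_bigr => c _; rewrite /lin; field; lra.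
  rewrite avgD avg_const avgD !avgZ !avg_color_count.
  have k1 : INR #|Z1| <= 4 * x0 - 6.
    by rewrite /x0; have := INR_leq kZ1; rewrite INR_addn /=; lra.
  have k2 : INR #|Z2| <= 4 * y0 - 6.
    by rewrite /y0; have := INR_leq kZ2; rewrite INR_addn /=; lra.
  have i1 := Rinv_0_lt_compat _ x00; have i2 := Rinv_0_lt_compat _ y00.
  have := Rmult_le_compat_l (3 / 8 * / x0) _ _ ltac:(lra) k1.
  have := Rmult_le_compat_l (3 / 8 * / y0) _ _ ltac:(lra) k2.
  have -> : 3 / 8 * / x0 * (4 * x0 - 6) = 3 / 2 - 9 / 4 * / x0 by field; lra.
  have -> : 3 / 8 * / y0 * (4 * y0 - 6) = 3 / 2 - 9 / 4 * / y0 by field; lra.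
  by rewrite /Rdiv; lra.
have e64 : 2 ^ size s6 = 64 by rewrite /=; ring.
rewrite e64 in bound.
have h2 := two_pow_gt0.
have h3 : 1 / (16 * PI) * (w32 x0 * w32 y0) <= 64 * avg (quad_term col a b e d).
  have w0 : 0 <= 1 / (16 * PI) * (w32 x0 * w32 y0).
    apply: Rmult_le_pos; first by apply/Rlt_le/Rdiv_lt_0_compat; lra.
    by apply: Rmult_le_pos; apply/Rlt_le/w32_gt0.
  apply: (@Rle_trans _ (1 / (16 * PI) * (w32 x0 * w32 y0) * avg lin)).
    by rewrite -[X in X <= _]Rmult_1_r; apply: Rmult_le_compat_l.
  rewrite -avgZ -avgZ.
  apply: (@Rle_trans _ (avg (fun c => quad_term col a b e d (sg c)))); first exact: avg_le.
  rewrite avgZ /avg (Rmult_comm 64) Rmult_assoc; apply: Rmult_le_compat_l.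
    exact/Rlt_le/Rinv_0_lt_compat.
  by rewrite Rmult_comm.
(* The two quarters in [x0] and [y0] give 8 * 8, which exactly cancels the 64 lost by recolouring
   six points. *)
move: h3; rewrite /x0 /y0 !w32_quarter; [|by have := pos_INR (d - b); lra|by have := pos_INR (e - a); lra].
lra.
Qed.

End Colorings.

(** * Lower bound for the mean number of short crossings *)

Section ColoredPoints.
Variable n : nat.
Local Notation pt := 'I_(2 * n).
Local Notation cpt := 'I_(2 * n).-1.
Local Notation arc := (pt * pt)%type.
Implicit Types (c : coloring n) (z : cpt) (col : bool).

Lemma red_emb c z : (emb z \in red_pts c) = (c z == true).
Proof. by rewrite inE full_col_emb; case: (c z). Qed.

Lemma blue_emb c z : (emb z \in blue_pts c) = (c z == false).
Proof. by rewrite inE full_col_emb; case: (c z). Qed.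

Lemma disjoint_red_blue c : [disjoint red_pts c & blue_pts c].
Proof. by rewrite disjoint_subset; apply/subsetP => z; rewrite !inE => ->. Qed.

Lemma card_red_blue c : (#|red_pts c| + #|blue_pts c| = 2 * n)%N.
Proof.
rewrite -[RHS]card_ord -(cardsC (red_pts c)); congr addn; apply: eq_card => z; by rewrite !inE.
Qed.

Lemma card_red c : (0 < n)%N -> #|red_pts c| = (color_count setT true c + odd (color_count setT true c))%N.
Proof.
move=> hn.
have -> : color_count setT true c = #|[set j | c j]| by apply: eq_card => z; rewrite !inE; case: (c z).
pose g (i : nat) : bool := match (insub i : option cpt) with
  | Some j => c j | None => odd #|[set j | c j]| end.
have e : #|red_pts c| = \big[addn/0%N]_(0 <= i < 2 * n) g i.
  by rewrite big_mkord -sum1_card big_mkcond /=; apply: eq_bigr => i _; rewrite inE /full_col -/(g i); case: (g i).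
have e2 : (2 * n = (2 * n).-1.+1)%N by lia.
rewrite e [X in (\big[_/_]_(0 <= i < X) _)]e2 big_nat_recr //=; congr addn; last first.
  by rewrite /g insubF // ltnn.
rewrite big_mkord -sum1_card [RHS]big_mkcond /=; apply: eq_bigr => i _.
by rewrite inE /g valK; case: (c i).
Qed.

Lemma red_even c : (0 < n)%N -> #|red_pts c| = (2 * #|red_pts c|./2)%N.
Proof. by move=> hn; rewrite card_red //; lia. Qed.

Lemma blue_even c : (0 < n)%N -> #|blue_pts c| = (2 * #|blue_pts c|./2)%N.
Proof. by move=> hn; have := red_even c hn; have := card_red_blue c; lia. Qed.

Lemma half_red_blue c : (0 < n)%N -> (#|red_pts c|./2 + #|blue_pts c|./2 = n)%N.
Proof. by move=> hn; have := red_even c hn; have := blue_even c hn; have := card_red_blue c; lia. Qed.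

Lemma arc_prob_vlow col c (S : {set pt}) k (x y : cpt) : (forall z, (emb z \in S) = (c z == col)) ->
  #|S| = (2 * k)%N -> (x < y)%N -> c x == col -> c y == col ->
  vlow (color_count (open_itv x y) col c) <= arc_prob S (emb x, emb y).
Proof.
move=> hS hk hxy hx hy; rewrite -(inside_colE x y hS) /arc_prob.
by apply: (prob1_ge hk) => //=; rewrite hS.
Qed.

(** The inner sum is at least 2 (u - v) with [u] and [v] the inverse roots of [y + 6] and
    [Y + y + 6], and (u - v)^2 >= u^2 - 2 u v. The squares [u^2] sum to the logarithm, the cross
    terms to a constant; 36 bounds 4 ln 6 + 16. *)
Lemma square_sum_ge (Y : nat) : (0 < Y)%N ->
  4 * ln (INR Y) - 36 <= \sum_(y < Y) (\sum_(x < Y) w32 (INR x + (INR y + 6))) ^ 2.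
Proof.
move=> hY; have Y0 := INR_gt0 hY; have sY := sqrt_lt_R0 _ Y0.
apply: (@Rle_trans _ (\sum_(y < Y) (4 * (1 / (INR y + 6)) + (- (8 / sqrt (INR Y))) * (1 / sqrt (INR y + 1))))).
  rewrite big_split -(big_distrr 4) -(big_distrr (- (8 / sqrt (INR Y)))) /=.
  have h1 := @harmonic_ge 6 Y ltac:(lra); have h2 := sum_inv_sqrt Y.
  have h3 : ln (INR Y) <= ln (INR Y + 6) by apply: ln_le; lra.
  have h4 := @ln_le_sub 6 ltac:(lra).
  have i0 : 0 < 8 / sqrt (INR Y) by apply: Rdiv_lt_0_compat; lra.
  have h5 := Rmult_le_compat_l _ _ _ (Rlt_le _ _ i0) h2.
  have e5 : 8 / sqrt (INR Y) * (2 * sqrt (INR Y)) = 16 by field; lra.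
  rewrite e5 in h5.
  have h6 := Rmult_le_compat_l 4 _ _ ltac:(lra) h1.
  apply: (@Rle_trans _ (4 * (ln (INR Y + 6) - ln 6) + - 16)); first lra.
  apply: Rplus_le_compat; first exact: h6.
  rewrite Ropp_mult_distr_l_reverse; apply: Ropp_le_contravar; exact: h5.
apply: rsum_le => y _; have hy := pos_INR y.
have h := @sum_w32_ge (INR y + 6) Y ltac:(lra).
set s := \sum_(x < Y) _ in h *.
have u0 := @inv_sqrt_gt0 (INR y + 6) ltac:(lra).
have v0 := @inv_sqrt_gt0 (INR Y + (INR y + 6)) ltac:(lra).
have uu : 1 / sqrt (INR y + 6) * (1 / sqrt (INR y + 6)) = 1 / (INR y + 6).
  have e := sqrt_sqrt (INR y + 6) ltac:(lra); have p := sqrt_lt_R0 (INR y + 6) ltac:(lra).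
  by rewrite -{3}e; field; lra.
have inv_le a b : 0 < a -> a <= b -> 1 / sqrt b <= 1 / sqrt a.
  move=> ha hab; rewrite /Rdiv !Rmult_1_l; apply: Rinv_le_contravar; first exact: sqrt_lt_R0.
  exact: sqrt_le_1_alt.
have uv := inv_le (INR y + 6) (INR Y + (INR y + 6)) ltac:(lra) ltac:(lra).
have u1 := inv_le (INR y + 1) (INR y + 6) ltac:(lra) ltac:(lra).
have v1 := inv_le (INR Y) (INR Y + (INR y + 6)) ltac:(lra) ltac:(lra).
have -> : 8 / sqrt (INR Y) = 8 * (1 / sqrt (INR Y)) by field; lra.
rewrite -uu; move: (1 / sqrt (INR y + 6)) (1 / sqrt (INR Y + (INR y + 6))) (1 / sqrt (INR y + 1))
  (1 / sqrt (INR Y)) u0 v0 uv u1 v1 h => u v u' v' u0 v0 uv u1 v1 h.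
have : u * v <= u' * v' by apply: Rmult_le_compat; lra.
have : (2 * (u - v)) ^ 2 <= s ^ 2 by apply: pow_incr; lra.
nra.
Qed.

(** Quadruples are parametrised by the start [i] and by [x, y, z] with [e - a = x + y + 3] and
    [d - b = y + z + 3]; for fixed [y] the sums over [x] and [z] factor into a square. The span is
    at most [3 Y + 2], and the range of [i] avoids the last point, whose colour is not free. The two
    colours of the first arc turn [1 / (16 PI)] into [1 / (8 PI)]. *)
Lemma avg_mcross_ge (Y : nat) : (0 < Y)%N -> (3 * Y + 3 <= 2 * n)%N ->
  INR (2 * n - (3 * Y + 3)) / (2 * PI) * (ln (INR Y) - 9) <=
  avg (fun c => mcross (3 * Y + 2) (red_pts c) (blue_pts c)).
Proof.
move=> hY hn; have hn0 : (0 < n)%N by lia.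
set M := (2 * n - (3 * Y + 3))%N; set L := (3 * Y + 2)%N.
pose idx := ('I_M * ('I_Y * ('I_Y * 'I_Y)))%type.
have ha (q : idx) : (q.1 < (2 * n).-1)%N by have := ltn_ord q.1; rewrite /M; lia.
have hp (q : idx) : (q.1.+1 < (2 * n).-1)%N by have := ltn_ord q.1; rewrite /M; lia.
have hb (q : idx) : (q.1 + q.2.2.1 + 2 < (2 * n).-1)%N.
  by have := ltn_ord q.1; have := ltn_ord q.2.2.1; rewrite /M; lia.
have he (q : idx) : (q.1 + q.2.2.1 + q.2.1 + 3 < (2 * n).-1)%N.
  by have := ltn_ord q.1; have := ltn_ord q.2.2.1; have := ltn_ord q.2.1; rewrite /M; lia.
have hq (q : idx) : ((q.1 + q.2.2.1 + q.2.1 + 3).+1 < (2 * n).-1)%N.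
  by have := ltn_ord q.1; have := ltn_ord q.2.2.1; have := ltn_ord q.2.1; rewrite /M; lia.
have hd (q : idx) : (q.1 + q.2.2.1 + q.2.1 + q.2.2.2 + 5 < (2 * n).-1)%N.
  by have := ltn_ord q.1; have := ltn_ord q.2.2.1; have := ltn_ord q.2.1; have := ltn_ord q.2.2.2; rewrite /M; lia.
pose a q : cpt := Ordinal (ha q); pose b q : cpt := Ordinal (hb q).
pose e q : cpt := Ordinal (he q); pose d q : cpt := Ordinal (hd q).
pose h1 q : arc * arc := ((emb (a q), emb (e q)), (emb (b q), emb (d q))).
pose h2 q : arc * arc := ((emb (b q), emb (d q)), (emb (a q), emb (e q))).
have inj4 (q q' : idx) : emb (a q) = emb (a q') -> emb (b q) = emb (b q') -> emb (e q) = emb (e q') ->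
    emb (d q) = emb (d q') -> q = q'.
  case: q q' => [i [y [x z]]] [i' [y' [x' z']]] /(congr1 val) /= e1 /(congr1 val) /= e2.
  move=> /(congr1 val) /= e3 /(congr1 val) /= e4.
  have f1 : i = i' by apply: val_inj.
  have f2 : x = x' by apply: val_inj => /=; lia.
  have f3 : y = y' by apply: val_inj => /=; lia.
  have f4 : z = z' by apply: val_inj => /=; lia.
  by rewrite f1 f2 f3 f4.
have low c : \sum_q (quad_term true (a q) (b q) (e q) (d q) c +
                     quad_term false (a q) (b q) (e q) (d q) c) <=
             mcross L (red_pts c) (blue_pts c).
  have nn (A B : arc) : 0 <= arc_prob (red_pts c) A * arc_prob (blue_pts c) B.
    by apply: Rmult_le_pos; exact: prob1_ge0.
  rewrite /mcross pair_big_dep /= (bigID (fun AB : arc * arc => (AB.1.1 < AB.2.1)%N)) /=.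
  rewrite big_split /=; apply: Rplus_le_compat.
    apply: (@Rle_trans _ (\sum_q arc_prob (red_pts c) (h1 q).1 * arc_prob (blue_pts c) (h1 q).2)).
      apply: rsum_le => q _; rewrite /quad_term; case: ifP => [/and4P[q1 q2 q3 q4]|_]; last exact: nn.
      apply: Rmult_le_compat; try exact: vlow_ge0.
        by apply: (arc_prob_vlow (red_emb c) (red_even c hn0)) => //=; lia.
      by apply: (arc_prob_vlow (blue_emb c) (blue_even c hn0)) => //=; lia.
    apply: (@rsum_inj_le _ _ h1 _ (fun AB => arc_prob (red_pts c) AB.1 * arc_prob (blue_pts c) AB.2)).
    - move=> q q' E; apply: inj4; [exact: (congr1 (fun AB : arc * arc => AB.1.1) E) | exact: (congr1 (fun AB : arc * arc => AB.2.1) E) |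
        exact: (congr1 (fun AB : arc * arc => AB.1.2) E) | exact: (congr1 (fun AB : arc * arc => AB.2.2) E)].
    - move=> q; have := ltn_ord q.2.2.1; have := ltn_ord q.2.1; have := ltn_ord q.2.2.2.
      by rewrite /crosses /L /=; lia.
    - by move=> AB _; exact: nn.
  apply: (@Rle_trans _ (\sum_q arc_prob (red_pts c) (h2 q).1 * arc_prob (blue_pts c) (h2 q).2)).
    apply: rsum_le => q _; rewrite /quad_term; case: ifP => [/and4P[q1 q2 q3 q4]|_]; last exact: nn.
    rewrite Rmult_comm; apply: Rmult_le_compat; try exact: vlow_ge0.
      by apply: (arc_prob_vlow (red_emb c) (red_even c hn0)) => //=; lia.
    by apply: (arc_prob_vlow (blue_emb c) (blue_even c hn0)) => //=; lia.
  apply: (@rsum_inj_le _ _ h2 _ (fun AB => arc_prob (red_pts c) AB.1 * arc_prob (blue_pts c) AB.2)).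
  - move=> q q' E; apply: inj4; [exact: (congr1 (fun AB : arc * arc => AB.2.1) E) | exact: (congr1 (fun AB : arc * arc => AB.1.1) E) |
        exact: (congr1 (fun AB : arc * arc => AB.2.2) E) | exact: (congr1 (fun AB : arc * arc => AB.1.2) E)].
  - move=> q; have := ltn_ord q.2.2.1; have := ltn_ord q.2.1; have := ltn_ord q.2.2.2.
    by rewrite /crosses /L /=; lia.
  - by move=> AB _; exact: nn.
apply: Rle_trans (avg_le low).
rewrite avg_sum.
have P0 := PI_RGT_0.
apply: (@Rle_trans _ (\sum_(q : idx) 1 / (8 * PI) *
   (w32 (INR q.2.2.1 + (INR q.2.1 + 6)) * w32 (INR q.2.2.2 + (INR q.2.1 + 6))))); last first.
  apply: rsum_le => q _; rewrite avgD.
  have g col := @avg_quad_term _ col (a q) (Ordinal (hp q)) (b q) (e q) (Ordinal (hq q)) (d q)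
     (erefl _) ltac:(rewrite /=; lia) ltac:(rewrite /=; lia) (erefl _) ltac:(rewrite /=; lia).
  have e1 : INR (e q - a q) + 3 = INR q.2.2.1 + (INR q.2.1 + 6).
    rewrite (_ : (e q - a q)%N = (q.2.2.1 + q.2.1 + 3)%N); last by rewrite /=; lia.
    by rewrite !INR_addn /=; ring.
  have e2 : INR (d q - b q) + 3 = INR q.2.2.2 + (INR q.2.1 + 6).
    rewrite (_ : (d q - b q)%N = (q.2.2.2 + q.2.1 + 3)%N); last by rewrite /=; lia.
    by rewrite !INR_addn /=; ring.
  apply: Rle_trans (Rplus_le_compat _ _ _ _ (g true) (g false)).
  have ee (u v : R) : 1 / (8 * PI) * (u * v) = 1 / (16 * PI) * (u * v) + 1 / (16 * PI) * (u * v) by field; lra.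
  by rewrite e1 e2; apply: Req_le; exact: ee.
rewrite -(pair_bigA _ (fun (i : 'I_M) (q : 'I_Y * ('I_Y * 'I_Y)) => 1 / (8 * PI) *
   (w32 (INR q.2.1 + (INR q.1 + 6)) * w32 (INR q.2.2 + (INR q.1 + 6))))) /=.
rewrite rsum_const card_ord.
rewrite -(pair_bigA _ (fun (y : 'I_Y) (q : 'I_Y * 'I_Y) => 1 / (8 * PI) *
   (w32 (INR q.1 + (INR y + 6)) * w32 (INR q.2 + (INR y + 6))))) /=.
have sq := square_sum_ge hY.
rewrite (eq_bigr (fun y : 'I_Y => 1 / (8 * PI) * (\sum_(x < Y) w32 (INR x + (INR y + 6))) ^ 2)); last first.
  move=> y _; rewrite -(pair_bigA _ (fun (x z : 'I_Y) => 1 / (8 * PI) *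
   (w32 (INR x + (INR y + 6)) * w32 (INR z + (INR y + 6))))) /=.
  rewrite Rmult_1_r big_distrl big_distrr /=; apply: eq_bigr => x _.
  by rewrite big_distrr /= big_distrr.
rewrite -(big_distrr (1 / (8 * PI))) /=.
have M0 := pos_INR M.
have i0 : 0 <= 1 / (8 * PI) by apply/Rlt_le/Rdiv_lt_0_compat; lra.
apply: (@Rle_trans _ (INR M * (1 / (8 * PI) * (4 * ln (INR Y) - 36)))).
  by apply: Req_le; field; lra.
by apply: Rmult_le_compat_l => //; apply: Rmult_le_compat_l.
Qed.

End ColoredPoints.

(** * Expectations over the whole model *)

Section Expectation.
Variable n : nat.
Local Notation pt := 'I_(2 * n).
Local Notation cpt := 'I_(2 * n).-1.
Local Notation arc := (pt * pt)%type.
Local Notation mt := {set {set pt}}.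
Implicit Types (c : coloring n) (P PR PB : mt) (F G : coloring n -> mt -> mt -> R).

(** Each colour has at least a quarter of the points, so arcs of span of order [n / K] are short for
    both colours. *)
Definition balanced c : bool := (n <= 2 * #|red_pts c|)%N && (n <= 2 * #|blue_pts c|)%N.

Lemma avg_variance :
  avg (fun c => (INR (color_count setT true c) - INR (2 * n).-1 / 2) ^ 2) = INR (2 * n).-1 / 4.
Proof.
pose s (z : cpt) c : R := if c z then 1 / 2 else - (1 / 2).
have e c : (INR (color_count setT true c) - INR (2 * n).-1 / 2) ^ 2 = \sum_z \sum_z' s z c * s z' c.
  have -> : INR (color_count setT true c) - INR (2 * n).-1 / 2 = \sum_z s z c.
    rewrite INR_color_count (_ : INR (2 * n).-1 / 2 = \sum_(z : cpt) (1 / 2)); last first.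
      by rewrite rsum_const card_ord; field.
    rewrite (_ : \sum_(z in setT) (if c z == true then 1 else 0) = \sum_z (s z c + 1 / 2)).
      by rewrite big_split /=; set u := \sum_z s z c; set v := \sum_(z : cpt) (1 / 2); ring.
    apply: eq_big => [z|z _]; first by rewrite inE.
    by rewrite /s; case: (c z) => /=; lra.
  rewrite -Rsqr_pow2 /Rsqr big_distrl /=; apply: eq_bigr => z _; by rewrite big_distrr.
transitivity (avg (fun c => \sum_z \sum_z' s z c * s z' c)).
  by rewrite /avg; congr (_ * _); apply: eq_bigr => c _; exact: e.
rewrite avg_sum (eq_bigr (fun _ : cpt => 1 / 4)); first by rewrite rsum_const card_ord; field.
move=> z _; rewrite avg_sum (bigD1 z) //= big1 ?Rplus_0_r.
  rewrite -[RHS](avg_const n) /avg; congr (_ * _); apply: eq_bigr => c _.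
  by rewrite /s; case: (c z); field.
(* Off-diagonal terms cancel in pairs when the colour of [z] is flipped. *)
move=> z' hz'; rewrite /avg.
have := sum_toggle (fun c => s z c * s z' c) z.
rewrite big1 => [|c _]; last first.
  by rewrite /s !ffunE eqxx (negbTE hz'); case: (c z'); ring.
move=> h; rewrite (_ : \sum_c s z c * s z' c = 0); [ring | move: h; set u := \sum_c _; lra].
Qed.

(** Chebyshev's inequality: in an unbalanced colouring the number of red points among the first
    [2 n - 1] deviates by at least [(n - 1) / 2] from its mean. *)
Lemma prob_unbalanced : (1 < n)%N -> avg (fun c => if balanced c then 0 else 1) <= 8 / INR n.
Proof.
move=> hn; have n2 : 2 <= INR n by apply: (@INR_leq 2).
have e2 : INR (2 * n).-1 = 2 * INR n - 1.
  by rewrite -subn1 -minusE minus_INR ?INR_muln /=; [ring | apply/leP; lia].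
apply: (@Rle_trans _ (4 / (INR n - 1) ^ 2 * (INR (2 * n).-1 / 4))); last first.
  rewrite e2 (_ : 4 / (INR n - 1) ^ 2 * ((2 * INR n - 1) / 4) = (2 * INR n - 1) / (INR n - 1) ^ 2); last by field; lra.
  apply (Rle_div_l _ _ ((INR n - 1) ^ 2)); first nra.
  rewrite (_ : 8 / INR n * (INR n - 1) ^ 2 = 8 * (INR n - 1) ^ 2 / INR n); last by field; lra.
  apply (Rle_div_r _ _ (INR n)); nra.
rewrite -avg_variance -avgZ; apply: avg_le => c.
have q0 : 0 < 4 / (INR n - 1) ^ 2 by apply: Rdiv_lt_0_compat; nra.
case: (boolP (balanced c)) => hb; first by apply: Rmult_le_pos; [lra | exact: pow2_ge_0].
have n0 : (0 < n)%N by lia.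
have h1 := card_red c n0; have h2 := card_red_blue c.
apply: (@Rle_trans _ (4 / (INR n - 1) ^ 2 * ((INR n - 1) / 2) ^ 2)); first by apply: Req_le; field; lra.
apply: Rmult_le_compat_l; first lra.
rewrite e2; set r := color_count setT true c in h1 *.
have [h|h] : (2 * r <= n)%N \/ (3 * n <= 2 * r + 2)%N.
  move: hb; rewrite /balanced negb_and -!ltnNge h1 => /orP[] hh; [left | right].
    by clear -hh; lia.
  by clear -hh h1 h2; lia.
- have := INR_leq h; rewrite INR_muln /= => h'; nra.
- have := INR_leq h; rewrite INR_addn !INR_muln /= => h'; nra.
Qed.

Definition avgCP F : R :=
  avg (fun c => avgM (red_pts c) (fun PR => avgM (blue_pts c) (fun PB => F c PR PB))).

Lemma expectE (X : mt -> mt -> R) : expect X = avgCP (fun _ => X).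
Proof.
rewrite /expect /avgCP /avg big_distrr /=; apply: eq_bigr => c _.
rewrite /avgM -/(ncat (red_pts c)) -/(ncat (blue_pts c)) -big_distrr /=; ring.
Qed.

Lemma avgCP_le F G : (forall c PR PB, PR \in catalan_matchings (red_pts c) ->
  PB \in catalan_matchings (blue_pts c) -> F c PR PB <= G c PR PB) -> avgCP F <= avgCP G.
Proof.
by move=> h; apply: avg_le => c; apply: avgM_le => PR hR; apply: avgM_le => PB hB; exact: h.
Qed.

Lemma avgCP_eq F G : (forall c PR PB, PR \in catalan_matchings (red_pts c) ->
  PB \in catalan_matchings (blue_pts c) -> F c PR PB = G c PR PB) -> avgCP F = avgCP G.
Proof.
by move=> h; apply: Rle_antisym; apply: avgCP_le => c PR PB hR hB; rewrite h //; exact: Rle_refl.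
Qed.

Lemma avgCP_affine F1 F2 F3 k0 k1 k2 k3 : (0 < n)%N ->
  avgCP (fun c PR PB => k0 + (k1 * F1 c PR PB + (k2 * F2 c PR PB + k3 * F3 c PR PB))) =
  k0 + (k1 * avgCP F1 + (k2 * avgCP F2 + k3 * avgCP F3)).
Proof.
move=> hn; rewrite /avgCP -!avgZ -!avgD -{2}[k0](avg_const n) -avgD.
rewrite /avg; congr (_ * _); apply: eq_bigr => c _.
transitivity (avgM (red_pts c) (fun PR => k0 + (k1 * avgM (blue_pts c) (F1 c PR) +
   (k2 * avgM (blue_pts c) (F2 c PR) + k3 * avgM (blue_pts c) (F3 c PR))))).
  by apply: avgM_eq => PR _; rewrite !avgMD !avgMZ (avgM_const _ (blue_even c hn)).
by rewrite !avgMD !avgMZ (avgM_const _ (red_even c hn)).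
Qed.

Lemma ncross_mono L L' P P' : (L <= L')%N -> ncross L P P' <= ncross L' P P'.
Proof.
move=> hL; apply: rsum_le => A _; apply: rsum_sub => [B|B _].
  by rewrite /crosses; lia.
by apply: Rmult_le_pos; exact: arc_ind_ge0.
Qed.

Lemma ncross_ge0 L P P' : 0 <= ncross L P P'.
Proof. by apply: rsum_ge0 => A _; apply: rsum_ge0 => B _; apply: Rmult_le_pos; exact: arc_ind_ge0. Qed.

(** [edges] orders a pair of arcs by position, [ncross] by colour, and [h] translates. Arcs of one
    colour never alternate and no arc has both colours, so nothing is lost or counted twice; a span
    bound of [2 * n] excludes no pair. *)
Lemma edgesE c PR PB : PR \in catalan_matchings (red_pts c) ->
  PB \in catalan_matchings (blue_pts c) -> INR (edges PR PB) = ncross (2 * n) PR PB.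
Proof.
rewrite !inE => hR hB.
have disj (X : {set pt}) : X \in PR -> X \in PB -> False.
  move=> h1 h2; case/catalan_matchingP: (hR) => /(_ _ h1) [x [y [_ hx _ e]]] _ _ _.
  have : x \in blue_pts c by apply: (catalan_sub hB h2); rewrite e mem_arc eqxx.
  by move: hx; rewrite !inE => ->.
pose E1 := [set AB : arc * arc | [&& crosses (2 * n) AB.1 AB.2, [set AB.1.1; AB.1.2] \in PR & [set AB.2.1; AB.2.2] \in PB]].
have e1 : ncross (2 * n) PR PB = INR #|E1|.
  rewrite /ncross pair_big_dep /= -[INR #|E1|]Rmult_1_r -rsum_const [LHS]big_mkcond [RHS]big_mkcond /=.
  apply: eq_bigr => AB _; rewrite inE /arc_in /arc_ind.
  by case: (crosses _ _ _) => //=; case: ifP => _; case: ifP => _ /=; ring.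
pose h (AB : arc * arc) := if (AB.1.1 < AB.2.1)%N then ([set AB.1.1; AB.1.2], [set AB.2.1; AB.2.2])
   else ([set AB.2.1; AB.2.2], [set AB.1.1; AB.1.2]).
have crlt (A B : arc) : crosses (2 * n) A B -> (A.1 < A.2)%N /\ (B.1 < B.2)%N by case/crosses_short.
have hinj : {in E1 &, injective h}.
  move=> [[x y] [b d]] [[x' y'] [b' d']]; rewrite !inE /= => /and3P[/crlt /= [l1 l2] r1 r2] /and3P[/crlt /= [l3 l4] r3 r4].
  rewrite /h /=; case: ifP => _; case: ifP => _ [q1 q2].
  - by have [-> ->] := arc_inj l1 l3 q1; have [-> ->] := arc_inj l2 l4 q2.
  - by case: (disj [set x; y]) => //; rewrite q1.
  - by case: (disj [set b; d]) => //; rewrite q1.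
  - by have [-> ->] := arc_inj l1 l3 q2; have [-> ->] := arc_inj l2 l4 q1.
rewrite e1 -(card_in_imset hinj) /edges; congr INR; apply: eq_card => -[X Y].
rewrite !inE /=; apply/idP/imsetP => [/and3P[hX hY]|].
  move=> /existsP[a /existsP[b /existsP[e /existsP[d /and5P[hab hbc hcd /eqP eX /eqP eY]]]]].
  case/catalan_matchingP: (hR) => _ _ _ nR; case/catalan_matchingP: (hB) => _ _ _ nB.
  have hd := ltn_ord d.
  rewrite eX eY in hX hY *.
  case/orP: hX => hX; case/orP: hY => hY.
  - by case: (nR a b e d).
  - exists ((a, e), (b, d)); last by rewrite /h /= hab.
    by rewrite inE /= hX hY /crosses /= hab hbc hcd; move: hd; clear; lia.
  - exists ((b, d), (a, e)); last by rewrite /h /= ifF //; move: hab; clear; lia.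
    by rewrite inE /= hX hY /crosses /= hab hbc hcd; move: hd; clear; lia.
  - by case: (nB a b e d).
move=> [[[x y] [b d]]]; rewrite inE /= => /and3P[hcr h1 h2].
have alt_of (a b' e d' : pt) : (a < b')%N -> (b' < e)%N -> (e < d')%N -> alt [set a; e] [set b'; d'].
  move=> u1 u2 u3; apply/existsP; exists a; apply/existsP; exists b'; apply/existsP; exists e.
  by apply/existsP; exists d'; rewrite u1 u2 u3 !eqxx.
rewrite /h /=; case: ifP => hlt [-> ->]; rewrite h1 h2 ?orbT /=; apply: alt_of; move: hcr hlt; rewrite /crosses /=; clear; lia.
Qed.

Definition Xshort (L : nat) c PR PB : R := if balanced c then ncross L PR PB else 0.

Lemma avgCP_edges_le : (0 < n)%N ->
  avgCP (fun _ PR PB => INR (edges PR PB)) <= / PI * INR n * ln (INR n) + 149 * INR n.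
Proof.
move=> hn; rewrite (avgCP_eq (G := fun _ => ncross (2 * n))); last by move=> c PR PB; exact: edgesE.
rewrite -[X in _ <= X](avg_const n); apply: avg_le => c; rewrite avgM_ncross.
exact: (mcross_le _ hn (disjoint_red_blue c) (red_even c hn) (blue_even c hn) (half_red_blue c hn)).
Qed.

Lemma Xshort_le_edges L c PR PB : (L <= 2 * n)%N -> PR \in catalan_matchings (red_pts c) ->
  PB \in catalan_matchings (blue_pts c) -> 0 <= Xshort L c PR PB <= INR (edges PR PB).
Proof.
move=> hL hR hB; rewrite (edgesE hR hB) /Xshort; have := ncross_ge0 (2 * n) PR PB.
have := ncross_ge0 L PR PB; have := ncross_mono PR PB hL.
by case: ifP => _; lra.
Qed.

(** Discarding unbalanced colourings costs at most their probability times the uniform bound on the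
    conditional mean. *)
Lemma avgCP_Xshort_ge Y : (1 < n)%N -> (0 < Y)%N -> (3 * Y + 3 <= 2 * n)%N -> 0 <= ln (INR n) ->
  INR (2 * n - (3 * Y + 3)) / (2 * PI) * (ln (INR Y) - 9) -
    (/ PI * INR n * ln (INR n) + 149 * INR n) * (8 / INR n) <= avgCP (Xshort (3 * Y + 2)).
Proof.
move=> hn hY hYn hl; have n0 : (0 < n)%N by lia.
set B := / PI * INR n * ln (INR n) + 149 * INR n; set L := (3 * Y + 2)%N.
have P0 := PI_RGT_0; have n0' := INR_gt0 n0.
have B0 : 0 <= B.
  have : 0 <= / PI * INR n * ln (INR n).
    by apply: Rmult_le_pos => //; apply: Rmult_le_pos; [exact/Rlt_le/Rinv_0_lt_compat | lra].
  rewrite /B; lra.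
have h1 := avg_mcross_ge hY hYn; rewrite -/L in h1.
have h2 := Rmult_le_compat_l _ _ _ B0 (prob_unbalanced hn).
have h3 : avg (fun c => mcross L (red_pts c) (blue_pts c)) <=
   avgCP (Xshort L) + B * avg (fun c => if balanced c then 0 else 1).
  rewrite /avgCP -avgZ -avgD; apply: avg_le => c; rewrite /Xshort.
  have hm := @mcross_le n L _ _ _ _ n0 (disjoint_red_blue c) (red_even c n0) (blue_even c n0) (half_red_blue c n0).
  case: (balanced c); first by rewrite avgM_ncross Rmult_0_r Rplus_0_r; exact: Rle_refl.
  rewrite (avgM_eq (G := fun _ => 0)); last by move=> PR _; exact: avgM0.
  by rewrite avgM0 Rplus_0_l Rmult_1_r.
lra.
Qed.

(** On balanced colourings [12 L + 12 <= n] yields [3 (L + 1) <= k] for both colours. The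
    conditional mean is replaced by its uniform bound, so averaging over colourings is trivial;
    601920 = 2 * 300960, one overlap term per colour. *)
Lemma avgCP_Xshort_sqr L rho : (1 < n)%N -> (0 < L)%N -> (12 * L + 12 <= n)%N -> 0 <= ln (INR n) ->
  (forall k, (n <= 4 * k)%N -> ((INR k + 1) / (INR (k - L.+2) + 1)) ^ 2 <= rho) ->
  avgCP (fun c PR PB => Xshort L c PR PB ^ 2) <=
  rho ^ 2 * (/ PI * INR n * ln (INR n) + 149 * INR n) ^ 2 +
  601920 * INR n * INR L * (1 + ln (INR (2 * n))).
Proof.
move=> hn hL hLn hl hrho; have n0 : (0 < n)%N by lia.
set B := / PI * INR n * ln (INR n) + 149 * INR n.
have hH : 0 <= ln (INR (2 * n)) by rewrite -ln_1; apply: ln_le; [lra | apply: (@INR_leq 1); lia].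
have n0' := pos_INR n; have L0' := pos_INR L.
have H0 : 0 <= 601920 * INR n * INR L * (1 + ln (INR (2 * n))).
  by apply: Rmult_le_pos; [apply: Rmult_le_pos; lra | lra].
have B0 : 0 <= rho ^ 2 * B ^ 2 by apply: Rmult_le_pos; exact: pow2_ge_0.
rewrite -[X in _ <= X](avg_const n); apply: avg_le => c; rewrite /Xshort.
case: (boolP (balanced c)) => hb; last first.
  rewrite (avgM_eq (G := fun _ => 0)); first by rewrite avgM0; lra.
  by move=> PR _; rewrite (avgM_eq (G := fun _ => 0)) ?avgM0 // => PB _; ring.
have hr := red_even c n0; have hbl := blue_even c n0; have hh := half_red_blue c n0.
have hdj := disjoint_red_blue c.
case/andP: hb => b1 b2.
set k := #|red_pts c|./2 in hr hh; set m := #|blue_pts c|./2 in hbl hh.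
have k4 : (n <= 4 * k)%N by rewrite hr in b1; clear -b1; lia.
have m4 : (n <= 4 * m)%N by rewrite hbl in b2; clear -b2; lia.
have Lk : (3 * L.+1 < k.+1)%N by clear -k4 hLn; lia.
have Lm : (3 * L.+1 < m.+1)%N by clear -m4 hLn; lia.
have M := second_moment (L := L) hr hbl ltac:(clear -Lk; lia) ltac:(clear -Lm; lia) (hrho _ k4) (hrho _ m4).
have R1 := overlap_le n0 hdj hr hbl hh hL ltac:(clear -Lk; lia) ltac:(clear -Lm; lia).
have hdj' : [disjoint blue_pts c & red_pts c] by rewrite disjoint_sym.
have hh' : (m + k = n)%N by rewrite addnC.
have R2 := overlap_le n0 hdj' hbl hr hh' hL ltac:(clear -Lm; lia) ltac:(clear -Lk; lia).
have U := @mcross_le n L _ _ _ _ n0 hdj hr hbl hh; rewrite -/B in U.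
have U0 : 0 <= mcross L (red_pts c) (blue_pts c).
  by apply: rsum_ge0 => A _; apply: rsum_ge0 => B' _; apply: Rmult_le_pos; exact: prob1_ge0.
have U2 : rho ^ 2 * mcross L (red_pts c) (blue_pts c) ^ 2 <= rho ^ 2 * B ^ 2.
  by apply: Rmult_le_compat_l; [exact: pow2_ge_0 | apply: pow_incr].
apply: Rle_trans M _; lra.
Qed.

End Expectation.

(** * Choice of parameters and conclusion *)

Lemma nat_above (x : R) : exists N : nat, x <= INR N.
Proof. by have [N hN] := INR_unbounded x; exists N; lra. Qed.

(** Numerator and denominator differ by [3 Y + 4 <= 7 Y], while the denominator is at least
    [K Y / 8]; 56 = 7 * 8. *)
Lemma ratio_le (k Y K : nat) : (128 <= K)%N -> (0 < Y)%N -> (K * Y <= 4 * k)%N ->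
  (INR k + 1) / (INR (k - (3 * Y + 2).+2) + 1) <= 1 + 56 / INR K.
Proof.
move=> hK hY hk.
have K0 : 128 <= INR K by have := INR_leq hK; rewrite (_ : INR 128 = 128) // INR_IZR_INZ.
have Y1 : 1 <= INR Y by apply: (@INR_leq 1).
have hk' : INR K * INR Y <= 4 * INR k by have := INR_leq hk; rewrite !INR_muln /=; lra.
have e : INR (k - (3 * Y + 2).+2) = INR k - 3 * INR Y - 4.
  rewrite -minusE minus_INR; last by apply/leP; nia.
  by rewrite !S_INR INR_addn INR_muln /=; ring.
rewrite e.
have hlow : INR K * INR Y / 8 <= INR k - 3 * INR Y - 4 + 1 by nra.
have pos : 0 < INR K * INR Y / 8 by nra.
apply (Rle_div_l _ _ (INR k - 3 * INR Y - 4 + 1)); first lra.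
have : 56 / INR K * (INR K * INR Y / 8) <= 56 / INR K * (INR k - 3 * INR Y - 4 + 1).
  by apply: Rmult_le_compat_l => //; apply/Rlt_le/Rdiv_lt_0_compat; lra.
have -> : 56 / INR K * (INR K * INR Y / 8) = 7 * INR Y by field; lra.
lra.
Qed.

Lemma main_bounds (de : R) : 0 < de -> de <= 1 -> exists n0 : nat, forall n, (n0 <= n)%N ->
  [/\ (1 < n)%N, 1 <= ln (INR n),
    avgCP (fun _ PR PB => INR (@edges n PR PB)) <= / PI * INR n * ln (INR n) + de * (INR n * ln (INR n)) &
    exists L, [/\ (L <= 2 * n)%N,
      / PI * INR n * ln (INR n) - de * (INR n * ln (INR n)) <= avgCP (@Xshort n L) &
      avgCP (fun c PR PB => @Xshort n L c PR PB ^ 2) <=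
        (/ PI * INR n * ln (INR n)) ^ 2 + de * (INR n * ln (INR n)) ^ 2]].
Proof.
move=> de0 de1.
(* 1680 = 30 * 56, so that [x = 56 / K] satisfies [15 x <= de / 2]; the summand 128 makes
   [12 L + 12 <= n] and [ratio_le] available. *)
have [K hK] := nat_above (1680 / de + 128).
have q0 : 0 < 1680 / de by apply: Rdiv_lt_0_compat; lra.
have K128 : 128 <= INR K by lra.
have K128' : (128 <= K)%N.
  by apply/leP; apply: INR_le; rewrite (_ : INR 128 = 128) // INR_IZR_INZ.
have hKd : 1680 / INR K <= de.
  apply (Rle_div_l _ _ (INR K)); first lra.
  have e : de * (1680 / de) = 1680 by field; lra.
  nra.
have lK : 0 <= ln (2 * INR K) by rewrite -ln_1; apply: ln_le; lra.
(* A lower bound for [ln n] absorbing both errors: 3680000 exceeds twice the coefficient 1839509 of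
   n^2 ln n in the second moment, and [ln (2 K) + 1209] is the coefficient of [n] lost in the lower
   bound for the mean, where 1209 = 9 + 1200. *)
pose La := (3680000 + 2 * (ln (2 * INR K) + 1209)) / de.
have hLa : de * La = 3680000 + 2 * (ln (2 * INR K) + 1209) by rewrite /La; field; lra.
have [N hN] := nat_above (exp La).
exists (N + K)%N => n hn.
have nK : (K <= n)%N by lia.
have n1 : (1 < n)%N by lia.
have n0 : (0 < n)%N by lia.
have nn : 2 <= INR n by apply: (@INR_leq 2).
have nN : exp La <= INR n by apply: Rle_trans hN _; apply: INR_leq; lia.
set l := ln (INR n).
have lL : La <= l.
  by rewrite -(ln_exp La); apply: ln_le => //; exact: exp_pos.
have dl : 3680000 + 2 * (ln (2 * INR K) + 1209) <= de * l by rewrite -hLa; apply: Rmult_le_compat_l; lra.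
have l1 : 3680000 <= l by nra.
have ln_n : l <= INR n by have := @ln_le_sub (INR n) ltac:(lra); rewrite -/l; lra.
have P3 := PI_ge3.
have iP : 0 < / PI by apply: Rinv_0_lt_compat; lra.
have iP1 : / PI <= 1 by rewrite -Rinv_1; apply: Rinv_le_contravar; lra.
set Mn := / PI * INR n * l.
have nl0 : 0 < INR n * l by nra.
have M0 : 0 <= Mn by rewrite /Mn Rmult_assoc; apply: Rmult_le_pos; lra.
have M1 : Mn <= INR n * l by rewrite /Mn Rmult_assoc; nra.
split => //; first lra.
  apply: Rle_trans (avgCP_edges_le n0) _; rewrite -/l -/Mn; apply: Rplus_le_compat_l.
  have := Rmult_le_compat_l (INR n) 149 (de * l) ltac:(lra) ltac:(lra); lra.
pose Y := (n %/ K)%N.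
have Y0 : (0 < Y)%N by rewrite divn_gt0 //; lia.
have YK : (K * Y <= n)%N by rewrite mulnC leq_trunc_div.
have YK2 : (n <= 2 * K * Y)%N by have := @ltn_ceil n K ltac:(lia); rewrite -/Y; nia.
have Y1 : 1 <= INR Y by apply: (@INR_leq 1).
have rYK : INR K * INR Y <= INR n by rewrite -INR_muln; apply: INR_leq.
have rYK2 : INR n <= 2 * INR K * INR Y by have := INR_leq YK2; rewrite !INR_muln /=; lra.
have Y128 : (128 * Y <= n)%N by nia.
exists (3 * Y + 2)%N; split; first by clear -Y128 Y0; lia.
- have h3 : (3 * Y + 3 <= 2 * n)%N by clear -Y128 Y0; lia.
  apply: Rle_trans (avgCP_Xshort_ge n1 Y0 h3 _); last by rewrite -/l; lra.
  rewrite -/l -/Mn.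
  have eA : INR (2 * n - (3 * Y + 3)) = 2 * INR n - 3 * INR Y - 3.
    rewrite -minusE minus_INR; last by apply/leP.
    by rewrite INR_addn !INR_muln /=; ring.
  have lY : l - ln (2 * INR K) <= ln (INR Y).
    have : ln (INR n) <= ln (2 * INR K * INR Y) by apply: ln_le; lra.
    rewrite ln_mult; try lra; rewrite -/l; lra.
  have Yn : 3 / INR K * INR n >= 3 * INR Y.
    have -> : 3 / INR K * INR n = 3 * (INR n / INR K) by field; lra.
    have : INR Y <= INR n / INR K by apply (Rle_div_r _ _ (INR K)); lra.
    lra.
  have kd : 3 / INR K <= de / 2.
    have -> : 3 / INR K = 3 / 1680 * (1680 / INR K) by field; lra.
    have : 0 < 1680 / INR K by apply: Rdiv_lt_0_compat; lra.
    lra.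
  have kn0 : 0 < 3 / INR K by apply: Rdiv_lt_0_compat; lra.
  have hA : INR n - 3 / INR K * INR n <= (2 * INR n - 3 * INR Y - 3) / 2 by lra.
  have pos2 : 0 <= l - ln (2 * INR K) - 9 by nra.
  have s1 : (INR n - 3 / INR K * INR n) * (l - ln (2 * INR K) - 9) <=
     (2 * INR n - 3 * INR Y - 3) / 2 * (ln (INR Y) - 9).
    apply: (@Rle_trans _ ((2 * INR n - 3 * INR Y - 3) / 2 * (l - ln (2 * INR K) - 9))).
      exact: Rmult_le_compat_r.
    apply: Rmult_le_compat_l; last lra.
    have : 128 * INR Y <= INR n by nra.
    lra.
  have s2 : INR n * l - (de / 2 * (INR n * l) + INR n * (ln (2 * INR K) + 9)) <=
     (INR n - 3 / INR K * INR n) * (l - ln (2 * INR K) - 9).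
    have t1 : 3 / INR K * (INR n * l) <= de / 2 * (INR n * l) by apply: Rmult_le_compat_r; lra.
    have t2 : 0 <= 3 / INR K * INR n * (ln (2 * INR K) + 9) by apply: Rmult_le_pos; nra.
    lra.
  have s3 : Mn - (de / 2 * (INR n * l) + INR n * (ln (2 * INR K) + 9)) <=
     INR (2 * n - (3 * Y + 3)) / (2 * PI) * (ln (INR Y) - 9).
    rewrite eA.
    have -> : (2 * INR n - 3 * INR Y - 3) / (2 * PI) * (ln (INR Y) - 9) =
      / PI * ((2 * INR n - 3 * INR Y - 3) / 2 * (ln (INR Y) - 9)) by field; lra.
    have := Rmult_le_compat_l _ _ _ (Rlt_le _ _ iP) (Rle_trans _ _ _ s2 s1).
    have z0 : 0 <= de / 2 * (INR n * l) + INR n * (ln (2 * INR K) + 9).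
      by apply: Rplus_le_le_0_compat; apply: Rmult_le_pos; lra.
    have := Rmult_le_compat_r _ _ _ z0 iP1.
    rewrite /Mn; lra.
  have s4 : (Mn + 149 * INR n) * (8 / INR n) <= 1200 * INR n.
    have -> : (Mn + 149 * INR n) * (8 / INR n) = 8 * (/ PI * l) + 1192 by rewrite /Mn; field; lra.
    have : / PI * l <= 1 * l by apply: Rmult_le_compat_r; lra.
    lra.
  have s5 := Rmult_le_compat_l (INR n) (ln (2 * INR K) + 1209) (de / 2 * l) ltac:(lra) ltac:(lra).
  lra.
- have L0 : (0 < 3 * Y + 2)%N by lia.
  have hL : (12 * (3 * Y + 2) + 12 <= n)%N by clear -Y128 Y0; lia.
  set x := 56 / INR K.
  have x0 : 0 < x by apply: Rdiv_lt_0_compat; lra.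
  have xd : 15 * x <= de / 2.
    have -> : x = 56 / 1680 * (1680 / INR K) by rewrite /x; field; lra.
    lra.
  have hr k : (n <= 4 * k)%N -> ((INR k + 1) / (INR (k - (3 * Y + 2).+2) + 1)) ^ 2 <= (1 + x) ^ 2.
    move=> hk; apply: pow_incr; split; last by apply: ratio_le => //; lia.
    by apply/Rlt_le/Rdiv_lt_0_compat; [have := pos_INR k; lra | have := pos_INR (k - (3 * Y + 2).+2); lra].
  apply: Rle_trans (avgCP_Xshort_sqr n1 L0 hL _ hr) _; first by rewrite -/l; lra.
  rewrite -/l -/Mn.
  (* By convexity the fourth power lies below its chord over [0, 1], of slope 2^4 - 1 = 15. *)
  have hx : ((1 + x) ^ 2) ^ 2 <= 1 + 15 * x by nra.
  have lnn2 : ln (INR (2 * n)) <= 1 + l.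
    rewrite INR_muln ln_mult ?[INR 2]/=; try lra.
    have := @ln_le_sub 2 ltac:(lra); rewrite (_ : 1 + 1 = 2) -/l; lra.
  have rL : INR (3 * Y + 2) <= INR n by apply: INR_leq; clear -Y128 Y0; lia.
  have rL0 := pos_INR (3 * Y + 2).
  have nn0 : 0 <= INR n * INR n by nra.
  have t1 : 601920 * INR n * INR (3 * Y + 2) * (1 + ln (INR (2 * n))) <= 1805760 * (INR n * INR n * l).
    apply: (@Rle_trans _ (601920 * INR n * INR n * (3 * l))); last lra.
    have ln0 : 0 <= ln (INR (2 * n)) by rewrite -ln_1; apply: ln_le; [lra | apply: (@INR_leq 1); lia].
    apply: Rmult_le_compat; [|lra | | lra].
      by apply: Rmult_le_pos; lra.
    by apply: Rmult_le_compat_l; lra.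
  have t2 : ((1 + x) ^ 2) ^ 2 * (Mn + 149 * INR n) ^ 2 <= (1 + de / 2) * (Mn + 149 * INR n) ^ 2.
    by apply: Rmult_le_compat_r; [exact: pow2_ge_0 | lra].
  have t3 : (Mn + 149 * INR n) ^ 2 <= Mn ^ 2 + 22499 * (INR n * INR n * l).
    have r1 : Mn * INR n <= INR n * INR n * l by nra.
    have r2 : INR n * INR n * 1 <= INR n * INR n * l by apply: Rmult_le_compat_l; lra.
    lra.
  have nnl : 0 <= INR n * INR n * l by nra.
  have t4 : (1 + de / 2) * (Mn + 149 * INR n) ^ 2 <= Mn ^ 2 + de / 2 * Mn ^ 2 + 33749 * (INR n * INR n * l).
    have u := Rmult_le_compat_l (1 + de / 2) _ _ ltac:(lra) t3.
    have v : (1 + de / 2) * (22499 * (INR n * INR n * l)) <= 3 / 2 * (22499 * (INR n * INR n * l)).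
      by apply: Rmult_le_compat_r; lra.
    lra.
  have t5 : de / 2 * Mn ^ 2 <= de / 2 * (INR n * l) ^ 2.
    by apply: Rmult_le_compat_l; [lra | apply: pow_incr].
  have t6 : 1839509 * (INR n * INR n * l) <= de / 2 * (INR n * l) ^ 2.
    have u := Rmult_le_compat_l (INR n * INR n * l) 1839509 (de / 2 * l) nnl ltac:(lra).
    lra.
  lra.
Qed.

Theorem theorem1p1 :
  Un_cv (fun n : nat =>
           Rdiv (expected_edges n) (Rmult (Rmult (Rinv PI) (INR n)) (ln (INR n)))) R1 /\
  (forall eps : R, Rlt R0 eps ->
     Un_cv (fun n : nat => prob_concentrated n eps) R1).
Proof.
have P0 := PI_RGT_0; have P4 := PI_4; have P3 := PI_ge3.
split.
  move=> eps heps.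
  (* Relative to the main term the error is [de * PI], at most 4/5 of [eps] since [PI <= 4]. *)
  pose de := Rmin 1 (eps / 5).
  have de0 : 0 < de by apply: Rmin_glb_lt; lra.
  have de1 : de <= 1 by exact: Rmin_l.
  have de2 : de <= eps / 5 by exact: Rmin_r.
  have [n0 hn0] := main_bounds de0 de1; exists n0 => n /leP hn.
  have [n1 l1 hup [L [hL hlow _]]] := hn0 n hn.
  rewrite /R_dist /expected_edges expectE.
  have hle : avgCP (@Xshort n L) <= avgCP (fun _ PR PB => INR (@edges n PR PB)).
    by apply: avgCP_le => c PR PB hR hB; have [] := Xshort_le_edges hL hR hB.
  set E := avgCP (fun _ PR PB => INR (@edges n PR PB)) in hup hle *.
  have nn : 2 <= INR n by apply: (@INR_leq 2).
  set M := / PI * INR n * ln (INR n) in hup hlow *.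
  have M0 : 0 < M by apply: Rmult_lt_0_compat; [apply: Rmult_lt_0_compat; [exact: Rinv_0_lt_compat | lra] | lra].
  have eM : INR n * ln (INR n) = PI * M by rewrite /M; field; lra.
  have hd : de * (PI * M) <= 4 / 5 * eps * M.
    have : de * PI <= eps / 5 * 4 by apply: Rmult_le_compat; lra.
    move=> h; have := Rmult_le_compat_r M _ _ ltac:(lra) h; lra.
  rewrite eM in hup hlow.
  have -> : E / M - 1 = (E - M) / M by field; lra.
  rewrite /Rdiv Rabs_mult [Rabs (/ M)]Rabs_right; last by have := Rinv_0_lt_compat _ M0; lra.
  apply (Rlt_div_l _ _ M) => //.
  have : eps * M > 0 by apply: Rmult_lt_0_compat.
  by move=> ?; apply: Rabs_def1; lra.
move=> eps heps r hr.
(* 9 and 5 strictly exceed the coefficients [4 + 8 * (M / W)] and 4 obtained at the end, where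
   [M / W <= 1 / 3]. *)
pose de := Rmin 1 (r / (9 / eps ^ 2 + 5 / eps)).
have c0 : 0 < 9 / eps ^ 2 + 5 / eps.
  by apply: Rplus_lt_0_compat; apply: Rdiv_lt_0_compat; nra.
have de0 : 0 < de by apply: Rmin_glb_lt; [lra | apply: Rdiv_lt_0_compat].
have de1 : de <= 1 by exact: Rmin_l.
have de2 : de * (9 / eps ^ 2 + 5 / eps) <= r by apply (Rle_div_r _ _ _ c0); exact: Rmin_r.
have [n0 hn0] := main_bounds de0 de1; exists n0 => n /leP hn.
have [n1 l1 hup [L [hL hlow hsq]]] := hn0 n hn.
have nn : 2 <= INR n by apply: (@INR_leq 2).
have n0' : (0 < n)%N by apply: ltnW.
set M := / PI * INR n * ln (INR n) in hup hlow hsq.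
set W := INR n * ln (INR n) in hup hlow hsq.
have W0 : 0 < W by apply: Rmult_lt_0_compat; lra.
have eM : M = / PI * W by rewrite /M /W; ring.
have iP : 0 < / PI by apply: Rinv_0_lt_compat.
have iP3 : / PI <= / 3 by apply: Rinv_le_contravar; lra.
have MW : M <= W / 3 by rewrite eM; have := Rmult_le_compat_r W _ _ ltac:(lra) iP3; lra.
have M0 : 0 < M by rewrite eM; exact: Rmult_lt_0_compat.
have eta0 : 0 < eps * W by exact: Rmult_lt_0_compat.
rewrite /R_dist /prob_concentrated expectE.
set eta := eps * W in eta0.
set I := avgCP _.
have up : I <= 1.
  apply: (@Rle_trans _ (@avgCP n (fun _ _ _ => 1 + (0 * 0 + (0 * 0 + 0 * 0))))).
    by apply: avgCP_le => c PR PB _ _; case: (Rlt_dec _ _) => ? /=; lra.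
  have := @avgCP_affine n (fun _ _ _ => 0) (fun _ _ _ => 0) (fun _ _ _ => 0) 1 0 0 0 n0'.
  by move=> ->; lra.
(* Chebyshev and Markov in pointwise form: a deviation of at least [eta] forces [Rabs (x - M)] or
   [e - x] to be at least [eta / 2], so the indicator is at least 1 - 4 ((x - M) / eta)^2 - 2 (e -
   x) / eta. Expanded, this is affine in [x ^ 2], [x] and [e], with signs matching the three bounds
   of [main_bounds]. *)
have lo : 1 - 4 * M ^ 2 / eta ^ 2 + (- (4 / eta ^ 2) * avgCP (fun c PR PB => @Xshort n L c PR PB ^ 2) +
   ((8 * M / eta ^ 2 + 2 / eta) * avgCP (@Xshort n L) +
    (- (2 / eta)) * avgCP (fun _ PR PB => INR (@edges n PR PB)))) <= I.
  rewrite -avgCP_affine //; apply: avgCP_le => c PR PB hR hB.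
  have [x0 xe] := Xshort_le_edges hL hR hB.
  move: (Xshort L c PR PB) (INR (edges PR PB)) x0 xe => x e x0 xe.
  have -> : 1 - 4 * M ^ 2 / eta ^ 2 + (- (4 / eta ^ 2) * x ^ 2 + ((8 * M / eta ^ 2 + 2 / eta) * x + - (2 / eta) * e)) =
     1 - (4 * ((x - M) / eta) ^ 2 + 2 * ((e - x) / eta)) by field; lra.
  have g0 : 0 <= (e - x) / eta by apply: Rmult_le_pos; [lra | exact/Rlt_le/Rinv_0_lt_compat].
  have g1 : 0 <= ((x - M) / eta) ^ 2 by exact: pow2_ge_0.
  case: (Rlt_dec _ _) => [?|hnot] /=; first lra.
  have {hnot} hbig : eta <= Rabs (e - M) by rewrite /eta /W -Rmult_assoc; apply: Rnot_lt_le.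
  have hb2 : eta / 2 <= Rabs (x - M) \/ eta / 2 <= e - x.
    have tri : Rabs (e - M) <= Rabs (x - M) + (e - x).
      rewrite (_ : e - M = (x - M) + (e - x)); last ring.
      by apply: Rle_trans (Rabs_triang _ _) _; rewrite [Rabs (e - x)]Rabs_right; lra.
    case: (Rle_dec (eta / 2) (e - x)) => h; [by right | left; lra].
  case: hb2 => h.
    have : (1 / 2) ^ 2 <= ((x - M) / eta) ^ 2.
      rewrite -[((x - M) / eta) ^ 2]pow2_abs; apply: pow_incr; split; first lra.
      rewrite /Rdiv Rabs_mult [Rabs (/ eta)]Rabs_right; last by have := Rinv_0_lt_compat _ eta0; lra.
      by apply (Rle_div_r _ _ eta); lra.
    lra.
  have : 1 / 2 <= (e - x) / eta by apply (Rle_div_r _ _ eta); lra.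
  lra.
have k1 : 0 < 4 / eta ^ 2 by apply: Rdiv_lt_0_compat; nra.
have k2 : 0 < 8 * M / eta ^ 2 + 2 / eta.
  by apply: Rplus_lt_0_compat; apply: Rdiv_lt_0_compat; nra.
have k3 : 0 < 2 / eta by apply: Rdiv_lt_0_compat; lra.
have b1 := Rmult_le_compat_l _ _ _ (Rlt_le _ _ k1) hsq.
have b2 := Rmult_le_compat_l _ _ _ (Rlt_le _ _ k2) hlow.
have b3 := Rmult_le_compat_l _ _ _ (Rlt_le _ _ k3) hup.
have fin : 1 - 4 * M ^ 2 / eta ^ 2 + (- (4 / eta ^ 2) * (M ^ 2 + de * W ^ 2) +
   ((8 * M / eta ^ 2 + 2 / eta) * (M - de * W) + (- (2 / eta)) * (M + de * W))) =
   1 - de * ((4 + 8 * (M / W)) / eps ^ 2 + 4 / eps) by rewrite /eta; field; lra.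
have MW3 : M / W <= 1 / 3 by apply (Rle_div_l _ _ W); lra.
have last : de * ((4 + 8 * (M / W)) / eps ^ 2 + 4 / eps) < r.
  apply: Rlt_le_trans de2; apply: Rmult_lt_compat_l => //.
  apply: Rplus_lt_compat; last by apply: Rmult_lt_compat_r; [exact: Rinv_0_lt_compat | lra].
  by apply: Rmult_lt_compat_r; [apply: Rinv_0_lt_compat; nra | lra].
have lo2 : 1 - r < I by lra.
by apply: Rabs_def1; lra.
Qed.
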